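(* Let $n\ge1$ and let $\boldsymbol u_h^{n-1}\in\boldsymbol S_h$ and $\boldsymbol m_h^{n-1}\in\boldsymbol V_h$ be given. Then the fully discrete scheme (FD) described in the context has at least one solution $\boldsymbol u_h^n\in\boldsymbol S_h$, $\tilde p_h^n\in L_h$, $\boldsymbol m_h^n\in\boldsymbol V_h$, $\boldsymbol z_h^n\in\boldsymbol U_h$, $\boldsymbol k_h^n\in\boldsymbol U_h$, $\boldsymbol H_h^n\in\boldsymbol V_h$, $\varphi_h^n\in W_h$.
   Context: $\Omega\subset\mathbb R^3$ is a bounded, simply connected, convex domain with Lipschitz boundary and outward unit normal $\boldsymbol n$; $(\cdot,\cdot)$, $\|\cdot\|$ are the $L^2(\Omega)$ inner product and norm. $\boldsymbol S=H_0^1(\Omega)^3$, $\boldsymbol U=H_0(\mathrm{curl})$ (zero tangential trace), $\boldsymbol V=H_0(\mathrm{div})$ (zero normal trace), $W=L_0^2(\Omega)$ (zero mean). $\eta,\mu_0,\sigma,\tau,\chi_0,\beta$ are positive constants; $\boldsymbol H_e$ is a given external field with values in $H(\mathrm{div})$ and $\boldsymbol H_e\cdot\boldsymbol n=0$ on $\partial\Omega$. $b(\boldsymbol v;\boldsymbol m,\boldsymbol F):=\frac12(\boldsymbol v\cdot\boldsymbol F,\mathrm{div}\,\boldsymbol m)-\frac12(\boldsymbol v\cdot\boldsymbol m,\mathrm{div}\,\boldsymbol F)$. Time step $\Delta t=T/N$ ($T>0$, $N$ a positive integer), $t_n=n\Delta t$, $\boldsymbol H_e^n=\boldsymbol H_e(t_n)$,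 $\delta_tv^n=(v^n-v^{n-1})/\Delta t$. Finite element spaces. $\mathcal T_h$ is a quasi-uniform shape-regular tetrahedral triangulation of $\Omega$ of mesh size $h$; $l\ge0$ an integer. $\boldsymbol S_h=(S_h)^3\subset\boldsymbol S$ with $S_h$ a Lagrange space, $S_h|_K\supset\mathbb P_{l+1}(K)$; $\Sigma_h\subset H_0^1(\Omega)$ a Lagrange space with $\Sigma_h|_K\supset\mathbb P_l(K)$; $\boldsymbol U_h\subset\boldsymbol U$ an edge element space with $\boldsymbol U_h|_K\supset\mathbb P_l(K)^3$; $\boldsymbol V_h\subset\boldsymbol V$ a face element space with $\boldsymbol V_h|_K\supset\mathbb P_l(K)^3$; $W_h,L_h\subset W$ piecewise polynomial spaces whose restrictions to $K$ contain $\mathbb P_l(K)$. Standing assumptions: (A1) the sequences $H_0^1\xrightarrow{\mathrm{grad}}\boldsymbol U\xrightarrow{\mathrm{curl}}\boldsymbol V\xrightarrow{\mathrm{div}}W$ and $\Sigma_h\xrightarrow{\mathrm{grad}}\boldsymbol U_h\xrightarrow{\mathrm{curl}}\boldsymbol V_h\xrightarrow{\mathrm{div}}W_h$ are exact (in particular $\mathrm{grad}\,\Sigma_h\subset\boldsymbol U_h$, $\mathrm{curl}\,\boldsymbol U_h\subset\boldsymbol V_h$, $\mathrm{div}\,\boldsymbol V_h=W_h$) and commute with the classical interpolation operators $H_0^1\to\Sigma_h$, $\boldsymbol U\to\boldsymbol U_h$, $\boldsymbol V\to\boldsymbol V_h$ and the $L^2$ projection $W\to W_h$; (A2) $\sup_{\boldsymbol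 v_h\in\boldsymbol S_h}(q_h,\mathrm{div}\,\boldsymbol v_h)/\|\boldsymbol v_h\|_1\ge c\|q_h\|$ for all $q_h\in L_h$, with $c>0$ independent of $h$. Fully discrete scheme (FD): for all $\boldsymbol v_h\in\boldsymbol S_h$, $q_h\in L_h$, $\boldsymbol F_h,\boldsymbol G_h\in\boldsymbol V_h$, $\boldsymbol\zeta_h,\boldsymbol\kappa_h\in\boldsymbol U_h$, $r_h\in W_h$: $$(\delta_t\boldsymbol u_h^n,\boldsymbol v_h)-(\boldsymbol u_h^n\times\mathrm{curl}\boldsymbol u_h^n,\boldsymbol v_h)+\eta(\nabla\boldsymbol u_h^n,\nabla\boldsymbol v_h)-(\tilde p_h^n,\mathrm{div}\boldsymbol v_h)-\mu_0b(\boldsymbol v_h;\boldsymbol H_h^n,\boldsymbol m_h^n)-\tfrac{\mu_0}2(\boldsymbol v_h\times\boldsymbol k_h^n,\boldsymbol H_h^n)=0,$$ $$(\mathrm{div}\boldsymbol u_h^n,q_h)=0,$$ $$(\delta_t\boldsymbol m_h^n,\boldsymbol F_h)+b(\boldsymbol u_h^n;\boldsymbol m_h^n,\boldsymbol F_h)+\tfrac12(\boldsymbol u_h^n\times\boldsymbol F_h,\boldsymbol k_h^n)+\tfrac1\tau(\boldsymbol m_h^n,\boldsymbol F_h)-\tfrac12(\mathrm{curl}\boldsymbol z_h^n,\boldsymbol F_h)+\sigma(\mathrm{curl}\boldsymbol k_h^n,\boldsymbol F_h)+\sigma(\mathrm{div}\boldsymbol m_h^n,\mathrm{div}\boldsymbol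 F_h)-\tfrac{\chi_0}\tau(\boldsymbol H_h^n,\boldsymbol F_h)+\beta(\boldsymbol m_h^n\times(\boldsymbol m_h^n\times\boldsymbol H_h^n),\boldsymbol F_h)=0,$$ $$(\boldsymbol z_h^n,\boldsymbol\zeta_h)-(\boldsymbol u_h^n\times\boldsymbol m_h^n,\boldsymbol\zeta_h)=0,\quad(\boldsymbol k_h^n,\boldsymbol\kappa_h)-(\boldsymbol m_h^n,\mathrm{curl}\boldsymbol\kappa_h)=0,$$ $$(\boldsymbol H_h^n,\boldsymbol G_h)+(\varphi_h^n,\mathrm{div}\boldsymbol G_h)=0,\quad(\mathrm{div}\boldsymbol H_h^n+\mathrm{div}\boldsymbol m_h^n,r_h)+(\mathrm{div}\boldsymbol H_e^n,r_h)=0.$$ *)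

(* Defs.v *)
From HB Require Import structures.
From mathcomp Require Import all_boot all_order all_algebra.
From mathcomp Require Import all_classical all_reals all_analysis.

Set Implicit Arguments.
Unset Strict Implicit.
Unset Printing Implicit Defensive.

Import Order.TTheory GRing.Theory Num.Theory.
Import numFieldNormedType.Exports.

Local Open Scope classical_set_scope.
Local Open Scope ring_scope.

(* MathComp-Analysis development over an arbitrary realType R.  Points and
   vectors of R^3 are row vectors.  A field is a total function on 'rV[R]_3 of
   which only the values on Omega matter; elements of L^2 and of its subspaces
   are Borel representatives, compared almost everywhere ([aeq]). *)

Section Fields.
Context {R : realType}.
Local Notation pt := 'rV[R]_3.

Definition sfield : Type := pt -> R.
Definition vfield : Type := pt -> pt.

Definition comp (i : 'I_3) (v : vfield) : sfield := fun x => v x 0 i.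

Definition dot (u v : pt) : R := \sum_(i < 3) u 0 i * v 0 i.

(* The norm `|x| of 'rV[R]_3 is the sup norm; this is the Euclidean one. *)
Definition enorm (u : pt) : R := Num.sqrt (dot u u).

(* 'I_3 is the ring of integers mod 3, so i + 1 and i + 2 are cyclic. *)
Definition cross (u v : pt) : pt :=
  \row_(i < 3) (u 0 (i + 1) * v 0 (i + 2) - u 0 (i + 2) * v 0 (i + 1)).

Definition fdot (u v : vfield) : sfield := fun x => dot (u x) (v x).
Definition fcross (u v : vfield) : vfield := fun x => cross (u x) (v x).

Definition vec3 (p : R * R * R) : pt :=
  \row_(i < 3) nth 0 [:: p.1.1; p.1.2; p.2] i.

(* Lebesgue measure on R^3 as a product measure; sets and functions on
   'rV[R]_3 are pulled back along the coordinate bijection vec3. *)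
Definition leb3 : set (R * R * R) -> \bar R :=
  ((@lebesgue_measure R \x @lebesgue_measure R) \x @lebesgue_measure R)%E.

Definition int3 (D : set pt) (f : sfield) : R :=
  \int[leb3]_(p in vec3 @^-1` D) f (vec3 p).

Definition aeq (V : Type) (D : set pt) (f g : pt -> V) : Prop :=
  {ae leb3, forall p, D (vec3 p) -> f (vec3 p) = g (vec3 p)}.

Definition L2 (D : set pt) (f : sfield) : Prop :=
  measurable_fun (vec3 @^-1` D) (f \o vec3) /\
  (\int[leb3]_(p in vec3 @^-1` D) ((f (vec3 p)) ^+ 2)%:E < +oo)%E.

Definition L2v (D : set pt) (v : vfield) : Prop :=
  forall i, L2 D (comp i v).

Definition L20 (D : set pt) (f : sfield) : Prop := L2 D f /\ int3 D f = 0.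

Definition sip (D : set pt) (f g : sfield) : R := int3 D (fun x => f x * g x).
Definition vip (D : set pt) (u v : vfield) : R := int3 D (fdot u v).

Definition snorm (D : set pt) (f : sfield) : R := Num.sqrt (sip D f f).

End Fields.

Section TestFunctions.
Context {R : realType}.
Local Notation pt := 'rV[R]_3.

Definition partial (i : 'I_3) (f : @sfield R) : @sfield R :=
  fun x => 'D_(delta_mx 0 i : pt) (f : pt -> R^o) x.

Fixpoint Ck (k : nat) (f : @sfield R) : Prop :=
  continuous (f : pt -> R) /\
  if k is k'.+1 then
    forall i : 'I_3,
      (forall x, derivable (f : pt -> R^o) x (delta_mx 0 i : pt)) /\
      Ck k' (partial i f)
  else True.

Definition test_function (Omega : set pt) (f : @sfield R) : Prop :=
  (forall k, Ck k f) /\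
  exists2 C : set pt, compact C /\ C `<=` Omega & forall x, ~ C x -> f x = 0.

Definition vtest_function (Omega : set pt) (v : @vfield R) : Prop :=
  forall i, test_function Omega (comp i v).

Definition cdiv (v : @vfield R) : @sfield R :=
  fun x => \sum_(i < 3) partial i (comp i v) x.
Definition cgrad (f : @sfield R) : @vfield R :=
  fun x => \row_(i < 3) partial i f x.
Definition ccurl (v : @vfield R) : @vfield R :=
  fun x => \row_(i < 3) (partial (i + 1) (comp (i + 2) v) x
                         - partial (i + 2) (comp (i + 1) v) x).

End TestFunctions.

Section Sobolev.
Context {R : realType}.
Local Notation pt := 'rV[R]_3.
Implicit Types (Omega : set pt).

Definition is_wgrad Omega (f : @sfield R) (g : @vfield R) : Prop :=
  [/\ L2 Omega f, L2v Omega g &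
      forall phi, vtest_function Omega phi ->
        sip Omega f (cdiv phi) = - vip Omega g phi].

Definition is_wcurl Omega (v w : @vfield R) : Prop :=
  [/\ L2v Omega v, L2v Omega w &
      forall phi, vtest_function Omega phi ->
        vip Omega v (ccurl phi) = vip Omega w phi].

Definition is_wdiv Omega (v : @vfield R) (d : @sfield R) : Prop :=
  [/\ L2v Omega v, L2 Omega d &
      forall phi, test_function Omega phi ->
        vip Omega v (cgrad phi) = - sip Omega d phi].

(* Weak derivatives are unique up to a null set; these operators pick one
   representative, and 0 if there is no weak derivative in L^2. *)
Definition wgrad Omega (f : @sfield R) : @vfield R :=
  xget (fun=> 0 : pt) [set g : pt -> pt | is_wgrad Omega f g].
Definition wcurl Omega (v : @vfield R) : @vfield R :=
  xget (fun=> 0 : pt) [set w : pt -> pt | is_wcurl Omega v w].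
Definition wdiv Omega (v : @vfield R) : @sfield R :=
  xget (fun=> 0 : R) [set d : pt -> R | is_wdiv Omega v d].

Definition H1 Omega : set (@sfield R) :=
  [set f | exists g, is_wgrad Omega f g].
Definition H1v Omega : set (@vfield R) :=
  [set v | forall i, H1 Omega (comp i v)].

Definition h1norm Omega (f : @sfield R) : R :=
  Num.sqrt (sip Omega f f + vip Omega (wgrad Omega f) (wgrad Omega f)).

Definition gradip Omega (u v : @vfield R) : R :=
  \sum_(i < 3) vip Omega (wgrad Omega (comp i u)) (wgrad Omega (comp i v)).

Definition h1normv Omega (v : @vfield R) : R :=
  Num.sqrt (vip Omega v v + gradip Omega v v).

Definition H01 Omega : set (@sfield R) :=
  [set f | H1 Omega f /\
    forall e : R, 0 < e ->
      exists2 phi, test_function Omega phi &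
                   h1norm Omega (fun x => f x - phi x) < e].
Definition H01v Omega : set (@vfield R) :=
  [set v | forall i, H01 Omega (comp i v)].

(* The traces n x v and v . n are the functionals on the traces of H^1 given by
   Green's formulas
     <n x v, w> = (curl v, w) - (v, curl w),
     <v . n, q> = (v, grad q) + (div v, q),
   and H0curl, H0div ask that they vanish. *)
Definition H0curl Omega : set (@vfield R) :=
  [set v | (exists w, is_wcurl Omega v w) /\
    forall w, H1v Omega w ->
      vip Omega (wcurl Omega v) w - vip Omega v (wcurl Omega w) = 0].
Definition H0div Omega : set (@vfield R) :=
  [set v | (exists d, is_wdiv Omega v d) /\
    forall q, H1 Omega q ->
      vip Omega v (wgrad Omega q) + sip Omega (wdiv Omega v) q = 0].

End Sobolev.

Section Domain.
Context {R : realType}.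
Local Notation pt := 'rV[R]_3.
Implicit Types (Omega : set pt).

Definition domain Omega : Prop :=
  [/\ open Omega, connected Omega & Omega !=set0].

Definition unit_square : set (R * R) :=
  [set p | 0 <= p.1 <= 1 /\ 0 <= p.2 <= 1].

(* Every loop contracts to its base point.  For a domain (open and connected)
   path-connectedness is automatic. *)
Definition simply_connected Omega : Prop :=
  forall gam : R -> pt,
    {within `[0, 1], continuous gam} ->
    (forall t, 0 <= t <= 1 -> Omega (gam t)) ->
    gam 0 = gam 1 ->
    exists G : R * R -> pt,
      [/\ {within unit_square, continuous G},
          forall p, unit_square p -> Omega (G p),
          forall t, 0 <= t <= 1 -> G (t, 0) = gam t,
          forall t, 0 <= t <= 1 -> G (t, 1) = gam 0 &
          forall s, 0 <= s <= 1 -> G (0, s) = gam 0 /\ G (1, s) = gam 0].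

(* In suitable orthonormal coordinates (y, t) centred at a boundary point,
   Omega is locally the epigraph of a Lipschitz function. *)
Definition lipschitz_boundary Omega : Prop :=
  forall x : pt, (closure Omega `\` (Omega°)) x ->
    exists (Q : 'M[R]_3) (g : 'rV[R]_2 -> R) (r a L : R),
      [/\ Q *m Q^T = 1%:M, 0 < r, 0 < a,
          forall y y', `|g y - g y'| <= L * `|y - y'| &
          forall (y : 'rV[R]_2) (t : R), `|y| < r -> `|t| < a ->
            (Omega (x + (row_mx y (const_mx t : 'rV[R]_1) : pt) *m Q)
             <-> g y < t)].

End Domain.

Section Mesh.
Context {R : realType}.
Local Notation pt := 'rV[R]_3.

(* A tetrahedron is given by its vertices, the rows of a 4 x 3 matrix. *)
Definition tetra : Type := 'M[R]_(4, 3).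

Definition tface (K : tetra) (s : pred 'I_4) : set pt :=
  [set x | exists lam : 'rV[R]_4,
    [/\ forall i, 0 <= lam 0 i, forall i, ~~ s i -> lam 0 i = 0,
        \sum_(i < 4) lam 0 i = 1 & x = lam *m K]].

Definition thull (K : tetra) : set pt := tface K xpredT.

Definition diam (A : set pt) : R :=
  sup [set d | exists x y, [/\ A x, A y & d = enorm (x - y)]].

Definition inradius (A : set pt) : R :=
  sup [set r | exists c, forall x, enorm (x - c) <= r -> A x].

(* Two distinct elements meet in a common proper face, possibly empty. *)
Definition triangulation (Omega : set pt) (Th : seq tetra) : Prop :=
  [/\ forall K, K \in Th -> (thull K)° !=set0,
      \bigcup_(K in [set` Th]) thull K = closure Omega &
      forall K L, K \in Th -> L \in Th -> K != L ->
        exists s t : pred 'I_4,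
          [/\ exists i, ~~ s i, exists j, ~~ t j,
              thull K `&` thull L = tface K s & tface K s = tface L t]].

Definition mesh_size (Th : seq tetra) : R :=
  \big[Num.max/0]_(K <- Th) diam (thull K).

Definition shape_regular (gam : R) (Th : seq tetra) : Prop :=
  forall K, K \in Th -> diam (thull K) <= gam * inradius (thull K).

Definition quasi_uniform (theta : R) (Th : seq tetra) : Prop :=
  forall K, K \in Th -> mesh_size Th <= theta * diam (thull K).

End Mesh.

Section FiniteElements.
Context {R : realType}.
Local Notation pt := 'rV[R]_3.

(* Polynomials of total degree at most r. *)
Definition Pol (r : nat) : set (@sfield R) :=
  [set p | exists c : nat -> nat -> nat -> R, forall x : pt,
    p x = \sum_(i < r.+1) \sum_(j < r.+1) \sum_(k < r.+1 | (i + j + k <= r)%N)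
            c i j k * x 0 0 ^+ i * x 0 1 ^+ j * x 0 2 ^+ k].
Definition Polv (r : nat) : set (@vfield R) :=
  [set v | forall i, Pol r (comp i v)].

Definition linear_space (V : lmodType R) (X : set (pt -> V)) : Prop :=
  X (fun=> 0) /\
  forall (a : R) f g, X f -> X g -> X (fun x => a *: f x + g x).

(* P r stands for the polynomials of degree at most r; the local space is a
   space of polynomials of bounded degree containing those of degree l. *)
Definition local_space (V : lmodType R) (P : nat -> set (pt -> V)) (l r : nat)
    (Q : set (pt -> V)) : Prop :=
  [/\ linear_space Q, P l `<=` Q & Q `<=` P r].

(* The conforming finite element space with local spaces Q K:
   Xh = {v in X : v|_K in Q K for all K}.  The condition that Xh|_K contains
   the polynomials of degree l is put on Q K, because the boundary condition
   built into X cuts Xh|_K down on elements touching the boundary. *)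
Definition conforming_space (V : lmodType R) (P : nat -> set (pt -> V))
    (X : set (pt -> V)) (Th : seq (@tetra R)) (l : nat)
    (Xh : set (pt -> V)) : Prop :=
  exists (r : nat) (Q : @tetra R -> set (pt -> V)),
    (forall K, K \in Th -> local_space P l r (Q K)) /\
    Xh = [set v | X v /\
           forall K, K \in Th -> exists2 p, Q K p & aeq (thull K) v p].

Definition C0bar (Omega : set pt) : set (@sfield R) :=
  [set f | exists2 g : pt -> R,
             {within closure Omega, continuous g} & aeq Omega f g].

Definition lagrange_space (Omega : set pt) (Th : seq (@tetra R)) (l : nat)
    (Sh : set (@sfield R)) : Prop :=
  @conforming_space R^o Pol (H01 Omega `&` C0bar Omega) Th l Sh.

Definition edge_space (Omega : set pt) (Th : seq (@tetra R)) (l : nat)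
    (Uh : set (@vfield R)) : Prop :=
  @conforming_space 'rV[R]_3 Polv (H0curl Omega) Th l Uh.

Definition face_space (Omega : set pt) (Th : seq (@tetra R)) (l : nat)
    (Vh : set (@vfield R)) : Prop :=
  @conforming_space 'rV[R]_3 Polv (H0div Omega) Th l Vh.

(* Piecewise polynomial subspaces of L^2_0, continuous or not.  Restrictions
   are compared up to an additive constant, to account for the zero-mean
   normalization (only visible on a one-element mesh). *)
Definition pw_poly_space (Omega : set pt) (Th : seq (@tetra R)) (l : nat)
    (Wh : set (@sfield R)) : Prop :=
  [/\ @linear_space R^o Wh, Wh `<=` L20 Omega,
      forall f g, Wh f -> L20 Omega g -> aeq Omega f g -> Wh g,
      exists r, forall q K, Wh q -> K \in Th ->
        exists2 p, Pol r p & aeq (thull K) q p &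
      forall K p, K \in Th -> Pol l p ->
        exists2 q, Wh q & exists c : R, aeq (thull K) (fun x => q x + c) p].

(* (S_h)^3 *)
Definition vec_space (Sh : set (@sfield R)) : set (@vfield R) :=
  [set v | forall i, Sh (comp i v)].

Definition exact_sequence (Omega : set pt) (H : set (@sfield R))
    (U V : set (@vfield R)) (W : set (@sfield R)) : Prop :=
  [/\ [/\ forall f, H f -> U (wgrad Omega f),
          forall v, U v -> V (wcurl Omega v) &
          forall v, V v -> W (wdiv Omega v)],
      forall v, U v -> (aeq Omega (wcurl Omega v) (fun=> 0)
                        <-> exists2 f, H f & aeq Omega v (wgrad Omega f)),
      forall v, V v -> (aeq Omega (wdiv Omega v) (fun=> 0)
                        <-> exists2 w, U w & aeq Omega v (wcurl Omega w)) &
      forall q, W q -> exists2 v, V v & aeq Omega q (wdiv Omega v)].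

Definition interpolation (V : lmodType R) (Omega : set pt)
    (X Xh : set (pt -> V)) (pi : (pt -> V) -> (pt -> V)) : Prop :=
  [/\ forall f, X f -> Xh (pi f),
      forall f, Xh f -> aeq Omega (pi f) f &
      forall (a : R) f g, X f -> X g ->
        aeq Omega (pi (fun x => a *: f x + g x))
                  (fun x => a *: pi f x + pi g x)].

Definition is_L2proj (Omega : set pt) (Wh : set (@sfield R))
    (f g : @sfield R) : Prop :=
  Wh g /\ forall r, Wh r -> sip Omega g r = sip Omega f r.

Definition commuting_interpolations (Omega : set pt)
    (Sigmah : set (@sfield R)) (Uh Vh : set (@vfield R)) (Wh : set (@sfield R))
    (piS : @sfield R -> @sfield R) (piU piV : @vfield R -> @vfield R) : Prop :=
  [/\ [/\ @interpolation R^o Omega (H01 Omega) Sigmah piS,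
          @interpolation 'rV[R]_3 Omega (H0curl Omega) Uh piU &
          @interpolation 'rV[R]_3 Omega (H0div Omega) Vh piV],
      forall f, H01 Omega f ->
        aeq Omega (wgrad Omega (piS f)) (piU (wgrad Omega f)),
      forall v, H0curl Omega v ->
        aeq Omega (wcurl Omega (piU v)) (piV (wcurl Omega v)) &
      forall v, H0div Omega v ->
        is_L2proj Omega Wh (wdiv Omega v) (wdiv Omega (piV v))].

(* The quotient is 0 when v has zero norm, since x / 0 = 0 here. *)
Definition inf_sup (Omega : set pt) (c : R) (Sh : set (@vfield R))
    (Lh : set (@sfield R)) : Prop :=
  forall q, Lh q ->
    c * snorm Omega q <=
    sup [set s | exists2 v, Sh v &
           s = sip Omega q (wdiv Omega v) / h1normv Omega v].

End FiniteElements.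

Section Scheme.
Context {R : realType}.
Local Notation pt := 'rV[R]_3.

Definition bform (Omega : set pt) (v m F : @vfield R) : R :=
  2^-1 * sip Omega (fdot v F) (wdiv Omega m)
  - 2^-1 * sip Omega (fdot v m) (wdiv Omega F).

Definition ddt (dt : R) (v v0 : @vfield R) : @vfield R :=
  fun x => dt^-1 *: (v x - v0 x).

(* u0, m0 are the values at the previous time step, He the external field at
   the current one. *)
Record FD_solution (Omega : set pt) (eta mu0 sigma tau chi0 beta dt : R)
    (Sh : set (@vfield R)) (Lh : set (@sfield R)) (Uh Vh : set (@vfield R))
    (Wh : set (@sfield R)) (He u0 m0 : @vfield R)
    (u : @vfield R) (p : @sfield R) (m z k H : @vfield R) (phi : @sfield R)
    : Prop := {
  FD_momentum : forall v, Sh v ->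
    vip Omega (ddt dt u u0) v
    - vip Omega (fcross u (wcurl Omega u)) v
    + eta * gradip Omega u v
    - sip Omega p (wdiv Omega v)
    - mu0 * bform Omega v H m
    - mu0 / 2 * vip Omega (fcross v k) H = 0;
  FD_incompressible : forall q, Lh q -> sip Omega (wdiv Omega u) q = 0;
  FD_magnetization : forall F, Vh F ->
    vip Omega (ddt dt m m0) F
    + bform Omega u m F
    + 2^-1 * vip Omega (fcross u F) k
    + tau^-1 * vip Omega m F
    - 2^-1 * vip Omega (wcurl Omega z) F
    + sigma * vip Omega (wcurl Omega k) F
    + sigma * sip Omega (wdiv Omega m) (wdiv Omega F)
    - chi0 / tau * vip Omega H F
    + beta * vip Omega (fcross m (fcross m H)) F = 0;
  FD_z : forall zeta, Uh zeta ->
    vip Omega z zeta - vip Omega (fcross u m) zeta = 0;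
  FD_k : forall kappa, Uh kappa ->
    vip Omega k kappa - vip Omega m (wcurl Omega kappa) = 0;
  FD_H : forall G, Vh G ->
    vip Omega H G + sip Omega phi (wdiv Omega G) = 0;
  FD_magnetostatic : forall r, Wh r ->
    sip Omega (fun x => wdiv Omega H x + wdiv Omega m x) r
    + sip Omega (wdiv Omega He) r = 0
}.

End Scheme.

(* Main.v *)
(* All function spaces of the scheme are finite-dimensional and their elements
   are bounded piecewise polynomials, so that z, k, H, the pressure and phi can
   be eliminated by linear algebra.  Put w = m - mu0 H.  The magnetostatic
   equations determine m and H affinely from w, and the scheme becomes a
   polynomial system F(y) = 0 in the coordinates y of (u, w), where u ranges
   over the discretely divergence-free velocities.  The sum of F_i(y) y_i is the
   momentum residual tested with u plus the magnetization residual tested with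
   m - mu0 H; all trilinear terms cancel in it, and Young's inequality makes it
   positive for large |y|.

   Brouwer's theorem is not needed to find the zero.  For an odd D larger than
   deg F, the ideal generated by e y_i^D + F_i has a quotient of the odd
   dimension D^n, on which the multiplications by the coordinates are commuting
   operators; a common eigenvector is a real zero of the perturbed system.
   There the sum of F_i(y) y_i is nonpositive, so these zeros stay in a fixed
   ball, and e tends to 0.  Lagrange multipliers for the two divergence
   constraints finally recover the pressure and phi. *)

Require Import Defs.
From HB Require Import structures.
From mathcomp Require Import all_boot all_order all_algebra.
From mathcomp Require Import ring lra zify.
From mathcomp Require ssrcomplements mpoly complex.

Set Implicit Arguments.
Unset Strict Implicit.
Unset Printing Implicit Defensive.

Import Order.TTheory GRing.Theory Num.Theory.


(** The combination m - mu0 H is forced. In the momentum equation tested with u the terms - mu0 b(u;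
    H, m) and - mu0/2 (u x k, H) have no sign; their opposites come from the magnetization equation
    tested with - mu0 H, while testing with m controls m itself. The coordinates of w must therefore
    be the unknowns, so that w is also the test function in the sum of F_i(y) y_i. The external
    field is traded for its interpolant in V_h, so that its sum with m + H is a divergence-free
    element of V_h, to which H is orthogonal. Oddness of D serves twice: it makes D^n odd, and it
    gives y_i^(D+1) >= 0 at a perturbed zero. A second obstacle shapes most of the development.
    [wgrad], [wcurl] and [wdiv] choose representatives arbitrarily, so they are linear only almost
    everywhere. Working with them requires uniqueness of weak derivatives, hence the fundamental
    lemma, hence bump functions; the discrete spaces are finite-dimensional only modulo null sets,
    and each term of the scheme is treated as a linear functional that ignores null sets. *)

Module OddSystem.
Import ssrcomplements mpoly.
Local Open Scope ring_scope.

(** * Real zeros of polynomial systems *)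

Section Root.
Variables (R : rcfType) (n d : nat) (P : 'I_n -> {mpoly R[n]}).
Hypotheses (d_odd : odd d) (szP : forall i, (msize (P i) <= d)%N).

Let d_gt0 : (0 < d)%N. Proof. exact: odd_gt0. Qed.
Let G i : {mpoly R[n]} := 'X_i ^+ d + P i.

(** [msize] is the degree plus one: f agrees with ['X_[m]] up to terms of strictly lower total
    degree. *)
Let lead (f : {mpoly R[n]}) m := (msize (f - 'X_[m]) <= mdeg m)%N.

Let leadM f g m m' : lead f m -> lead g m' -> lead (f * g) (m + m')%MM.
Proof.
rewrite /lead => hf hg.
have hM (p q : {mpoly R[n]}) a b :
    (msize p <= a -> msize q <= b.+1 -> msize (p * q) <= a + b)%N.
  move=> hp hq.
  have [->|p0] := eqVneq p 0; first by rewrite mul0r msize0.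
  have [->|q0] := eqVneq q 0; first by rewrite mulr0 msize0.
  rewrite msizeM //; case: (msize q) hq => [|k] hq.
    by rewrite addn0 (leq_trans (leq_pred _)) // (leq_trans hp) // leq_addr.
  by rewrite addnS /= leq_add.
have -> : f * g - 'X_[m + m'] =
    (g - 'X_[m']) * 'X_[m] + (f - 'X_[m]) * (g - 'X_[m']) + (f - 'X_[m]) * 'X_[m'].
  by rewrite mpolyXD; ring.
rewrite mdegD.
have h1 : (msize ((g - 'X_[m']) * 'X_[m]) <= mdeg m + mdeg m')%N.
  by rewrite addnC hM // msizeX.
have h2 : (msize ((f - 'X_[m]) * (g - 'X_[m'])) <= mdeg m + mdeg m')%N.
  by rewrite hM // (leq_trans hg).
have h3 : (msize ((f - 'X_[m]) * 'X_[m']) <= mdeg m + mdeg m')%N.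
  by rewrite hM // msizeX.
by rewrite !(leq_trans (msizeD_le _ _)) // geq_max ?h3 ?andbT
  !(leq_trans (msizeD_le _ _)) // geq_max h1 h2.
Qed.

Let lead1 : lead 1 0%MM. Proof. by rewrite /lead mpolyX0 subrr msize0. Qed.

(* B m is 'X_[m] with every factor 'X_i ^+ d replaced by G i.  Its leading part is
   'X_[m], so T : 'X_[m] |-> B m is unitriangular, hence bijective. *)
Let quo (m : 'X_{1..n}) : 'X_{1..n} := [multinom m i %/ d | i < n]%N.
Let rmd (m : 'X_{1..n}) : 'X_{1..n} := [multinom m i %% d | i < n]%N.
Let B (m : 'X_{1..n}) : {mpoly R[n]} := (\prod_i G i ^+ quo m i) * 'X_[rmd m].

Let leadB m : lead (B m) m.
Proof.
have -> : lead (B m) m = lead (B m) (\sum_(i < n) U_(i) *+ (quo m i * d)%N + rmd m)%MM.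
  congr (lead _ _); apply/mnmP => j; rewrite mnmDE mnm_sumE (bigD1 j) //= big1 ?addn0.
    by rewrite mulmnE mnm1E eqxx mul1n !mnmE -divn_eq.
  by move=> i /negbTE ij; rewrite mulmnE mnm1E ij.
apply: leadM; last by rewrite /lead subrr msize0.
elim/big_rec2 : _ => [//|i f m' _ hm']; apply: leadM => //.
elim: (quo m i) => [|k ih].
  have -> : (U_(i) *+ (0 * d)%N = 0 :> 'X_{1..n})%MM.
    by apply/mnmP => j; rewrite mulmnE mul0n muln0 ?mnm0E.
  by rewrite expr0.
have -> : (U_(i) *+ (k.+1 * d)%N = U_(i) *+ d + U_(i) *+ (k * d)%N :> 'X_{1..n})%MM.
  by apply/mnmP => j; rewrite mnmDE !mulmnE mulSn mulnDr.
rewrite exprS.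
by apply: leadM => //; rewrite /lead /G mpolyXn addrAC subrr add0r mdegMn mdeg1 mul1n.
Qed.

Let T (p : {mpoly R[n]}) := \sum_(m <- msupp p) p@_m *: B m.

Let TE k p : (msize p <= k)%N -> T p = \sum_(m : 'X_{1..n < k}) p@_m *: B m.
Proof.
move=> hk; rewrite /T (big_mksub [the subFinType _ of 'X_{1..n < k}]) ?msupp_uniq //=; last first.
  by move=> x /msize_mdeg_lt /leq_trans; apply.
by rewrite big_rmcond //= => j /memN_msupp_eq0 ->; rewrite scale0r.
Qed.

Let T_lin : linear T.
Proof.
move=> a p q.
pose k := maxn (msize (a *: p + q)) (maxn (msize p) (msize q)).
rewrite !(@TE k) ?leq_max ?leqnn ?orbT // scaler_sumr -big_split /=.
by apply: eq_bigr => m _; rewrite mcoeffD mcoeffZ scalerDl scalerA.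
Qed.
Let TD p q : T (p + q) = T p + T q.
Proof. by have := T_lin 1 p q; rewrite !scale1r. Qed.
Let T0 : T 0 = 0. Proof. by rewrite /T msupp0 big_nil. Qed.
Let TN p : T (- p) = - T p.
Proof. by have := T_lin (-1) p 0; rewrite T0 !addr0 !scaleN1r. Qed.
Let TZ a p : T (a *: p) = a *: T p.
Proof. by have := T_lin a p 0; rewrite T0 !addr0. Qed.
Let T_sum (I : Type) (r : seq I) (F : I -> {mpoly R[n]}) :
  T (\sum_(i <- r) F i) = \sum_(i <- r) T (F i).
Proof. by elim/big_rec2 : _ => // i p q _ <-; rewrite TD. Qed.
Let TX m : T 'X_[m] = B m.
Proof. by rewrite /T msuppX big_seq1 mcoeffX eqxx scale1r. Qed.

Let szT p : (msize (p - T p) <= (msize p).-1)%N.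
Proof.
rewrite {1}[p]mpolyE /T -sumrB big_seq.
rewrite (leq_trans (msize_sum _ _ _)) //; apply/bigmax_leqP_seq => m _ hm.
rewrite -scalerBr (leq_trans (msizeZ_le _ _)) // -opprB msizeN.
rewrite (leq_trans (leadB m)) //.
by have := msize_mdeg_lt hm; case: (msize p).
Qed.

(** T alters a polynomial only by terms of lower degree, so a nonzero p with T p = 0 would have
    smaller size than itself. For surjectivity, p - T p is smaller than p and is reached by
    induction. *)
Let T_inj p : T p = 0 -> p = 0.
Proof.
move=> h; have := szT p; rewrite h subr0 => {}h.
by apply/eqP; rewrite -msize_poly_eq0; move: h; case: (msize p) => //= k; rewrite ltnn.
Qed.

Let T_surj p : {q | T q = p}.
Proof.
have [k] := ubnP (msize p); elim: k p => // k ih p hp.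
have [q hq] : {q | T q = p - T p}.
  have [->|p0] := eqVneq p 0; first by exists 0; rewrite T0 subrr.
  apply: ih; rewrite (leq_ltn_trans (szT p)) //.
  by have := p0; rewrite -msize_poly_eq0; move: hp; case: (msize p).
by exists (p + q); rewrite TD hq addrC subrK.
Qed.
Let S p := projT1 (T_surj p).
Let TS p : T (S p) = p. Proof. exact: projT2 (T_surj p). Qed.
Let ST p : S (T p) = p.
Proof. by apply/eqP; rewrite -subr_eq0; apply/eqP/T_inj; rewrite TD TN TS subrr. Qed.
Let S_lin : linear S.
Proof. by move=> a p q; rewrite -{1}(TS p) -{1}(TS q) -TZ -TD ST. Qed.

Let BG i m : B (m + U_(i) *+ d)%MM = G i * B m.
Proof.
rewrite /B mulrA; congr (_ * 'X_[_]); last first.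
  apply/mnmP => j; rewrite [LHS]mnmE [RHS]mnmE mnmDE mulmnE mnm1E.
  by case: eqP => _; rewrite ?mul1n ?modnDr // mul0n addn0.
rewrite (bigD1 i) //= [in RHS](bigD1 i) //= mulrA -exprS; congr (_ ^+ _ * _).
  by rewrite [LHS]mnmE [X in _ = X.+1]mnmE mnmDE mulmnE mnm1E eqxx mul1n divnDr // divnn d_gt0 addn1.
apply: eq_bigr => j ji.
by congr (_ ^+ _); rewrite [LHS]mnmE [RHS]mnmE mnmDE mulmnE mnm1E eq_sym (negbTE ji) mul0n addn0.
Qed.

(** T is not multiplicative, but it turns multiplication by ['X_i ^+ d] into multiplication by
    [G i]. Hence it carries the ideal of the pure powers, whose quotient has an evident monomial
    basis, onto the ideal of the [G i]. *)
Let TG i p : T ('X_i ^+ d * p) = G i * T p.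
Proof.
rewrite [in LHS](mpolyE p) mulr_sumr T_sum [T p]/T mulr_sumr; apply: eq_bigr => m _.
by rewrite -!scalerAr TZ; congr (_ *: _); rewrite mpolyXn -mpolyXD addmC TX BG.
Qed.

Let I := {ffun 'I_n -> 'I_d}.
Let N := #|{: I}|.
Let mono (k : 'I_N) : 'X_{1..n} := [multinom (enum_val k : I) i : nat | i < n].

Let mono_inj : injective mono.
Proof.
move=> k l /mnmP h; apply: enum_val_inj; apply/ffunP => i.
by apply: val_inj; have := h i; rewrite !mnmE.
Qed.

(* Coordinates of p modulo the ideal (G i)_i, in the basis of the monomials with
   all exponents < d. *)
Let c p : 'rV[R]_N := \row_k (S p)@_(mono k).
Let vl (v : 'rV[R]_N) : {mpoly R[n]} := \sum_k v 0 k *: 'X_[mono k].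

Let c_lin : linear c.
Proof. by move=> a p q; apply/rowP => k; rewrite !mxE S_lin mcoeffD mcoeffZ. Qed.
Let cD p q : c (p + q) = c p + c q.
Proof. by have := c_lin 1 p q; rewrite !scale1r. Qed.
Let c0 : c 0 = 0.
Proof. by apply/rowP => k; rewrite !mxE -T0 ST mcoeff0. Qed.
Let cZ a p : c (a *: p) = a *: c p.
Proof. by have := c_lin a p 0; rewrite c0 !addr0. Qed.
Let c_sum (J : Type) (r : seq J) (F : J -> {mpoly R[n]}) :
  c (\sum_(i <- r) F i) = \sum_(i <- r) c (F i).
Proof. by elim/big_rec2 : _ => // i p q _ <-; rewrite cD. Qed.

Let T_mono k : T 'X_[mono k] = 'X_[mono k].
Proof.
rewrite TX /B big1 => [|i _]; last first.
  by rewrite !mnmE divn_small ?expr0.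
rewrite mul1r; congr 'X_[_]; apply/mnmP => i.
by rewrite !mnmE modn_small.
Qed.

Let T_vl v : T (vl v) = vl v.
Proof. by rewrite T_sum; apply: eq_bigr => k _; rewrite TZ T_mono. Qed.

Let c_vl v : c (vl v) = v.
Proof.
apply/rowP => k; rewrite !mxE -{1}T_vl ST raddf_sum /= (bigD1 k) //= big1.
  by rewrite mcoeffZ mcoeffX eqxx mulr1 addr0.
by move=> l lk; rewrite mcoeffZ mcoeffX (inj_eq mono_inj) (negbTE lk) mulr0.
Qed.

Let c_G i f : c (G i * f) = 0.
Proof.
rewrite -(TS f) -TG; apply/rowP => k; rewrite !mxE ST.
apply/eqP; rewrite mpolyXn mcoeff_eq0; apply/negP.
rewrite mulrC (perm_mem (msuppMX _ _)) => /mapP[m _] /mnmP /(_ i); rewrite mnmE mnmDE mulmnE mnm1E eqxx mul1n.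
by move=> e; have := ltn_ord ((enum_val k : I) i); rewrite e ltnNge leq_addr.
Qed.

(** p - vl (c p) is T of a polynomial each of whose monomials has some exponent at least d; it lies
    in the ideal of the [G i], and so do its multiples. Multiplication is thereby well defined on
    coordinates. *)
Let c_sub f p : c (f * (p - vl (c p))) = 0.
Proof.
have cI q : (forall k, q@_(mono k) = 0) -> c (f * T q) = 0.
  move=> hq; rewrite /T mulr_sumr c_sum big_seq big1 // => m hm.
  rewrite -scalerAr cZ.
  case: (pickP (fun i => d <= m i)%N) => [i hi|hm'].
    have -> : m = ((m - U_(i) *+ d) + U_(i) *+ d)%MM.
      apply/mnmP => j; rewrite mnmDE mnmBE mulmnE mnm1E.
      by case: eqP => [<-|_]; rewrite ?mul1n ?subnK // mul0n subn0 addn0.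
    by rewrite BG mulrCA c_G scaler0.
  pose r : I := [ffun i => Ordinal (ltn_pmod (m i) d_gt0)].
  have := hq (enum_rank r).
  have -> : mono (enum_rank r) = m.
    apply/mnmP => i; rewrite mnmE enum_rankK ffunE /= modn_small //.
    by rewrite ltnNge hm'.
  by move=> ->; rewrite scale0r.
have -> : p - vl (c p) = T (S p - vl (c p)) by rewrite TD TN TS T_vl.
apply: cI => k; rewrite mcoeffB.
rewrite (_ : (vl (c p))@_(mono k) = (S p)@_(mono k)) ?subrr //.
rewrite raddf_sum /= (bigD1 k) //= big1.
  by rewrite mcoeffZ mcoeffX eqxx mulr1 addr0 mxE.
by move=> l lk; rewrite mcoeffZ mcoeffX (inj_eq mono_inj) (negbTE lk) mulr0.
Qed.

Let cM f p : c (f * p) = c (f * vl (c p)).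
Proof. by apply/eqP; rewrite -subr_eq0 -[X in _ - X]scale1r -scaleN1r scalerA mulr1 -cZ -cD scaleN1r -mulrBr c_sub. Qed.

Let M i : 'M[R]_N := \matrix_k c ('X_i * 'X_[mono k]).

Let vlZ a v : vl (a *: v) = a *: vl v.
Proof. by rewrite scaler_sumr; apply: eq_bigr => k _; rewrite mxE scalerA. Qed.

Let mulM v i : v *m M i = c ('X_i * vl v).
Proof.
rewrite mulmx_sum_row mulr_sumr c_sum; apply: eq_bigr => k _.
by rewrite rowK -scalerAr cZ.
Qed.

Lemma odd_system_root :
  exists x : 'I_n -> R, forall i, x i ^+ d + (P i).@[x] = 0.
Proof.
have N_odd : odd N by rewrite /N card_ffun !card_ord oddX d_odd orbT.
have comm i j : M i *m M j = M j *m M i.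
  apply/row_matrixP => k; rewrite !rowE !mulmxA !mulM -!cM.
  by rewrite mulrCA.
(* Commuting operators on a real space of odd dimension have a common eigenvector. *)
have [|||f g|v v0 hv] := @complex.Lemma4 R n N 1%:M _ (0 :: [seq M i | i <- enum 'I_n]).
- by rewrite mxrank1 dvdn2 N_odd.
- by rewrite /= size_map size_enum_ord.
- by move=> f _; rewrite submx1.
- rewrite !inE => /predU1P[->|/mapP[i _ ->]]; first by rewrite mulmx0 mul0mx.
  by case/predU1P => [->|/mapP[j _ ->]]; rewrite ?mulmx0 ?mul0mx.
have [x hx] : exists x : 'I_n -> R, forall i, c ('X_i * vl v) = x i *: v.
  suff /fin_all_exists[x hx] : forall i, exists a, c ('X_i * vl v) = a *: v by exists x.
  move=> i; have [|a /eigenspaceP ha] := hv (M i).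
    by rewrite inE map_f ?orbT // mem_enum.
  by exists a; rewrite -mulM.
exists x => i.
(* On the common eigenvector every polynomial acts as the scalar p(x), where x collects the
   eigenvalues. As [G i] acts as 0 and v is nonzero, x is a zero of [G i]. *)
pose good p := c (p * vl v) = p.@[x] *: v.
have goodM p q : good p -> good q -> good (p * q).
  move=> hp hq; rewrite /good -mulrA cM hq vlZ -scalerAr cZ hp scalerA.
  by rewrite mevalM mulrC.
have good1 : good 1 by rewrite /good mul1r c_vl meval1 scale1r.
have goodX k m : good ('X_k ^+ m).
  elim: m => [|m ih]; first by rewrite expr0.
  by rewrite exprS; apply: goodM => //; rewrite /good mevalXU.
have goodall p : good p.
  elim/mpolyind : p => [|a m p _ _ ih].
    by rewrite /good mul0r c0 meval0 scale0r.
  rewrite /good mulrDl cD -scalerAl cZ ih mevalD mevalZ scalerDl -scalerA.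
  congr (_ *: _ + _); rewrite -/(good _) mpolyXE_id.
  by elim/big_ind : _ => // k _; exact: goodX.
have := goodall (G i); rewrite /good c_G => /esym/eqP.
rewrite scaler_eq0 (negbTE v0) orbF => /eqP.
by rewrite /G mevalD rmorphXn /= mevalXU.
Qed.

End Root.

(** * Polynomial functions and coercive polynomial maps *)

(** Closure rules rather than explicit polynomials: the components of F are integrals of products of
    fields, to which such rules apply term by term. *)
Inductive polyfun (R : realDomainType) (n : nat) : ('rV[R]_n -> R) -> Prop :=
| polyfun_cst a : polyfun (fun=> a)
| polyfun_coord i : polyfun (fun x => x 0 i)
| polyfunD f g : polyfun f -> polyfun g -> polyfun (fun x => f x + g x)
| polyfunM f g : polyfun f -> polyfun g -> polyfun (fun x => f x * g x).

Lemma polyfun_mpoly (R : realDomainType) (n : nat) (f : 'rV[R]_n -> R) :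
  polyfun f -> exists p : {mpoly R[n]}, forall x, f x = p.@[x 0].
Proof.
elim => [a|i|{}f g _ [p hp] _ [q hq]|{}f g _ [p hp] _ [q hq]].
- by exists a%:MP => x; rewrite mevalC.
- by exists 'X_i => x; rewrite mevalXU.
- by exists (p + q) => x; rewrite mevalD hp hq.
- by exists (p * q) => x; rewrite mevalM hp hq.
Qed.

(** D is chosen before e: the limit e -> 0 needs one exponent for all perturbations. Dividing the
    system by e makes the added powers monic. *)
Lemma perturbed_root (R : rcfType) (n : nat) (F : 'I_n -> 'rV[R]_n -> R) :
  (forall i, polyfun (F i)) ->
  exists D, odd D /\ forall e, 0 < e ->
    exists x : 'rV[R]_n, forall i, F i x + e * x 0 i ^+ D = 0.
Proof.
move=> hF.
have [P hP] : exists P : 'I_n -> {mpoly R[n]}, forall i x, F i x = (P i).@[x 0].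
  apply: (@fin_all_exists _ (fun=> {mpoly R[n]}) (fun i p => forall x, F i x = p.@[x 0])).
  by move=> i; exact: polyfun_mpoly.
pose D := (\max_i msize (P i)).*2.+1.
exists D; split; first by rewrite /= odd_double.
move=> e e0.
have [||x hx] := @odd_system_root R n D (fun i => e^-1 *: P i).
- by rewrite /= odd_double.
- move=> i; rewrite (leq_trans (msizeZ_le _ _)) // /D.
  rewrite (@leq_trans (\max_i msize (P i))) ?(@leq_bigmax _ (fun i => msize (P i))) //.
  by rewrite -addnn ltnW // ltnS leq_addr.
exists (\row_i x i) => i; rewrite hP mxE.
rewrite (@meval_eq _ _ _ x) => [|j]; last by rewrite mxE.
have := hx i; rewrite mevalZ => /(congr1 (fun y => e * y)).
by rewrite mulr0 mulrDr mulrA divff ?gt_eqF // mul1r addrC.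
Qed.

End OddSystem.

From mathcomp Require Import all_classical all_reals all_analysis measurable_realfun.
Import numFieldNormedType.Exports.
Local Open Scope classical_set_scope.
Local Open Scope ring_scope.

Local Notation polyfun := OddSystem.polyfun.

Lemma polyfun_continuous (R : realType) (n : nat) (f : 'rV[R]_n -> R) :
  polyfun f -> continuous f.
Proof.
elim => [a|i|{}f g _ hf _ hg|{}f g _ hf _ hg] x.
- exact: cst_continuous.
- exact: coord_continuous.
- by apply: continuousD; [exact: hf|exact: hg].
- by apply: continuousM; [exact: hf|exact: hg].
Qed.

Lemma polyfun_sum (R : realType) (n : nat) (I : Type) (r : seq I) (F : I -> 'rV[R]_n -> R) :
  (forall i, polyfun (F i)) -> polyfun (fun x => \sum_(i <- r) F i x).
Proof.
move=> hF; elim: r => [|i r ih].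
  rewrite (_ : (fun _ => _) = fun=> 0); first exact: OddSystem.polyfun_cst.
  by apply/funext => x; rewrite big_nil.
rewrite (_ : (fun _ => _) = fun x => F i x + \sum_(i <- r) F i x).
  exact: OddSystem.polyfunD.
by apply/funext => x; rewrite big_cons.
Qed.

(** No convergent subsequence of perturbed zeros is extracted. The sum of squares g attains its
    minimum on the compact ball K, and the perturbed zero for e, which lies in K, bounds this
    minimum by a constant times e^2. *)
Lemma coercive_polynomial_zero (R : realType) (n : nat) (F : 'I_n -> 'rV[R]_n -> R) (r : R) :
  (forall i, polyfun (F i)) ->
  (forall x : 'rV[R]_n, r < \sum_i x 0 i ^+ 2 -> 0 < \sum_i F i x * x 0 i) ->
  exists x, forall i, F i x = 0.
Proof.
move=> hF hcoer.
(* For negative r, coercivity at x = 0 would read 0 < 0. *)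
have r0 : 0 <= r.
  rewrite leNgt; apply/negP => r0; have := hcoer 0.
  by rewrite !big1 ?ltxx => [|i _|i _]; rewrite ?mxE ?mulr0 ?expr0n //; move/(_ r0).
pose K := [set x : 'rV[R]_n | \sum_i x 0 i ^+ 2 <= r].
have hK x i : K x -> x 0 i ^+ 2 <= r.
  move=> hx; rewrite (le_trans _ hx) // (bigD1 i) //= lerDl.
  by apply: sumr_ge0 => j _; exact: sqr_ge0.
pose g x := \sum_i F i x * F i x.
have gpoly : polyfun g by apply: polyfun_sum => i; exact: OddSystem.polyfunM.
have g_ge0 x : 0 <= g x by apply: sumr_ge0 => i _; rewrite -expr2 sqr_ge0.
have cK : compact K.
  have cB := @rV_compact _ n (fun=> `[(- (1 + r)), (1 + r)]%classic)
    (fun=> @segment_compact R _ _).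
  apply: subclosed_compact cB _; last first.
    move=> x hx i /=; have := hK _ i hx; rewrite in_itv /= => h.
    by apply/andP; split; nra.
  have -> : K = (fun x : 'rV[R]_n => \sum_i x 0 i ^+ 2) @^-1` [set y | y <= r] by [].
  apply: closed_comp => [x _|]; last exact: closed_le.
  apply: polyfun_continuous; apply: polyfun_sum => i.
  under eq_fun do rewrite expr2.
  by apply: OddSystem.polyfunM; exact: OddSystem.polyfun_coord.
have K0 : K !=set0.
  by exists 0; rewrite /K /= big1 // => i _; rewrite mxE expr0n.
have [x hxK hx] := EVT_min_rV K0 cK (continuous_subspaceT (polyfun_continuous gpoly)).
have {hx} hmin y : K y -> g x <= g y by move=> Ky; apply: hx; rewrite inE.
exists x; suff gx0 : g x = 0.
  move=> i; apply/eqP; rewrite -sqrf_eq0 expr2 eq_le -{1}gx0.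
  rewrite -expr2 sqr_ge0 andbT /g (bigD1 i) //= -expr2 lerDl.
  by apply: sumr_ge0 => j _; rewrite -expr2 sqr_ge0.
apply/eqP; rewrite eq_le g_ge0 andbT.
have [D [Dodd hD]] := OddSystem.perturbed_root hF.
(* On K each y_i^2 is at most r, so (y_i^D)^2 = (y_i^2)^D is below (1 + r)^D, and e^2 C bounds the
   sum of the (e y_i^D)^2. *)
pose C := \sum_(i < n) (1 + r) ^+ D.
have C0 : 0 <= C by apply: sumr_ge0 => i _; apply: exprn_ge0; lra.
(* A zero y of F + e y^D satisfies sum_i F_i(y) y_i <= 0, hence lies in K. *)
have hg e : 0 < e -> g x <= e ^+ 2 * C.
  move=> e0; have [y hy] := hD e e0.
  have Fy i : F i y = - (e * y 0 i ^+ D) by apply/eqP; rewrite -addr_eq0 hy.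
  have Ky : K y.
    rewrite /K /= leNgt; apply/negP => /hcoer; apply/negP; rewrite -leNgt.
    rewrite -oppr_ge0 -sumrN; apply: sumr_ge0 => i _.
    rewrite Fy mulNr opprK -mulrA -exprSr mulr_ge0 ?(ltW e0) //.
    by apply: exprn_even_ge0; rewrite /= Dodd.
  rewrite (le_trans (hmin _ Ky)) // /g /C mulr_sumr ler_sum // => i _.
  rewrite Fy mulrNN mulrACA -!expr2 ler_wpM2l ?sqr_ge0 //.
  rewrite -exprM mulnC exprM lerXn2r ?nnegrE ?sqr_ge0 //; first lra.
  by have := hK _ i Ky; lra.
rewrite leNgt; apply/negP => gx0.
have [e e0 he] : exists2 e, 0 < e & e ^+ 2 * C < g x.
  exists (Num.min 1 (g x / (2 * (C + 1)))).
    by rewrite lt_min ltr01 divr_gt0 // mulr_gt0 //; lra.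
  set e := Num.min _ _.
  have e1 : e <= 1 by rewrite ge_min lexx.
  have e2 : e <= g x / (2 * (C + 1)) by rewrite ge_min lexx orbT.
  have e0 : 0 < e by rewrite lt_min ltr01 divr_gt0 // mulr_gt0 //; lra.
  move: e2; rewrite ler_pdivlMr; last by lra.
  by nra.
by have := hg e e0; rewrite leNgt he.
Qed.

(** * Borel representatives of square integrable fields *)

Section SquareIntegrable.
Context d (T : measurableType d) (R : realType) (mu : {measure set T -> \bar R}).
Variables (D : set T) (mD : measurable D).
Implicit Types f g : T -> R.

Definition sqi f :=
  measurable_fun D f /\ (\int[mu]_(x in D) ((f x) ^+ 2)%:E < +oo)%E.
Definition ae_bounded f := exists C : R, {ae mu, forall x, D x -> `|f x| <= C}.

Let sqi_integrable f : sqi f -> mu.-integrable D (fun x => (f x ^+ 2)%:E).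
Proof.
move=> [mf fi]; apply/integrableP; split.
  exact/measurable_EFinP/measurable_funX.
under eq_integral do rewrite gee0_abs ?lee_fin ?sqr_ge0 //.
exact: fi.
Qed.

Let integrable_sqi f : measurable_fun D f ->
  mu.-integrable D (fun x => (f x ^+ 2)%:E) -> sqi f.
Proof.
move=> mf /integrableP[_]; split=> //.
by under eq_integral do rewrite -[X in X%:E]ger0_norm ?sqr_ge0 //.
Qed.

Lemma sqi_mul_integrable f g : sqi f -> sqi g ->
  mu.-integrable D (EFin \o (fun x => f x * g x)).
Proof.
move=> sf sg; have := integrableD mD (sqi_integrable sf) (sqi_integrable sg).
apply: le_integrable => //.
  by apply/measurable_EFinP/measurable_funM; [case: sf|case: sg].
move=> x Dx /=; rewrite lee_fin [leRHS]ger0_norm ?addr_ge0 ?sqr_ge0 //.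
by rewrite ler_norml; apply/andP; split; nra.
Qed.

Lemma sqi_lin a f g : sqi f -> sqi g -> sqi (fun x => a * f x + g x).
Proof.
move=> sf sg; have [mf _] := sf; have [mg _] := sg; apply: integrable_sqi.
  by apply: measurable_funD => //; exact: measurable_funM.
have h1 := integrableZl mD (2 * a ^+ 2) (sqi_integrable sf).
have h2 := integrableZl mD 2 (sqi_integrable sg).
apply: le_integrable (integrableD mD h1 h2) => //.
  apply/measurable_EFinP/measurable_funX.
  by apply: measurable_funD => //; exact: measurable_funM.
move=> x Dx /=; rewrite lee_fin ger0_norm ?sqr_ge0 // ger0_norm.
  rewrite -subr_ge0 (_ : _ - _ = (a * f x - g x) ^+ 2) ?sqr_ge0 //; ring.
by rewrite addr_ge0 // mulr_ge0 ?sqr_ge0 // mulr_ge0 ?sqr_ge0.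
Qed.

Lemma sqi0 : sqi (fun=> 0).
Proof.
split; first exact: measurable_cst.
by rewrite integral0_eq ?ltry // => x _; rewrite expr0n.
Qed.

Lemma sqi_boundedM f g : measurable_fun D f -> ae_bounded f -> sqi g ->
  sqi (fun x => f x * g x).
Proof.
move=> mf [C hC] sg; have [mg ig] := sg; split; first exact: measurable_funM.
apply: (@le_lt_trans _ _ (\int[mu]_(x in D) ((C ^+ 2)%:E * (g x ^+ 2)%:E))%E).
  apply: ae_ge0_le_integral => //.
  - by move=> x _; rewrite lee_fin sqr_ge0.
  - by apply/measurable_EFinP/measurable_funX; exact: measurable_funM.
  - by move=> x _; rewrite mule_ge0 // lee_fin sqr_ge0.
  - under eq_fun do rewrite -EFinM.
    apply/measurable_EFinP/measurable_funM => //.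
    exact: measurable_funX.
  - apply: filterS hC => x /= h Dx; rewrite -EFinM lee_fin exprMn.
    rewrite ler_wpM2r ?sqr_ge0 // -real_normK ?num_real //.
    by rewrite lerXn2r ?nnegrE // ?h // (le_trans _ (h Dx)).
rewrite ge0_integralZl_EFin ?sqr_ge0 //.
- by rewrite lte_mul_pinfty // ?lee_fin ?sqr_ge0.
- by move=> x _; rewrite lee_fin sqr_ge0.
- exact/measurable_EFinP/measurable_funX.
Qed.

Lemma bounded_sqi f : (mu D < +oo)%E -> measurable_fun D f -> ae_bounded f -> sqi f.
Proof.
move=> fD mf bf; rewrite (_ : f = fun x => f x * 1); last by apply/funext => x; rewrite mulr1.
apply: sqi_boundedM => //; split; first exact: measurable_cst.
by rewrite (eq_integral (cst 1%E)) ?integral_cst ?mul1e // => x _; rewrite expr1n.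
Qed.

Lemma eq_ae_Rintegral f g : measurable_fun D f -> measurable_fun D g ->
  {ae mu, forall x, D x -> f x = g x} ->
  \int[mu]_(x in D) f x = \int[mu]_(x in D) g x.
Proof.
move=> mf mg h; congr fine; apply: ae_eq_integral => //.
- exact/measurable_EFinP.
- exact/measurable_EFinP.
- by apply: filterS h => x h Dx; rewrite h.
Qed.

Lemma Rintegral_sqr_eq0 f : sqi f -> \int[mu]_(x in D) (f x * f x) = 0 ->
  {ae mu, forall x, D x -> f x = 0}.
Proof.
move=> sf h; have [mf _] := sf.
have ff := sqi_mul_integrable sf sf.
have mff : measurable_fun D (EFin \o (fun x => f x * f x)).
  exact/measurable_EFinP/measurable_funM.
have h0 : (\int[mu]_(x in D) `| (EFin \o (fun x => f x * f x)%R) x | = 0)%E.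
  rewrite (eq_integral (EFin \o (fun x => f x * f x))) => [|x _]; last first.
    by rewrite gee0_abs //= lee_fin -expr2 sqr_ge0.
  by rewrite -[LHS]fineK ?integrable_fin_num // [X in X%:E]h.
have := (ae_eq_integral_abs mu mD mff).1 h0.
apply: filterS => x hx Dx; have /= := hx Dx.
by move=> [] /eqP; rewrite mulf_eq0 orbb => /eqP.
Qed.

End SquareIntegrable.

Lemma ord3P (P : 'I_3 -> Prop) : P 0 -> P 1 -> P 2 -> forall i, P i.
Proof.
move=> h0 h1 h2 [[|[|[|//]]]] hi.
- by rewrite (_ : Ordinal hi = 0) //; exact: val_inj.
- by rewrite (_ : Ordinal hi = 1) //; exact: val_inj.
- by rewrite (_ : Ordinal hi = 2) //; exact: val_inj.
Qed.

(** * Lebesgue measure on R^3: boxes and open sets *)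

Section Boxes.
Context {R : realType}.
Local Notation pt := 'rV[R]_3.
Local Notation pt3 := (measurableTypeR R * measurableTypeR R * measurableTypeR R)%type.

(** [leb3] is a bare set function; here it carries the measure structure that the integration
    theorems ask for. *)
Definition mu3 : {measure set _ -> \bar R} :=
  @leb3 R.

Lemma int3E D (f : @sfield R) :
  int3 D f = \int[mu3]_(p in vec3 @^-1` D) f (vec3 p).
Proof. by []. Qed.

Lemma aeqE (V : Type) (D : set pt) (f g : pt -> V) :
  aeq D f g = {ae mu3, forall p : pt3, D (vec3 p) -> f (vec3 p) = g (vec3 p)}.
Proof. by []. Qed.

(** [L2] integrates over R * R * R and [sqi] over [pt3]. The first integral is the one against the
    pushforward of [mu3] along the identity. *)
Lemma L2P D (f : @sfield R) : measurable (vec3 @^-1` D : set pt3) ->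
  L2 D f <-> sqi mu3 (vec3 @^-1` D) (f \o vec3).
Proof.
move=> mD; rewrite /L2 /sqi.
have e : measurable_fun (vec3 @^-1` D : set pt3) (f \o vec3) ->
    (\int[mu3]_(p in vec3 @^-1` D) ((f (vec3 p)) ^+ 2)%:E =
     \int[leb3]_(p in vec3 @^-1` D) ((f (vec3 p)) ^+ 2)%:E)%E.
  move=> mf.
  have mid : @measurable_fun _ _ pt3 (R * R * R)%type setT id by move=> _ A mA; rewrite setTI.
  symmetry; apply: (@ge0_integral_pushforward _ _ pt3 (R * R * R)%type _ id mid mu3 (vec3 @^-1` D) (fun p => ((f (vec3 p)) ^+ 2)%:E)).
  - exact: mD.
  - apply/measurable_EFinP; apply: (@measurable_funX _ (R * R * R)%type); exact: mf.
  - by move=> p _; rewrite lee_fin sqr_ge0.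
by split=> -[mf]; rewrite e.
Qed.

Lemma vec3_coord (p : pt3) : (vec3 p 0 0 = p.1.1) * (vec3 p 0 1 = p.1.2) * (vec3 p 0 2 = p.2).
Proof. by split; [split|]; rewrite mxE. Qed.

Definition box (a b : pt) : set pt3 :=
  [set p | forall i, a 0 i < vec3 p 0 i < b 0 i].

Lemma boxE a b : box a b =
  (`]a 0 0, b 0 0[ `*` `]a 0 1, b 0 1[) `*` `]a 0 2, b 0 2[.
Proof.
apply/seteqP; split => p /=.
  move=> h; have h0 := h 0; have h1 := h 1; have h2 := h 2.
  by rewrite !vec3_coord in h0 h1 h2; rewrite !in_itv.
by rewrite !in_itv /= => -[[h0 h1] h2]; apply: ord3P; rewrite vec3_coord.
Qed.

Lemma measurable_box a b : measurable (box a b).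
Proof. by rewrite boxE; apply: measurableX => //; exact: measurableX. Qed.

Lemma mu3_box a b : (mu3 (box a b) < +oo)%E.
Proof.
rewrite boxE [ltLHS]product_measure1E //; last exact: measurableX.
have h (x y : R) : (lebesgue_measure `]x, y[%classic < +oo)%E.
  by rewrite lebesgue_measure_itv /=; case: ifP => _; rewrite ?ltry // -EFinB ltry.
rewrite [X in (X * _)%E]product_measure1E //.
rewrite !lte_mul_pinfty ?mule_ge0 ?ge0_fin_numE ?h ?measure_ge0 //.
  by apply: lte_mul_pinfty; rewrite ?measure_ge0 ?ge0_fin_numE ?measure_ge0 ?h.
by apply: mule_ge0; exact: measure_ge0.
Qed.

(** Rational corners make the family countable: an open set is a countable union of such boxes, and
    a property that holds almost everywhere on each of them holds almost everywhere on the union. *)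
Definition rat_box (q : {ffun 'I_3 -> rat} * {ffun 'I_3 -> rat}) : set pt3 :=
  box (\row_i ratr (q.1 i)) (\row_i ratr (q.2 i)).

(** The closed box has to lie in U, so that it can serve as the compact support of a test
    function. *)
Definition inner_box (U : set pt) (a b : pt) :=
  forall x : pt, (forall i, a 0 i <= x 0 i <= b 0 i) -> U x.

Lemma open_rat_box (U : set pt) (x : pt) : open U -> U x ->
  exists q : {ffun 'I_3 -> rat} * {ffun 'I_3 -> rat},
    inner_box U (\row_i ratr (q.1 i)) (\row_i ratr (q.2 i)) /\
    forall i, ratr (q.1 i) < x 0 i < ratr (q.2 i).
Proof.
rewrite openE => /(_ x) oU /oU /nbhs_ballP[e /= e0 he].
have h i : exists q : rat * rat,
    x 0 i - e < ratr q.1 < x 0 i /\ x 0 i < ratr q.2 < x 0 i + e.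
  have [q1 /itvP h1] : {q : rat | (ratr q : R) \in `]x 0 i - e, x 0 i[}.
    by apply/sig_eqW; apply: rat_in_itvoo; rewrite ltrBlDr ltrDl.
  have [q2 /itvP h2] : exists q : rat, (ratr q : R) \in `]x 0 i, x 0 i + e[.
    by apply: rat_in_itvoo; rewrite ltrDl.
  by exists (q1, q2); rewrite /= !h1 !h2.
have {h} /(_ _)/cid-/all_tag[q hq] := h.
exists ([ffun i => (q i).1], [ffun i => (q i).2]); split; last first.
  by move=> i; rewrite !ffunE; have [/andP[_ ->] /andP[->]] := hq i.
move=> y hy; apply: he; split => // i j; rewrite ord1 /ball /=.
have := hy j; rewrite !mxE !ffunE; have [/andP[h1 h2] /andP[h3 h4]] := hq j.
by move=> /andP[h5 h6]; rewrite ltr_norml; apply/andP; split; lra.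
Qed.

Lemma open_bigcup_box (U : set pt) : open U ->
  vec3 @^-1` U =
  \bigcup_(q : {ffun 'I_3 -> rat} * {ffun 'I_3 -> rat}) if `[< inner_box U (\row_i ratr (q.1 i)) (\row_i ratr (q.2 i)) >]
                           then rat_box q else set0.
Proof.
move=> oU; apply/seteqP; split => p /=.
  move=> /(open_rat_box oU)[q [hq1 hq2]]; exists q => //.
  by rewrite asboolT // => i; have := hq2 i; rewrite !mxE.
move=> [q _]; case: asboolP => // hq hp; apply: hq => i.
by have /andP[/ltW -> /ltW ->] := hp i.
Qed.

Lemma measurable_open (U : set pt) : open U -> measurable (vec3 @^-1` U).
Proof.
move=> oU; rewrite open_bigcup_box //; apply: countable_bigcupT_measurable => // q.
by case: ifP => _ //; exact: measurable_box.
Qed.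

Lemma continuous_measurable3 (f : @sfield R) : continuous (f : pt -> R) ->
  measurable_fun setT (f \o vec3).
Proof.
move=> cf; apply: (measurability _ (RGenOpens.measurableE R)) => _ [_ [x [y ->]] <-].
rewrite setTI; apply: (@measurable_open (f @^-1` `]x, y[)).
by apply: open_comp; [move=> ? _; exact: cf | exact: interval_open].
Qed.

Lemma coord_le_norm (x : pt) i : `|x 0 i| <= `|x|.
Proof.
rewrite [leRHS]/Num.norm /= mx_normrE; apply/bigmax_geP; right => /=.
by exists (0, i).
Qed.

Lemma mu3_bounded (U : set pt) : open U -> bounded_set U -> (mu3 (vec3 @^-1` U) < +oo)%E.
Proof.
move=> oU [M [_ hM]].
apply: le_lt_trans (mu3_box (const_mx (- (`|M| + 2))) (const_mx (`|M| + 2))).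
apply: le_measure; rewrite ?inE; [exact: measurable_open|exact: measurable_box|].
move=> p /= Up i; rewrite [const_mx _ _ _]mxE [const_mx _ _ _]mxE -ltr_norml.
have := hM (`|M| + 1) _ _ Up; rewrite (le_lt_trans (ler_norm M)) ?ltrDl //.
move=> /(_ isT) /(le_trans _) h.
apply: le_lt_trans (h _ (coord_le_norm _ _)) _.
by rewrite ltrD2l ltr1n.
Qed.

End Boxes.

(** * Test functions and the fundamental lemma *)

Section Flat.
Context {R : realType}.
Local Notation pt := 'rV[R]_3.

(** The classical smooth function exp(-1/t), extended by 0, together with the powers t^-n that
    appear in its derivatives. *)
Definition flat (n : nat) (t : R) : R := if 0 < t then t^-1 ^+ n * expR (- t^-1) else 0.

(** From exp y >= 1 + y^(n+2) / (n+2)! at y = 1/t. A bound quadratic in t is what makes the function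
    differentiable at 0 with derivative 0. *)
Lemma flat_le n t : `|flat n t| <= (n.+2)`!%:R * t ^+ 2.
Proof.
rewrite /flat; case: ifPn => [t0|_]; last by rewrite normr0 mulr_ge0 ?sqr_ge0.
have y0 : 0 < t^-1 by rewrite invr_gt0.
rewrite ger0_norm ?mulr_ge0 ?exprn_ge0 ?expR_ge0 ?(ltW y0) //.
have F0 : (0 : R) < (n.+2)`!%:R by rewrite ltr0n fact_gt0.
rewrite expRN ler_pdivrMr ?expR_gt0 //.
apply: (@le_trans _ _ ((n.+2)`!%:R * t ^+ 2 * (1 + t^-1 ^+ n.+2 / (n.+2)`!%:R))); last first.
  apply: ler_wpM2l; first by rewrite mulr_ge0 ?sqr_ge0 ?(ltW F0).
  exact: (@expR_ge1Dxn _ _ n.+1 (ltW y0)).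
rewrite mulrDr mulr1; apply: ler_wpDl; first by rewrite mulr_ge0 ?sqr_ge0 ?(ltW F0).
rewrite le_eqVlt; apply/orP; left; apply/eqP.
move: ((n.+2)`!%:R : R) F0 => F F0.
have -> : t^-1 ^+ n.+2 = t^-1 ^+ n * t^-1 ^+ 2 by rewrite -exprD addn2.
by field; rewrite !gt_eqF.
Qed.

Lemma is_derive_flat n (t : R) :
  is_derive t (1 : R) (flat n) (- n%:R * flat n.+1 t + flat n.+2 t).
Proof.
have [t0|t0|->] := ltgtP t 0.
- have e : (\near t, (cst 0 : R -> R) t = flat n t).
    near=> x; rewrite /flat ifN // -leNgt ltW //.
    by near: x; exact: lt_nbhsl.
  apply: near_eq_is_derive e _.
  apply: is_derive_eq.
  by rewrite /flat ltNge (ltW t0) /= mulr0 addr0.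
- pose g (y : R) : R := y ^+ n * expR (- y).
  have e : (\near t, (g \o (fun y => y^-1)) t = flat n t).
    near=> x; rewrite /flat ifT //.
    by near: x; apply: open_nbhs_nbhs; split => //; exact: open_gt.
  apply: near_eq_is_derive e _.
  have tn0 : t != 0 by rewrite gt_eqF.
  have h1 : is_derive t (1 : R) (fun y : R => y^-1) (- t ^- 2).
    have := @is_deriveV R id t 1 1 tn0 (is_derive_id _ _).
    by rewrite /GRing.scale /= mulr1.
  have h2 (y : R) : is_derive y (1 : R) g
      (n%:R * y ^+ n.-1 * expR (- y) - y ^+ n * expR (- y)).
    have hX := @is_deriveX R R id n y 1 1 (is_derive_id _ _).
    have hN := is_deriveN (is_derive_id y (1 : R)).
    have hE := is_derive1_comp (is_derive_expR (- y)) hN.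
    have -> : g = (id ^+ n) * (expR \o (- id)) by apply/funext => z; rewrite /g !fctE.
    apply: is_derive_eq (is_deriveM hX hE) _; rewrite !fctE.
    rewrite /GRing.scale /=; ring.
  apply: is_derive_eq (is_derive1_comp (h2 _) h1) _.
  rewrite /flat t0 -!exprVn; move: t^-1 (expR _) => y E.
  by case: (n) => [|m] /=; rewrite ?exprS; ring.
(* At 0 the difference quotient is at most a constant times the absolute value of h, and the claimed
   derivative is 0 by definition of [flat]. *)
- have h : (fun h : R => h^-1 *: (flat n (h *: (1 : R) + 0) - flat n 0)) @ 0^' --> (0 : R).
    apply/cvgrPdist_le => e e0.
    pose C : R := (n.+2)`!%:R.
    have C0 : 0 < C by rewrite ltr0n fact_gt0.
    near=> h.
    have h0 : h != 0 by near: h; exact: nbhs_dnbhs_neq.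
    rewrite sub0r normrN addr0 [h *: 1]mulr1 {2}/flat ltxx subr0.
    rewrite normrZ normfV ler_pdivrMl ?normr_gt0 //.
    rewrite (le_trans (flat_le n h)) // -/C.
    have hC : `|h| <= e / C by near: h; apply: dnbhs0_le; rewrite divr_gt0.
    move: hC; rewrite ler_pdivlMr // => hC.
    rewrite -real_normK ?num_real // expr2 mulrCA ler_wpM2l //.
    by rewrite mulrC.
  apply: DeriveDef; first by apply: cvgP h.
  rewrite /flat ltxx mulr0 addr0; exact: cvg_lim h.
Unshelve. all: by end_near.
Qed.

(* The derivative of flat n is a combination of flat n.+1 and flat n.+2, so this
   algebra of functions is stable under partial derivatives. *)
Inductive flat_alg : @sfield R -> Prop :=
| flat_alg_flat n a c i : flat_alg (fun x => flat n (a * x 0 i + c))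
| flat_alg_cst a : flat_alg (fun=> a)
| flat_algD f g : flat_alg f -> flat_alg g -> flat_alg (fun x => f x + g x)
| flat_algM f g : flat_alg f -> flat_alg g -> flat_alg (fun x => f x * g x).

Lemma flat_alg_diff f : flat_alg f ->
  (forall x, differentiable (f : pt -> R^o) x) /\
  forall i, flat_alg (partial i f).
Proof.
elim=> [n a c i|a|{}f g fS [df pf] gS [dg pg]|{}f g fS [df pf] gS [dg pg]].
- pose L (x : pt) : R^o := a * x 0 i + c.
  pose coord (x : pt) : R^o := x 0 i.
  have dcoord x : differentiable coord x by exact: differentiable_coord.
  have LE : L = (a *: coord) + cst c by apply/funext.
  have dL x : differentiable L x.
    by rewrite LE; apply: differentiableD => //; exact: differentiableZ.
  have dflat t : differentiable (flat n : R -> R^o) t.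
    by apply/derivable1_diffP; have [] := is_derive_flat n t.
  split; first by move=> x; apply: (@differentiable_comp _ _ _ _ L (flat n)).
  move=> j.
  have h (x : pt) : partial j (fun x => flat n (a * x 0 i + c)) x =
     (a * ((delta_mx 0 j : pt) 0 i)) * (- n%:R * flat n.+1 (a * x 0 i + c) + flat n.+2 (a * x 0 i + c)).
    have <- : 'D_(delta_mx 0 j : pt) L x = a * ((delta_mx 0 j : pt) 0 i).
      rewrite LE deriveD; [|exact/derivableZ/diff_derivable|exact: derivable_cst].
      rewrite derive_cst addr0 deriveZ; last exact: diff_derivable.
      congr (a *: _); rewrite /derive; apply: lim_near_cst => //.
      near=> h; rewrite /= /coord !mxE addrK scalerA mulVf ?mul1r //.
        by rewrite scale1r.
      by near: h; exact: nbhs_dnbhs_neq.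
    have [_ <-] := is_derive_flat n (a * x 0 i + c).
    rewrite /partial deriveE; last exact: (@differentiable_comp _ _ _ _ L (flat n)).
    rewrite (@diff_comp _ _ _ _ L (flat n)) //=.
    have dlin (y w : R) : 'd (flat n : R -> R^o) y w = w * 'd (flat n : R -> R^o) y 1.
      transitivity ('d (flat n : R -> R^o) y (w *: (1 : R))); last exact: linearZ.
      by rewrite [w *: 1]mulr1.
    by rewrite dlin -!deriveE.
  have -> : partial j (fun x => flat n (a * x 0 i + c)) = fun x =>
     (a * ((delta_mx 0 j : pt) 0 i)) * (- n%:R * flat n.+1 (a * x 0 i + c) + flat n.+2 (a * x 0 i + c)).
    exact/funext.
  apply: (flat_algM (flat_alg_cst _)); apply: flat_algD; last exact: flat_alg_flat.
  by apply: (flat_algM (flat_alg_cst _)); exact: flat_alg_flat.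
- split; first by move=> x; exact: differentiable_cst.
  move=> i; rewrite (_ : partial i _ = fun=> 0); first exact: flat_alg_cst.
  by apply/funext => x; rewrite /partial derive_cst.
- split; first by move=> x; exact: differentiableD.
  move=> i; rewrite (_ : partial i _ = fun x => partial i f x + partial i g x).
    by apply: flat_algD.
  by apply/funext => x; rewrite /partial deriveD //; exact: diff_derivable.
- split; first by move=> x; exact: differentiableM.
  move=> i; rewrite (_ : partial i _ = fun x => f x * partial i g x + g x * partial i f x).
    by apply: flat_algD; apply: flat_algM.
  by apply/funext => x; rewrite /partial deriveM //; exact: diff_derivable.
Unshelve. all: by end_near.
Qed.

Lemma flat_alg_Ck k f : flat_alg f -> Ck k f.
Proof.
elim: k f => [|k ih] f fS /=; have [df pf] := flat_alg_diff fS.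
  by split => // x; exact: differentiable_continuous.
split; first by move=> x; exact: differentiable_continuous.
by move=> i; split; [move=> x; exact: diff_derivable|exact: ih].
Qed.

End Flat.

Section Bump.
Context {R : realType}.
Local Notation pt := 'rV[R]_3.

(** As k grows this tends to the indicator function of the open box: inside, each factor is exp(-1 /
    ((k+1) s)) with s > 0 the distance of a coordinate to one end; outside, some factor is 0. *)
Definition bump (a b : pt) (k : nat) : @sfield R := fun x =>
  \prod_(i < 3) (flat 0 (k.+1%:R * (x 0 i - a 0 i)) * flat 0 (k.+1%:R * (b 0 i - x 0 i))).

Lemma flat_alg_prod (I : Type) (r : seq I) (F : I -> @sfield R) :
  (forall i, flat_alg (F i)) -> flat_alg (fun x => \prod_(i <- r) F i x).
Proof.
move=> hF; elim: r => [|i r ih].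
  rewrite (_ : (fun _ => _) = fun=> 1); first exact: flat_alg_cst.
  by apply/funext => x; rewrite big_nil.
rewrite (_ : (fun _ => _) = fun x => F i x * \prod_(i <- r) F i x).
  exact: flat_algM.
by apply/funext => x; rewrite big_cons.
Qed.

Lemma flat_alg_bump a b k : flat_alg (bump a b k).
Proof.
apply: flat_alg_prod => i; apply: flat_algM.
  rewrite (_ : (fun _ => _) = fun x : pt => flat 0 (k.+1%:R * x 0 i + (- k.+1%:R * a 0 i))).
    exact: flat_alg_flat.
  by apply/funext => x; congr flat; ring.
rewrite (_ : (fun _ => _) = fun x : pt => flat 0 (- k.+1%:R * x 0 i + (k.+1%:R * b 0 i))).
  exact: flat_alg_flat.
by apply/funext => x; congr flat; ring.
Qed.

Lemma flat0_itv (t : R) : 0 <= flat 0 t <= 1.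
Proof.
rewrite /flat; case: ifPn => [t0|_]; last by rewrite lexx ler01.
by rewrite expr0 mul1r expR_ge0 /= -expR0 ler_expR oppr_le0 invr_ge0 ltW.
Qed.

Lemma flat0_le0 (t : R) : t <= 0 -> flat 0 t = 0.
Proof. by move=> t0; rewrite /flat ltNge t0. Qed.

Lemma bump_itv (a b : pt) k (x : pt) : 0 <= bump a b k x <= 1.
Proof.
have h i : 0 <= flat 0 (k.+1%:R * (x 0 i - a 0 i)) * flat 0 (k.+1%:R * (b 0 i - x 0 i)) <= 1.
  have /andP[h1 h2] := flat0_itv (k.+1%:R * (x 0 i - a 0 i)).
  have /andP[h3 h4] := flat0_itv (k.+1%:R * (b 0 i - x 0 i)).
  by rewrite mulr_ge0 //= mulr_ile1.
by rewrite prodr_ge0 /= ?prodr_ile1 // => i _; have /andP[] := h i.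
Qed.

Lemma bump_out (a b : pt) k (x : pt) : ~ (forall i, a 0 i < x 0 i < b 0 i) -> bump a b k x = 0.
Proof.
move=> /existsNP[i hi]; rewrite /bump (bigD1 i) //=.
have : ~~ (a 0 i < x 0 i) || ~~ (x 0 i < b 0 i) by rewrite -negb_and; exact/negP.
rewrite -!leNgt => /orP[h|h].
  by rewrite [flat _ _]flat0_le0 ?mul0r // mulr_ge0_le0 // subr_le0.
by rewrite [X in _ * X * _]flat0_le0 ?mulr0 ?mul0r // mulr_ge0_le0 // subr_le0.
Qed.

Lemma bump_cvg (a b x : pt) : (forall i, a 0 i < x 0 i < b 0 i) -> (fun k => bump a b k x) @ \oo --> (1 : R).
Proof.
move=> hx.
have hf (s : R) : 0 < s -> (fun k => flat 0 (k.+1%:R * s)) @ \oo --> (1 : R).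
  move=> s0.
  have -> : (fun k => flat 0 (k.+1%:R * s)) = expR \o (fun k => - s^-1 * harmonic k).
    apply/funext => k /=; rewrite /flat mulr_gt0 // expr0 mul1r /harmonic /=.
    by rewrite invfM mulrC mulNr.
  have h1 : (fun k => - s^-1 * harmonic k) @ \oo --> (- s^-1 * 0 : R).
    by apply: cvgMr; exact: cvg_harmonic.
  rewrite mulr0 in h1.
  have := @continuous_cvg _ _ _ _ _ _ expR _ (@continuous_expR R _) h1.
  by rewrite expR0; apply; exact: eventually_filter.
rewrite /bump; elim: (index_enum _) => [|i r ih].
  by under eq_fun do rewrite big_nil; exact: cvg_cst.
under eq_fun do rewrite big_cons.
have [h1 h2] : 0 < x 0 i - a 0 i /\ 0 < b 0 i - x 0 i.
  by rewrite !subr_gt0; have /andP[] := hx i.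
have h := cvgM (cvgM (hf _ h1) (hf _ h2)) ih; rewrite !mulr1 in h. exact: h.
Qed.

Lemma compact_closed_box (a b : pt) : compact [set x : pt | forall i, a 0 i <= x 0 i <= b 0 i].
Proof.
have := @rV_compact _ 3 (fun i => `[a 0 i, b 0 i]%classic) (fun i => @segment_compact R _ _).
by congr compact; apply/seteqP; split => x /= h i; have := h i; rewrite in_itv.
Qed.

Lemma bump_test (Omega : set pt) a b k : inner_box Omega a b ->
  test_function Omega (bump a b k).
Proof.
move=> hab; split; first by move=> m; apply: flat_alg_Ck; exact: flat_alg_bump.
exists [set x : pt | forall i, a 0 i <= x 0 i <= b 0 i].
  by split; [exact: compact_closed_box|exact: hab].
move=> x hx; apply: bump_out => h; apply: hx => i.
by have /andP[/ltW -> /ltW ->] := h i.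
Qed.

Lemma test_function_continuous (Omega : set pt) phi : test_function Omega phi ->
  continuous (phi : pt -> R).
Proof. by move=> [/(_ 0%N) []]. Qed.

Lemma test_function_bounded (Omega : set pt) phi : test_function Omega phi ->
  exists C : R, forall x, `|phi x| <= C.
Proof.
move=> ht; have [_ [K [cK _] hK]] := ht.
have cphi := test_function_continuous ht.
have [[y Ky]|K0] := pselect (K !=set0); last first.
  by exists 0 => x; rewrite hK ?normr0 // => Kx; apply: K0; exists x.
have [|z _ hz] := @EVT_max_rV R 3 (fun x => `|phi x|) K (ex_intro _ y Ky) cK.
  by apply: continuous_subspaceT => x; apply: (continuous_comp (cphi x)); exact: norm_continuous.
exists `|phi z| => x; have [Kx|/hK ->] := pselect (K x); first by apply: hz; rewrite inE.
by rewrite normr0.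
Qed.

Lemma test_partial (Omega : set pt) phi i : test_function Omega phi ->
  test_function Omega (partial i phi).
Proof.
move=> [hC [K [cK KO] hK]]; split.
  by move=> k; have /= [_ /(_ i)[]] := hC k.+1.
exists K => // x Kx; rewrite /partial.
have cl : closed K by apply: compact_closed => //; exact: norm_hausdorff.
rewrite (_ : 0 = 'D_(delta_mx 0 i : pt) (cst 0 : pt -> R^o) x); last by rewrite derive_cst.
apply: near_eq_derive.
have : nbhs x (~` K) by apply: open_nbhs_nbhs; split => //; exact: closed_openC.
by apply: filterS => y /hK ->.
Qed.

End Bump.

Section FundamentalLemma.
Context {R : realType}.
Local Notation pt := 'rV[R]_3.
Local Notation pt3 := (measurableTypeR R * measurableTypeR R * measurableTypeR R)%type.
Local Notation mu := (@mu3 R).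
Local Notation boxes := [set A : set pt3 | exists a b : pt, A = box a b].

(** A coordinate slab is the increasing union of boxes that are long in the other two directions.
    Boxes being stable under intersection, a Dynkin argument may start from them. *)
Lemma measurable_boxes : @measurable _ pt3 = <<s boxes >>.
Proof.
apply/seteqP; split; last first.
  apply: smallest_sub; first exact: sigma_algebra_measurable.
  by move=> _ [a [b ->]]; exact: measurable_box.
pose T' := g_sigma_algebraType boxes.
have mcoord (i : 'I_3) :
    measurable_fun [set: T'] ((fun p => vec3 p 0 i) : T' -> measurableTypeR R).
  apply: (measurability _ (RGenOpens.measurableE R)) => _ [_ [x [y ->]] <-].
  rewrite setTI (_ : _ @^-1` _ = \bigcup_n box (\row_j if j == i then x else - n%:R)
                                     (\row_j if j == i then y else n%:R)).
    apply: bigcupT_measurable => n; apply: sub_sigma_algebra.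
    by do 2!eexists; reflexivity.
  apply/seteqP; split => p; rewrite /bigcup /box /= in_itv /=; move: (vec3 p) => v; last first.
    by move=> [n _ /(_ i)]; rewrite !mxE eqxx.
  move=> hp; exists (Num.truncn (\sum_j `|v 0 j|)).+1 => // j; rewrite !mxE.
  case: eqP => [->//|_].
  rewrite -ltr_norml; apply: le_lt_trans (truncnS_gt _).
  by rewrite (bigD1 j) //= lerDl sumr_ge0.
have mid : measurable_fun [set: T'] (id : T' -> pt3).
  apply/measurable_fun_pairP; split; last first.
    by rewrite (_ : snd \o id = fun p => vec3 p 0 2) //; apply/funext => p; rewrite vec3_coord.
  apply/measurable_fun_pairP; split.
    by rewrite (_ : fst \o (fst \o id) = fun p => vec3 p 0 0) //; apply/funext => p; rewrite vec3_coord.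
  by rewrite (_ : snd \o (fst \o id) = fun p => vec3 p 0 1) //; apply/funext => p; rewrite vec3_coord.
by move=> A mA; have := mid measurableT A mA; rewrite setTI.
Qed.

Lemma boxI (a b a' b' : pt) : box a b `&` box a' b' =
  box (\row_i Num.max (a 0 i) (a' 0 i)) (\row_i Num.min (b 0 i) (b' 0 i)).
Proof.
apply/seteqP; split => p; rewrite /box /=; move: (vec3 p) => v.
  by move=> [h h'] i; have /andP[h1 h2] := h i; have /andP[h3 h4] := h' i; rewrite !mxE gt_max lt_min h1 h2 h3 h4.
by move=> h; split => i; have := h i; rewrite !mxE gt_max lt_min => /andP[/andP[h1 h2] /andP[h3 h4]]; rewrite ?h1 ?h2 ?h3 ?h4.
Qed.

(** The measurable sets A for which f has zero integral over the part of A in the fixed box form a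
    Dynkin system containing the pi-system of all boxes, hence are all measurable sets; then f
    vanishes almost everywhere on the fixed box. *)
Lemma box_integral_ae_eq0 (a0 b0 : pt) (f : pt3 -> R) :
  mu.-integrable (box a0 b0) (EFin \o f) ->
  (forall a b, \int[mu]_(p in box a b `&` box a0 b0) (f p)%:E = 0)%E ->
  {ae mu, forall p, box a0 b0 p -> f p = 0}.
Proof.
move=> fi h.
have mB := @measurable_box R a0 b0.
have mf : measurable_fun (box a0 b0) f by apply/measurable_EFinP; exact: measurable_int fi.
have H (A : set pt3) : measurable A -> (\int[mu]_(p in A `&` box a0 b0) (f p)%:E = 0)%E.
  rewrite {1}measurable_boxes; move: A; apply: dynkin_induction => //.
  - exact: measurable_boxes.
  - move=> _ _ [a [b ->]] [a' [b' ->]]; rewrite boxI; by do 2!eexists.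
  - by rewrite setTI -[X in integral _ X _]setIid h.
  - by move=> _ [a [b ->]]; exact: h.
  - move=> S mS hS.
    have e : (\int[mu]_(p in (S `&` box a0 b0) `|` (~` S `&` box a0 b0)) (f p)%:E = 0)%E.
      by rewrite -setIUl setUv setTI -[X in integral _ X _]setIid h.
    move: e; rewrite integral_setU_EFin.
    - by rewrite hS add0e.
    - exact: measurableI.
    - by apply: measurableI => //; exact: measurableC.
    - by rewrite -setIUl setUv setTI.
      by rewrite disj_set2E setIACA setICr set0I.
  - move=> F mF tF hF; rewrite setI_bigcupl integral_bigcup.
    + by apply: eseries0 => k _ _; exact: hF.
    + apply/trivIsetP => i j _ _ ij; rewrite setIACA.
      by move/trivIsetP : tF => /(_ i j I I ij) ->; rewrite set0I.
    + by move=> k; exact: measurableI.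
    + apply: integrableS fi => //; last by rewrite -setI_bigcupl => p [].
      by apply: bigcupT_measurable => k; exact: measurableI.
have := @integral_ae_eq _ _ R mu _ mB (cst 0%E) (EFin \o f) fi (measurable_cst _).
have hh : forall E : set pt3, E `<=` box a0 b0 -> measurable E ->
    (\int[mu]_(x in E) (EFin \o f) x)%E = (\int[mu]_(x in E) cst 0%E x)%E.
  by move=> E EB mE; rewrite integral0 -[E in LHS](setIidl EB) H.
move=> /(_ hh); apply: filterS => p hp Bp; by have /= [] := hp Bp.
Qed.

Variables (Omega : set pt) (oO : open Omega) (bO : bounded_set Omega).
Let D := vec3 @^-1` Omega : set pt3.
Let mD : measurable D. Proof. exact: measurable_open. Qed.

Lemma sqi_integrable1 (f : pt3 -> R) : sqi mu D f -> mu.-integrable D (EFin \o f).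
Proof.
move=> sf; have s1 : sqi mu D (fun=> 1).
  apply: bounded_sqi => //; first exact: mu3_bounded.
  by exists 1; apply: nearW => x _; rewrite normr1.
have := sqi_mul_integrable mD sf s1.
by under [X in _.-integrable _ (_ \o X)]eq_fun do rewrite mulr1.
Qed.

(** Testing with bumps and letting k tend to infinity, with |f| as dominating function, gives zero
    integral of f over every box whose closure lies in Omega. Each rational box of this kind then
    contributes one null set. *)
Lemma fundamental_lemma (f : @sfield R) : sqi mu D (f \o vec3) ->
  (forall phi, test_function Omega phi -> sip Omega f phi = 0) ->
  aeq Omega f (fun=> 0).
Proof.
move=> sf hphi.
have [mf _] := sf.
have fi := sqi_integrable1 sf.
have hbox a b : inner_box Omega a b -> (\int[mu]_(p in box a b) (f (vec3 p))%:E = 0)%E.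
  move=> hab.
  have BD : box a b `<=` D.
    by move=> p hp; apply: hab => i; have /andP[/ltW -> /ltW ->] := hp i.
  have mB := @measurable_box R a b.
  have := @dominated_convergence _ _ R mu D mD
    (fun k p => (f (vec3 p) * bump a b k (vec3 p))%:E)
    ((fun p => (f (vec3 p))%:E) \_ (box a b)) (fun p => `|f (vec3 p)|%:E).
  case.
  - move=> k; apply/measurable_EFinP/measurable_funM => //.
    apply: (@measurable_funS _ _ _ _ setT) => //.
    apply: continuous_measurable3; apply: test_function_continuous; exact: bump_test hab.
  - apply/measurable_restrict => //; apply/measurable_EFinP.
    by apply: measurable_funS mf.
  - apply: nearW => p Dp; rewrite patchE; case: ifPn => [/set_mem hp|/negP hp].
      apply: cvg_EFin; first exact: nearW.
      by rewrite -[X in _ --> X]mulr1; apply: cvgMr; exact: bump_cvg.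
    apply: cvg_near_cst; apply: nearW => k.
    by rewrite bump_out ?mulr0 // => hp'; apply: hp; rewrite inE.
  - by have := integrable_norm fi; under eq_fun do rewrite /=.
  - apply: nearW => p k Dp /=; rewrite lee_fin normrM ler_piMr //.
    by have /andP[h1 h2] := bump_itv a b k (vec3 p); rewrite ger0_norm.
  move=> _ _; rewrite -integral_mkcondr (setIidr BD) => h.
  have h0 : (fun k => \int[mu]_(p in D) (f (vec3 p) * bump a b k (vec3 p))%:E)%E = fun=> 0%E.
    apply/funext => k; have := hphi _ (bump_test k hab); rewrite /sip int3E => h1.
    rewrite -[LHS]fineK; first by rewrite [X in X%:E]h1.
    apply: integrable_fin_num => //.
    apply: le_integrable fi => //.
      apply/measurable_EFinP/measurable_funM => //.
      apply: (@measurable_funS _ _ _ _ setT) => //.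
      apply: continuous_measurable3; apply: test_function_continuous; exact: bump_test hab.
    move=> p Dp /=; rewrite lee_fin normrM ler_piMr //.
    by have /andP[h2 h3] := bump_itv a b k (vec3 p); rewrite ger0_norm.
  by rewrite h0 in h; apply: (cvg_unique _ h) => //; exact: cvg_cst.
have hq (q : {ffun 'I_3 -> rat} * {ffun 'I_3 -> rat}) :
    {ae mu, forall p, inner_box Omega (\row_i ratr (q.1 i)) (\row_i ratr (q.2 i)) ->
        rat_box q p -> f (vec3 p) = 0}.
  have [hin|nin] := pselect (inner_box Omega (\row_i ratr (q.1 i)) (\row_i ratr (q.2 i))); last first.
    by apply: nearW => p.
  have BD : rat_box q `<=` D.
    by move=> p hp; apply: hin => i; have /andP[/ltW -> /ltW ->] := hp i.
  have : {ae mu, forall p, rat_box q p -> f (vec3 p) = 0}.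
    apply: box_integral_ae_eq0.
      by apply: integrableS fi => //; exact: measurable_box.
    move=> a b; rewrite boxI; apply: hbox => x hx; apply: hin => i.
    have := hx i; rewrite !mxE ge_max le_min => /andP[/andP[_ ->] /andP[_ ->]]. by [].
  by apply: filterS => p hp _.
pose T := ({ffun 'I_3 -> rat} * {ffun 'I_3 -> rat})%type.
(* Enumerating the rational boxes by [unpickle] turns the quantifier over boxes into one over nat,
   for which the null sets can be united. *)
have hn (n : nat) : {ae mu, forall p, forall q : T, unpickle n = Some q ->
    inner_box Omega (\row_i ratr (q.1 i)) (\row_i ratr (q.2 i)) ->
    rat_box q p -> f (vec3 p) = 0}.
  case e : (unpickle n : option T) => [q|]; last by apply: nearW.
  by apply: filterS (hq q) => p hp q' [<-].
apply: filterS (ae_foralln hn) => p hp Dp.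
have [q [q1 q2]] := open_rat_box oO Dp.
apply: (hp (pickle q) q) => //; first by rewrite pickleK.
by move=> i; have := q2 i; move: (vec3 p 0 i) => t; rewrite !mxE.
Qed.

End FundamentalLemma.

(** * Integration by parts *)

Section ProductSigmaFinite.
Context d1 d2 (T1 : measurableType d1) (T2 : measurableType d2) (R:realType).
Variables (m1 : {sigma_finite_measure set T1 -> \bar R}) (m2 : {sigma_finite_measure set T2 -> \bar R}).

(** Fubini on the triple product treats the pair as a single factor, which must therefore be known
    to be sigma-finite. *)
Definition prod_measure : set (T1 * T2) -> \bar R := (m1 \x m2)%E.
HB.instance Definition _ := Measure.on prod_measure.

Let prod_sigma_finite : sigma_finite setT prod_measure.
Proof.
have /sigma_finiteP[F [TF ndF Foo]] := sigma_finiteT m1.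
have /sigma_finiteP[G [TG ndG Goo]] := sigma_finiteT m2.
exists (fun n => F n `*` G n).
  apply/seteqP; split => // -[x y] _.
  have [n _ Fn] : (\bigcup_i F i) x by rewrite -TF.
  have [k _ Gk] : (\bigcup_i G i) y by rewrite -TG.
  exists (maxn n k) => //; split => /=.
    by move: x Fn; exact/subsetPset/ndF/leq_maxl.
  by move: y Gk; exact/subsetPset/ndG/leq_maxr.
move=> k; have [mF fF] := Foo k; have [mG fG] := Goo k.
split; first exact: measurableX.
by rewrite /prod_measure product_measure1E // lte_mul_pinfty // ge0_fin_numE.
Qed.

HB.instance Definition _ := Measure_isSigmaFinite.Build _ _ _ prod_measure prod_sigma_finite.
End ProductSigmaFinite.

Section IntegrationByParts.
Context {R : realType}.
Local Notation pt := 'rV[R]_3.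
Local Notation pt3 := (measurableTypeR R * measurableTypeR R * measurableTypeR R)%type.
Local Notation mu := (@mu3 R).
Local Notation leb := (@lebesgue_measure R).
Local Notation dir i := (delta_mx 0 i : pt).

Lemma bounded_support_integrable d (T : measurableType d) (nu : {measure set T -> \bar R})
    (A : set T) (h : T -> R) (C : R) :
  measurable A -> (nu A < +oo)%E -> measurable_fun setT h ->
  (forall x, `|h x| <= C) -> (forall x, ~ A x -> h x = 0) ->
  nu.-integrable setT (EFin \o h).
Proof.
move=> mA fA mh hC hA.
have hi : nu.-integrable A (EFin \o h).
  apply: measurable_bounded_integrable => //.
    by apply: measurable_funS mh.
  by exists C; split; [exact: num_real|move=> x Cx y _; apply: le_trans (ltW Cx); exact: hC].
have := (integrable_mkcond (EFin \o h) mA).1 hi.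
congr (_.-integrable _ _); apply/funext => x; rewrite patchE; case: ifPn => // /negP h0.
by rewrite /= hA // => Ax; apply: h0; rewrite inE.
Qed.

Section Iterated.
Context d1 d2 (T1 : measurableType d1) (T2 : measurableType d2).
Variables (m1 : {sigma_finite_measure set T1 -> \bar R}) (m2 : {sigma_finite_measure set T2 -> \bar R}).
Variables (f : T1 * T2 -> \bar R) (fi : (m1 \x m2)%E.-integrable setT f).

Lemma iterated_integral_eq0l : (forall x, \int[m2]_y f (x, y) = 0)%E ->
  (\int[m1 \x m2]_z f z = 0)%E.
Proof. by move=> h; rewrite -integral12_prod_meas1 // integral0_eq // => x _; exact: h. Qed.

Lemma iterated_integral_eq0r : (forall y, \int[m1]_x f (x, y) = 0)%E ->
  (\int[m1 \x m2]_z f z = 0)%E.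
Proof. by move=> h; rewrite -integral21_prod_meas1 // integral0_eq // => y _; exact: h. Qed.
End Iterated.

Section IteratedTriple.
Context d1 d2 d3 (T1 : measurableType d1) (T2 : measurableType d2) (T3 : measurableType d3).
Variables (m1 : {sigma_finite_measure set T1 -> \bar R}) (m2 : {sigma_finite_measure set T2 -> \bar R})
  (m3 : {sigma_finite_measure set T3 -> \bar R}).
Variables (f : T1 * T2 * T3 -> \bar R) (fi : ((m1 \x m2) \x m3)%E.-integrable setT f).

Lemma triple_integral_eq0l : (forall q, \int[m3]_y f (q, y) = 0)%E ->
  (\int[(m1 \x m2) \x m3]_z f z = 0)%E.
Proof. exact: (@iterated_integral_eq0l _ _ _ _ (prod_measure m1 m2) m3 f fi). Qed.

Lemma triple_integral_eq0r : (forall y, \int[m1 \x m2]_q f (q, y) = 0)%E ->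
  (\int[(m1 \x m2) \x m3]_z f z = 0)%E.
Proof. exact: (@iterated_integral_eq0r _ _ _ _ (prod_measure m1 m2) m3 f fi). Qed.
End IteratedTriple.

Variables (Omega : set pt) (oO : open Omega) (bO : bounded_set Omega).

Lemma bounded_coord : exists2 M : R, 0 < M & forall x, Omega x -> forall i, `|x 0 i| < M.
Proof.
have [M [_ hM]] := bO.
exists (`|M| + 2); first by rewrite ltr_wpDl.
move=> x Ox i; have := hM (`|M| + 1) _ _ Ox; rewrite (le_lt_trans (ler_norm M)) ?ltrDl //.
move=> /(_ isT) h; apply: le_lt_trans (coord_le_norm _ _) (le_lt_trans h _).
by rewrite ltrD2l ltr1n.
Qed.

Lemma test_function_out phi x : test_function Omega phi -> ~ Omega x -> phi x = 0.
Proof. by move=> [_ [K [_ KO] hK]] Ox; apply: hK => /KO. Qed.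

(** As the i-th coordinate of x0 is 0, the parameter t is the i-th coordinate on the line, so the
    line is outside Omega for |t| >= M. The fundamental theorem of calculus on [-M, M] then has
    vanishing boundary values. *)
Lemma line_integral_partial phi (x0 : pt) (i : 'I_3) : test_function Omega phi -> x0 0 i = 0 ->
  (\int[leb]_t (partial i phi (x0 + t *: dir i))%:E = 0)%E.
Proof.
move=> ht x0i; have [M M0 hM] := bounded_coord.
pose F (t : R) : R := phi (x0 + t *: dir i).
pose f (t : R) : R := partial i phi (x0 + t *: dir i).
have coordE t : (x0 + t *: dir i) 0 i = t by rewrite !mxE x0i add0r !eqxx mulr1.
have out t : M <= `|t| -> ~ Omega (x0 + t *: dir i).
  by move=> hMt /hM /(_ i); rewrite coordE ltNge hMt.
have cline : continuous (fun t : R => x0 + t *: dir i : pt).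
  move=> t; apply: cvgD; first exact: cvg_cst.
  by apply: cvgZr_tmp; exact: cvg_id.
have cf : continuous f.
  move=> t; apply: (continuous_comp (cline t)).
  exact: test_function_continuous (test_partial i ht) _.
have cF : continuous F.
  move=> t; apply: (continuous_comp (cline t)).
  exact: test_function_continuous ht _.
have e (t : R) : (fun h : R => h^-1 *: ((F \o shift t) (h *: (1 : R)) - F t)) =
    (fun h => h^-1 *: ((phi \o shift (x0 + t *: dir i)) (h *: dir i) - phi (x0 + t *: dir i))).
  apply/funext => h; rewrite /F /=; congr (_ *: (phi _ - _)).
  by rewrite [h *: 1]mulr1 scalerDl addrCA addrA addrC addrA.
have dphi x : derivable (phi : pt -> R^o) x (dir i).
  by have [/(_ 1%N)[_ /(_ i)[]]] := ht.
have dF (t : R) : derivable F t 1 by rewrite /derivable e; exact: dphi.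
have F'E (t : R) : F^`()%classic t = f t.
  by rewrite derive1E /derive e.
pose J : set R := `[- M, M]%classic.
transitivity (\int[leb]_(t in J) (f t)%:E)%E.
  rewrite [RHS]integral_mkcond; apply: eq_integral => t _; rewrite patchE.
  case: ifPn => // /negP ht'; rewrite (test_function_out (test_partial i ht)) //.
  apply: out; rewrite leNgt; apply/negP => /ltW; rewrite ler_norml => h.
  by apply: ht'; rewrite inE /J /= in_itv.
rewrite (@continuous_FTC2 _ f F).
- have h t : M <= `|t| -> F t = 0 by move=> /out; exact: test_function_out.
  by rewrite !h ?subee // ?normrN ger0_norm // ltW.
- by lra.
- exact: (continuous_subspaceT cf).
- split.
  + by move=> t _; exact: dF.
  + by apply: cvg_at_right_filter; exact: cF.
  + by apply: cvg_at_left_filter; exact: cF.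
- by move=> t _; exact: F'E.
Qed.

(** Fubini with the innermost integral in direction i. The product is nested as (R x R) x R: i = 2
    is its last factor, while i = 0 and i = 1 are handled within the pair, for a fixed last
    coordinate. *)
Lemma integral_partial phi i : test_function Omega phi -> int3 Omega (partial i phi) = 0.
Proof.
move=> ht; rewrite int3E.
have tp := test_partial i ht.
have [C hC] := test_function_bounded tp.
have mp := continuous_measurable3 (test_function_continuous tp).
pose g (p : pt3) : R := partial i phi (vec3 p).
have [M M0 hM] := bounded_coord.
have gout p : ~ Omega (vec3 p) -> g p = 0 by exact: test_function_out.
have gi : mu.-integrable setT (EFin \o g).
  have mg : measurable_fun [set: pt3] g by exact: mp.
  apply: (@bounded_support_integrable _ pt3 mu _ g C (measurable_open oO) (mu3_bounded oO bO) mg) => //.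
  by move=> x; exact: hC.
rewrite /Rintegral integral_mkcond.
rewrite (eq_integral (EFin \o g)) => [|p _]; last first.
  by rewrite patchE; case: ifPn => // /negP h; rewrite /= gout // => Op; apply: h; rewrite inE.
pose S : set (measurableTypeR R * measurableTypeR R)%type := `]- M, M[ `*` `]- M, M[.
have mS : measurable S by exact: measurableX.
have fS : ((leb \x leb) S < +oo)%E.
  rewrite product_measure1E //.
  pose J : set R := `]- M, M[%classic.
  have h : (leb J < +oo)%E.
    by rewrite /J lebesgue_measure_itv /=; case: ifP => _; rewrite ?ltry // -EFinB ltry.
  by apply: lte_mul_pinfty; rewrite ?measure_ge0 ?ge0_fin_numE ?measure_ge0 ?h.
have g2i (y : R) : (leb \x leb)%E.-integrable setT (EFin \o (fun q => g (q, y))).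
  apply: (bounded_support_integrable mS fS) => //.
  - exact: measurable_fun_pair1.
  - by move=> x; exact: hC.
  - move=> [x1 x2] hS; apply: gout => Op; apply: hS; split => /=; rewrite in_itv /= -ltr_norml.
      by have := hM _ Op 0; rewrite vec3_coord.
    by have := hM _ Op 1; rewrite vec3_coord.
have vE (p : pt3) (t : R) : vec3 ((t, p.1.2), p.2) = vec3 ((0, p.1.2), p.2) + t *: dir 0.
  by apply/rowP; apply: ord3P; rewrite !mxE /= ?mulr0 ?mulr1 ?add0r ?addr0.
have vE1 (p : pt3) (t : R) : vec3 ((p.1.1, t), p.2) = vec3 ((p.1.1, 0), p.2) + t *: dir 1.
  by apply/rowP; apply: ord3P; rewrite !mxE /= ?mulr0 ?mulr1 ?add0r ?addr0.
have vE2 (p : pt3) (t : R) : vec3 (p.1, t) = vec3 (p.1, 0) + t *: dir 2.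
  by apply/rowP; apply: ord3P; rewrite !mxE /= ?mulr0 ?mulr1 ?add0r ?addr0.
have gi' : (leb \x leb \x leb)%E.-integrable setT (EFin \o g) := gi.
suff h0 : (\int[leb \x leb \x leb]_p (EFin \o g) p = 0)%E.
  transitivity (fine (\int[leb \x leb \x leb]_p (EFin \o g) p)%E); last by rewrite h0.
  by [].
have [i2|i2] := eqVneq i 2.
  apply: (@triple_integral_eq0l _ _ _ _ _ _ leb leb leb (EFin \o g) gi') => q.
  rewrite (eq_integral (fun t : measurableTypeR R => (partial i phi (vec3 (q, 0) + t *: dir i)%R)%:E)) => [|t _]; last first.
    by rewrite /= /g (vE2 (q, t)) /= i2.
  by apply: line_integral_partial => //; rewrite i2 vec3_coord.
apply: (@triple_integral_eq0r _ _ _ _ _ _ leb leb leb (EFin \o g) gi') => y.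
have [i1|i1] := eqVneq i 1.
  apply: (@iterated_integral_eq0l _ _ _ _ leb leb _ (g2i y)) => x.
  rewrite (eq_integral (fun t : measurableTypeR R => (partial i phi (vec3 (x, 0, y) + t *: dir i)%R)%:E)) => [|t _]; last first.
    by rewrite /= /g (vE1 (x, t, y)) /= i1.
  by apply: line_integral_partial => //; rewrite i1 vec3_coord.
have i0 : i = 0 by case: i i1 i2 {ht tp mp C hC g gout gi g2i gi'} => -[|[|[|//]]] // *; exact: val_inj.
apply: (@iterated_integral_eq0r _ _ _ _ leb leb _ (g2i y)) => x.
rewrite (eq_integral (fun t : measurableTypeR R => (partial i phi (vec3 (0, x, y) + t *: dir i)%R)%:E)) => [|t _]; last first.
    by rewrite /= /g (vE (t, x, y)) /= i0.
by apply: line_integral_partial => //; rewrite i0 vec3_coord.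
Qed.

End IntegrationByParts.

(** * Weak differential operators *)

(** Openness gives measurability of the domain and boundedness gives finite measure; bundled, they
    are supplied by a single argument. *)
Record bounded_open (R : realType) := BoundedOpen {
  bo_set :> set 'rV[R]_3;
  bo_open : open bo_set;
  bo_bounded : bounded_set bo_set }.

Section FieldCalculus.
Context {R : realType}.
Local Notation pt := 'rV[R]_3.
Local Notation pt3 := (measurableTypeR R * measurableTypeR R * measurableTypeR R)%type.
Local Notation mu := (@mu3 R).
Variable Om : bounded_open R.
Local Notation Omega := (bo_set Om).
Let oO : open Omega. Proof. exact: bo_open. Qed.
Let bO : bounded_set Omega. Proof. exact: bo_bounded. Qed.
Local Notation comp := Defs.comp.
Local Notation D := (vec3 @^-1` Omega : set pt3).
Let mD : measurable D. Proof. exact: measurable_open. Qed.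

Lemma L2_sqi (f : @sfield R) : L2 Omega f <-> sqi mu D (f \o vec3).
Proof. exact: L2P. Qed.

Lemma L2_lin a (f g : @sfield R) : L2 Omega f -> L2 Omega g -> L2 Omega (fun x => a * f x + g x).
Proof. by move=> /L2_sqi hf /L2_sqi hg; apply/L2_sqi; exact: (sqi_lin mD a hf hg). Qed.

Lemma L2_0 : L2 Omega (fun=> 0).
Proof. by apply/L2_sqi; exact: sqi0. Qed.

Lemma L2Z a (f : @sfield R) : L2 Omega f -> L2 Omega (fun x => a * f x).
Proof. by move=> hf; have := L2_lin a hf L2_0; under eq_fun do rewrite addr0. Qed.

Lemma L2D (f g : @sfield R) : L2 Omega f -> L2 Omega g -> L2 Omega (fun x => f x + g x).
Proof. by move=> hf hg; have := L2_lin 1 hf hg; under eq_fun do rewrite mul1r. Qed.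

Lemma L2N (f : @sfield R) : L2 Omega f -> L2 Omega (fun x => - f x).
Proof. by move=> hf; have := L2Z (-1) hf; under eq_fun do rewrite mulN1r. Qed.

Lemma L2B (f g : @sfield R) : L2 Omega f -> L2 Omega g -> L2 Omega (fun x => f x - g x).
Proof. by move=> hf hg; apply: L2D => //; exact: L2N. Qed.

Lemma L2_sum n (F : 'I_n -> @sfield R) : (forall i, L2 Omega (F i)) ->
  L2 Omega (fun x => \sum_i F i x).
Proof.
move=> hF; rewrite (_ : (fun _ => _) = \sum_i F i); last first.
  by apply/funext => x; rewrite fct_sumE.
by elim/big_ind : _ => // [|f g]; [exact: L2_0|exact: L2D].
Qed.

Lemma sip_integrable (f g : @sfield R) : L2 Omega f -> L2 Omega g ->
  mu.-integrable D (EFin \o (fun p => f (vec3 p) * g (vec3 p))).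
Proof. by move=> /L2_sqi hf /L2_sqi hg; exact: (sqi_mul_integrable mD hf hg). Qed.

Lemma sipC (f g : @sfield R) : sip Omega f g = sip Omega g f.
Proof. by rewrite /sip; congr int3; apply/funext => x; rewrite mulrC. Qed.

Lemma sip_linl a (f g h : @sfield R) : L2 Omega f -> L2 Omega g -> L2 Omega h ->
  sip Omega (fun x => a * f x + g x) h = a * sip Omega f h + sip Omega g h.
Proof.
move=> hf hg hh; rewrite /sip !int3E.
have fi := sip_integrable hf hh; have gi := sip_integrable hg hh.
rewrite -RintegralZl // -RintegralD //; last first.
  by have := integrableZl mD a fi; under [X in _.-integrable _ X -> _]eq_fun do rewrite /=.
by apply: eq_Rintegral => p _; rewrite mulrDl mulrA.
Qed.

Lemma sip_linr a (f g h : @sfield R) : L2 Omega f -> L2 Omega g -> L2 Omega h ->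
  sip Omega h (fun x => a * f x + g x) = a * sip Omega h f + sip Omega h g.
Proof. by move=> hf hg hh; rewrite sipC sip_linl // !(sipC h). Qed.

Lemma sipDl (f g h : @sfield R) : L2 Omega f -> L2 Omega g -> L2 Omega h ->
  sip Omega (fun x => f x + g x) h = sip Omega f h + sip Omega g h.
Proof.
by move=> hf hg hh; have := sip_linl 1 hf hg hh; rewrite mul1r => <-;
  congr sip; apply/funext => x; rewrite mul1r.
Qed.

Lemma sip0l (f : @sfield R) : sip Omega (fun=> 0) f = 0.
Proof.
rewrite /sip int3E; under eq_Rintegral do rewrite mul0r.
by rewrite /Rintegral integral0.
Qed.

Lemma sip_ge0 (f : @sfield R) : 0 <= sip Omega f f.
Proof. by rewrite /sip int3E; apply: Rintegral_ge0 => p _; rewrite -expr2 sqr_ge0. Qed.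

Lemma sip_aeql (f f' g : @sfield R) : L2 Omega f -> L2 Omega f' -> L2 Omega g ->
  aeq Omega f f' -> sip Omega f g = sip Omega f' g.
Proof.
move=> /L2_sqi[mf _] /L2_sqi[mf' _] /L2_sqi[mg _] ff'.
rewrite /sip !int3E; apply: eq_ae_Rintegral => //.
- exact: (measurable_funM mf mg).
- exact: (measurable_funM mf' mg).
- by move: ff'; rewrite aeqE; apply: filterS => p h Dp; rewrite /= h.
Qed.

Lemma sip_eq0 (f : @sfield R) : L2 Omega f -> sip Omega f f = 0 -> aeq Omega f (fun=> 0).
Proof. by move=> /L2_sqi sf h; have := Rintegral_sqr_eq0 mD sf h. Qed.

Lemma aeq_refl (V : Type) (f : pt -> V) : aeq Omega f f.
Proof. by rewrite aeqE; apply: nearW. Qed.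

Lemma aeq_sym (V : Type) (f g : pt -> V) : aeq Omega f g -> aeq Omega g f.
Proof. by rewrite !aeqE; apply: filterS => p h Dp; rewrite h. Qed.

Lemma aeq_vP (u v : @vfield R) : aeq Omega u v <-> forall i, aeq Omega (comp i u) (comp i v).
Proof.
split=> [|h]; first by rewrite aeqE => h i; rewrite aeqE; apply: filterS h => p e Dp; rewrite /comp e.
have := h 0; have := h 1; have := h 2; rewrite !aeqE; apply: filterS3 => p h2 h1 h0 Dp.
by apply/rowP; apply: ord3P; [exact: h0|exact: h1|exact: h2].
Qed.

(** Essentially bounded fields multiply L^2 into itself. The finite element fields belong to this
    class, which makes the nonlinear terms of the scheme integrals of integrable functions, hence
    linear in each argument. *)
Definition Bs (f : @sfield R) := L2 Omega f /\ ae_bounded mu D (f \o vec3).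
Definition Bv (v : @vfield R) := forall i, Bs (comp i v).

Lemma Bs_L2 f : Bs f -> L2 Omega f. Proof. by case. Qed.
Lemma Bv_L2 v : Bv v -> L2v Omega v. Proof. by move=> h i; case: (h i). Qed.

Lemma L2_mulB (f g : @sfield R) : Bs f -> L2 Omega g -> L2 Omega (fun x => f x * g x).
Proof.
by move=> [/L2_sqi[mf _] bf] /L2_sqi sg; apply/L2_sqi; exact: (sqi_boundedM mD mf bf sg).
Qed.

Lemma Bs_test phi : test_function Omega phi -> Bs phi.
Proof.
move=> ht; have [C hC] := test_function_bounded ht.
have bphi : ae_bounded mu D (phi \o vec3) by exists C; apply: nearW => p _; exact: hC.
split=> //; apply/L2_sqi; apply: bounded_sqi => //; first exact: mu3_bounded.
apply: (@measurable_funS _ _ _ _ setT) => //.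
exact: continuous_measurable3 (test_function_continuous ht).
Qed.

Lemma vipE (u v : @vfield R) : L2v Omega u -> L2v Omega v ->
  vip Omega u v = \sum_i sip Omega (comp i u) (comp i v).
Proof.
move=> hu hv; rewrite /vip /sip int3E /fdot /dot.
have h i := sip_integrable (hu i) (hv i).
rewrite /Rintegral; under eq_integral do rewrite -sumEFin.
rewrite integral_sum //.
by rewrite -EFin_sum_fine // => i _; apply: integrable_fin_num => //; exact: h.
Qed.

Lemma L2v_lin a (f g : @vfield R) : L2v Omega f -> L2v Omega g -> L2v Omega (fun x => a *: f x + g x).
Proof.
move=> hf hg i; rewrite (_ : comp i _ = fun x => a * comp i f x + comp i g x).
  exact: L2_lin.
by apply/funext => x; rewrite /comp !mxE.
Qed.

Lemma L2v0 : L2v Omega (fun=> 0).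
Proof. by move=> i; rewrite (_ : comp i _ = fun=> 0) ?L2_0 //; [exact: L2_0|apply/funext => x; rewrite /comp mxE]. Qed.

Lemma vipC (u v : @vfield R) : vip Omega u v = vip Omega v u.
Proof.
rewrite /vip; congr int3; apply/funext => x; rewrite /fdot /dot.
by apply: eq_bigr => i _; rewrite mulrC.
Qed.

Lemma comp_lin i a (f g : @vfield R) :
  comp i (fun x => a *: f x + g x) = fun x => a * comp i f x + comp i g x.
Proof. by apply/funext => x; rewrite /comp !mxE. Qed.

Lemma vip_linl a (f g h : @vfield R) : L2v Omega f -> L2v Omega g -> L2v Omega h ->
  vip Omega (fun x => a *: f x + g x) h = a * vip Omega f h + vip Omega g h.
Proof.
move=> hf hg hh; have := L2v_lin a hf hg => hfg; rewrite !vipE // mulr_sumr -big_split /=.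
by apply: eq_bigr => i _; rewrite comp_lin sip_linl.
Qed.

Lemma vip_linr a (f g h : @vfield R) : L2v Omega f -> L2v Omega g -> L2v Omega h ->
  vip Omega h (fun x => a *: f x + g x) = a * vip Omega h f + vip Omega h g.
Proof. by move=> hf hg hh; rewrite vipC vip_linl // !(vipC h). Qed.

Lemma vip_aeql (f f' g : @vfield R) : L2v Omega f -> L2v Omega f' -> L2v Omega g ->
  aeq Omega f f' -> vip Omega f g = vip Omega f' g.
Proof.
move=> hf hf' hg /aeq_vP h; rewrite !vipE //; apply: eq_bigr => i _.
exact: sip_aeql.
Qed.

Lemma vip_aeqr (f f' g : @vfield R) : L2v Omega f -> L2v Omega f' -> L2v Omega g ->
  aeq Omega f f' -> vip Omega g f = vip Omega g f'.
Proof. by move=> hf hf' hg h; rewrite !(vipC g); exact: vip_aeql. Qed.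

Lemma vip_ge0 (f : @vfield R) : 0 <= vip Omega f f.
Proof.
rewrite /vip int3E; apply: Rintegral_ge0 => p _; rewrite /fdot /dot.
by apply: sumr_ge0 => i _; rewrite -expr2 sqr_ge0.
Qed.

Lemma vip_eq0 (f : @vfield R) : L2v Omega f -> vip Omega f f = 0 -> aeq Omega f (fun=> 0).
Proof.
move=> hf; rewrite vipE // => /eqP; rewrite psumr_eq0 => [/allP h|i _]; last exact: sip_ge0.
apply/aeq_vP => i; have /eqP := h i (mem_index_enum _).
move=> /(sip_eq0 (hf i)); rewrite (_ : comp i (fun=> 0) = fun=> 0) //.
by apply/funext => x; rewrite /comp mxE.
Qed.

Lemma fdot_L2 (u v : @vfield R) : Bv u -> L2v Omega v -> L2 Omega (fdot u v).
Proof. by move=> hu hv; apply: L2_sum => i; exact: L2_mulB (hu i) (hv i). Qed.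

Lemma fcross_comp (u v : @vfield R) i : comp i (fcross u v) =
  fun x => comp (i + 1) u x * comp (i + 2) v x - comp (i + 2) u x * comp (i + 1) v x.
Proof. by apply/funext => x; rewrite /comp /fcross /cross mxE. Qed.

Lemma fcross_L2 (u v : @vfield R) : Bv u -> L2v Omega v -> L2v Omega (fcross u v).
Proof. by move=> hu hv i; rewrite fcross_comp; apply: L2B; apply: L2_mulB. Qed.

End FieldCalculus.

Section WeakOperators.
Context {R : realType}.
Local Notation pt := 'rV[R]_3.
Local Notation comp := Defs.comp.
Local Notation dir i := (delta_mx 0 i : pt).

Lemma CkW k (f : @sfield R) : Ck k.+1 f -> Ck k f.
Proof.
elim: k f => [|k ih] f [cf hf]; first by split.
by split=> // i; have [df pf] := hf i; split => //; exact: ih.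
Qed.

Lemma Ck_cst k (a : R) : Ck k (fun=> a).
Proof.
elim: k a => [|k ih] a; split => //; try by move=> x; exact: cst_continuous.
move=> i; split; first by move=> x; exact: derivable_cst.
rewrite (_ : partial i _ = fun=> 0) //.
by apply/funext => x; rewrite /partial derive_cst.
Qed.

Lemma CkD k (f g : @sfield R) : Ck k f -> Ck k g -> Ck k (fun x => f x + g x).
Proof.
elim: k f g => [|k ih] f g [cf hf] [cg hg].
  by split=> // x; apply: continuousD; [exact: cf|exact: cg].
split=> [x|i]; first by apply: continuousD; [exact: cf|exact: cg].
have [df pf] := hf i; have [dg pg] := hg i.
split; first by move=> x; exact: derivableD.
rewrite (_ : partial i _ = fun x => partial i f x + partial i g x); first exact: ih.
by apply/funext => x; rewrite /partial deriveD.
Qed.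

Lemma CkM k (f g : @sfield R) : Ck k f -> Ck k g -> Ck k (fun x => f x * g x).
Proof.
elim: k f g => [|k ih] f g hf hg.
  by have [[cf _] [cg _]] := (hf, hg); split=> // x; apply: continuousM; [exact: cf|exact: cg].
have [[cf pf] [cg pg]] := (hf, hg).
split=> [x|i]; first by apply: continuousM; [exact: cf|exact: cg].
have [df pdf] := pf i; have [dg pdg] := pg i.
split; first by move=> x; exact: derivableM.
rewrite (_ : partial i _ = fun x => f x * partial i g x + g x * partial i f x).
  by apply: CkD; apply: ih => //; exact: CkW.
by apply/funext => x; rewrite /partial deriveM.
Qed.

Variable Om : bounded_open R.
Local Notation Omega := (bo_set Om).
Let oO : open Omega. Proof. exact: bo_open. Qed.
Let bO : bounded_set Omega. Proof. exact: bo_bounded. Qed.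

Lemma test_function0 : test_function Omega (fun=> 0).
Proof. by split; [move=> k; exact: Ck_cst|exists set0 => //; split => //; exact: compact0]. Qed.

Lemma test_functionM phi psi : test_function Omega phi -> (forall k, Ck k psi) ->
  test_function Omega (fun x => phi x * psi x).
Proof.
move=> [h1 [K hK h2]] h3; split; first by move=> k; exact: CkM.
by exists K => // x /h2 ->; rewrite mul0r.
Qed.

Lemma test_function_lin a phi psi : test_function Omega phi -> test_function Omega psi ->
  test_function Omega (fun x => a * phi x + psi x).
Proof.
move=> [h1 [K [cK KO] h2]] [h3 [L [cL LO] h4]]; split.
  by move=> k; apply: CkD => //; apply: CkM => //; exact: Ck_cst.
exists (K `|` L); first by split; [exact: compactU|rewrite subUset].
by move=> x /not_orP[/h2 -> /h4 ->]; rewrite mulr0 addr0.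
Qed.

Lemma test_L2 phi : test_function Omega phi -> L2 Omega phi.
Proof. by move=> /Bs_test /Bs_L2. Qed.

Lemma partial_L2 phi i : test_function Omega phi -> L2 Omega (partial i phi).
Proof. by move=> h; apply: test_L2; exact: test_partial. Qed.

Lemma integration_by_parts phi psi i : test_function Omega phi -> test_function Omega psi ->
  sip Omega phi (partial i psi) = - sip Omega (partial i phi) psi.
Proof.
move=> hphi hpsi; apply/eqP; rewrite -addr_eq0; apply/eqP.
have := integral_partial oO bO i (test_functionM hphi hpsi.1).
rewrite (_ : partial i _ = fun x => phi x * partial i psi x + partial i phi x * psi x); last first.
  have [[_ /(_ i)[d1 _]] [_ /(_ i)[d2 _]]] := (hphi.1 1%N, hpsi.1 1%N).
  apply/funext => x; rewrite /partial deriveM //=.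
  by rewrite [in RHS]mulrC [X in _ = _ + X]mulrC; congr (_ + _); rewrite mulrC.
rewrite /sip !int3E RintegralD //; first exact: measurable_open.
- by apply: sip_integrable; [exact: test_L2|exact: partial_L2].
- by apply: sip_integrable; [exact: partial_L2|exact: test_L2].
Qed.

(** Test fields with one nonzero component reduce the vector identities to scalar ones. *)
Definition vsingle (i : 'I_3) (phi : @sfield R) : @vfield R := fun x => phi x *: dir i.

Lemma comp_vsingle i j phi : comp j (vsingle i phi) = if j == i then phi else fun=> 0.
Proof.
apply/funext => x; rewrite /comp /vsingle !mxE eqxx /=.
by case: eqP => _; rewrite ?mulr1 ?mulr0.
Qed.

Lemma vtest_vsingle i phi : test_function Omega phi -> vtest_function Omega (vsingle i phi).
Proof. by move=> h j; rewrite comp_vsingle; case: ifP => // _; exact: test_function0. Qed.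

Lemma vip_vsingle i (v : @vfield R) phi : vip Omega v (vsingle i phi) = sip Omega (comp i v) phi.
Proof.
rewrite /vip /sip; congr int3; apply/funext => x; rewrite /fdot /dot (bigD1 i) //= big1.
  by rewrite addr0 -/(comp i (vsingle i phi) x) comp_vsingle eqxx.
by move=> j ji; rewrite -/(comp j (vsingle i phi) x) comp_vsingle (negbTE ji) mulr0.
Qed.

Lemma partial0 i : @partial R i (fun=> 0) = fun=> 0.
Proof. by apply/funext => x; rewrite /partial derive_cst. Qed.

Lemma cdiv_vsingle i (phi : @sfield R) : cdiv (vsingle i phi) = partial i phi.
Proof.
apply/funext => x; rewrite /cdiv (bigD1 i) //= big1 ?addr0 ?comp_vsingle ?eqxx //.
by move=> j ji; rewrite comp_vsingle (negbTE ji) partial0.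
Qed.

Lemma comp_cgrad i (phi : @sfield R) : comp i (cgrad phi) = partial i phi.
Proof. by apply/funext => x; rewrite /comp /cgrad mxE. Qed.

Lemma vtest_L2 phi : vtest_function Omega phi -> L2v Omega phi.
Proof. by move=> h i; exact: test_L2. Qed.

Lemma cgrad_L2 phi : test_function Omega phi -> L2v Omega (cgrad phi).
Proof. by move=> h i; rewrite comp_cgrad; exact: partial_L2. Qed.

Lemma cdiv_L2 phi : vtest_function Omega phi -> L2 Omega (cdiv phi).
Proof. by move=> h; apply: L2_sum => i; exact: partial_L2. Qed.

Lemma comp_ccurl i (phi : @vfield R) : comp i (ccurl phi) = fun x =>
  partial (i + 1) (comp (i + 2) phi) x - partial (i + 2) (comp (i + 1) phi) x.
Proof. by apply/funext => x; rewrite /comp /ccurl mxE. Qed.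

Lemma ccurl_L2 phi : vtest_function Omega phi -> L2v Omega (ccurl phi).
Proof. by move=> h i; rewrite comp_ccurl; apply: L2B; exact: partial_L2. Qed.

Lemma sip_sumr n (F : 'I_n -> @sfield R) (f : @sfield R) : L2 Omega f ->
  (forall i, L2 Omega (F i)) ->
  sip Omega f (fun x => \sum_i F i x) = \sum_i sip Omega f (F i).
Proof.
move=> hf; elim: n F => [|n ih] F hF.
  have -> : (fun x => \sum_(i < 0) F i x) = fun=> 0 :> R by apply/funext => x; rewrite big_ord0.
  by rewrite big_ord0 sipC sip0l.
have -> : (fun x => \sum_i F i x) = fun x => 1 * F ord0 x + \sum_i F (lift ord0 i) x.
  by apply/funext => x; rewrite big_ord_recl mul1r.
rewrite big_ord_recl -ih // sip_linr ?mul1r //.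
by apply: L2_sum => i; exact: hF.
Qed.

Lemma sip_suml n (F : 'I_n -> @sfield R) (f : @sfield R) : L2 Omega f ->
  (forall i, L2 Omega (F i)) ->
  sip Omega (fun x => \sum_i F i x) f = \sum_i sip Omega (F i) f.
Proof.
by move=> hf hF; rewrite (sipC Om) sip_sumr //; apply: eq_bigr => i _; exact: sipC.
Qed.

Lemma test_wgrad phi : test_function Omega phi -> is_wgrad Omega phi (cgrad phi).
Proof.
move=> h; split; [exact: test_L2|exact: cgrad_L2|move=> psi hpsi].
rewrite vipE; [|exact: cgrad_L2|exact: vtest_L2].
rewrite sip_sumr; [|exact: test_L2|by move=> i; exact: partial_L2].
rewrite -sumrN; apply: eq_bigr => i _.
by rewrite comp_cgrad -integration_by_parts.
Qed.

Lemma is_wgrad_partial (f : @sfield R) g i phi : is_wgrad Omega f g -> test_function Omega phi ->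
  sip Omega f (partial i phi) = - sip Omega (comp i g) phi.
Proof.
move=> [_ _ h] ht; have := h _ (vtest_vsingle i ht).
by rewrite cdiv_vsingle vip_vsingle.
Qed.

Lemma L2_eq0 (f : @sfield R) : L2 Omega f ->
  (forall phi, test_function Omega phi -> sip Omega f phi = 0) -> aeq Omega f (fun=> 0).
Proof. by move=> /L2_sqi hf h; apply: fundamental_lemma. Qed.

Lemma sipB0 (f g phi : @sfield R) : L2 Omega f -> L2 Omega g -> L2 Omega phi ->
  sip Omega f phi = sip Omega g phi -> sip Omega (fun x => f x - g x) phi = 0.
Proof.
move=> hf hg hp e.
rewrite (_ : (fun x => f x - g x) = fun x => -1 * g x + f x).
  by rewrite sip_linl // e mulN1r addNr.
by apply/funext => x; rewrite mulN1r addrC.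
Qed.

Lemma aeq_sub0 (f g : @sfield R) : aeq Omega (fun x => f x - g x) (fun=> 0) -> aeq Omega f g.
Proof. by rewrite !aeqE; apply: filterS => p h Dp; apply/eqP; rewrite -subr_eq0 h. Qed.

Lemma L2_eq (f g : @sfield R) : L2 Omega f -> L2 Omega g ->
  (forall phi, test_function Omega phi -> sip Omega f phi = sip Omega g phi) -> aeq Omega f g.
Proof.
move=> hf hg h; apply: aeq_sub0; apply: L2_eq0; first exact: L2B.
by move=> phi hphi; apply: sipB0 => //; [exact: test_L2|exact: h].
Qed.

Lemma L2v_eq (u v : @vfield R) : L2v Omega u -> L2v Omega v ->
  (forall phi, vtest_function Omega phi -> vip Omega u phi = vip Omega v phi) -> aeq Omega u v.
Proof.
move=> hu hv h; apply/aeq_vP => i; apply: L2_eq => // phi hphi.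
by rewrite -!vip_vsingle; apply: h; exact: vtest_vsingle.
Qed.

Lemma wgrad_uniq f g g' : is_wgrad Omega f g -> is_wgrad Omega f g' -> aeq Omega g g'.
Proof.
move=> [_ h1 h2] [_ h3 h4]; apply: L2v_eq => // phi hphi.
by apply: oppr_inj; rewrite -h2 // -h4.
Qed.

Lemma wcurl_uniq f g g' : is_wcurl Omega f g -> is_wcurl Omega f g' -> aeq Omega g g'.
Proof.
move=> [_ h1 h2] [_ h3 h4]; apply: L2v_eq => // phi hphi.
by rewrite -h2 // -h4.
Qed.

Lemma wdiv_uniq f g g' : is_wdiv Omega f g -> is_wdiv Omega f g' -> aeq Omega g g'.
Proof.
move=> [_ h1 h2] [_ h3 h4]; apply: L2_eq => // phi hphi.
by apply: oppr_inj; rewrite -h2 // -h4.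
Qed.

Lemma wgradP f : H1 Omega f -> is_wgrad Omega f (wgrad Omega f).
Proof. by move=> [g hg]; exact: (xgetPex _ (ex_intro _ g hg)). Qed.

Lemma wcurlP v : (exists w, is_wcurl Omega v w) -> is_wcurl Omega v (wcurl Omega v).
Proof. by move=> [g hg]; exact: (xgetPex _ (ex_intro _ g hg)). Qed.

Lemma wdivP v : (exists w, is_wdiv Omega v w) -> is_wdiv Omega v (wdiv Omega v).
Proof. by move=> [g hg]; exact: (xgetPex _ (ex_intro _ g hg)). Qed.

(** No regularity of f is assumed: where there is no weak gradient the operator returns its default
    0, which is in L^2. The same holds for the curl and the divergence. *)
Lemma wgrad_L2 f : L2v Omega (wgrad Omega f).
Proof.
have [/wgradP[]//|h] := pselect (H1 Omega f).
by rewrite /wgrad xgetPN => [|g hg]; [exact: L2v0|apply: h; exists g].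
Qed.

Lemma wcurl_L2 v : L2v Omega (wcurl Omega v).
Proof.
have [/wcurlP[]//|h] := pselect (exists w, is_wcurl Omega v w).
by rewrite /wcurl xgetPN => [|g hg]; [exact: L2v0|apply: h; exists g].
Qed.

Lemma wdiv_L2 v : L2 Omega (wdiv Omega v).
Proof.
have [/wdivP[]//|h] := pselect (exists w, is_wdiv Omega v w).
by rewrite /wdiv xgetPN => [|g hg]; [exact: L2_0|apply: h; exists g].
Qed.

Lemma is_wgrad_lin a f g f' g' : is_wgrad Omega f g -> is_wgrad Omega f' g' ->
  is_wgrad Omega (fun x => a * f x + f' x) (fun x => a *: g x + g' x).
Proof.
move=> [h1 h2 h3] [h4 h5 h6]; split; [exact: L2_lin|exact: L2v_lin|move=> phi hphi].
have h7 := cdiv_L2 hphi; have h8 := vtest_L2 hphi.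
by rewrite sip_linl // vip_linl // h3 // h6 //; ring.
Qed.

Lemma is_wcurl_lin a f g f' g' : is_wcurl Omega f g -> is_wcurl Omega f' g' ->
  is_wcurl Omega (fun x => a *: f x + f' x) (fun x => a *: g x + g' x).
Proof.
move=> [h1 h2 h3] [h4 h5 h6]; split; [exact: L2v_lin|exact: L2v_lin|move=> phi hphi].
have h7 := ccurl_L2 hphi; have h8 := vtest_L2 hphi.
by rewrite !vip_linl // h3 // h6.
Qed.

Lemma is_wdiv_lin a f g f' g' : is_wdiv Omega f g -> is_wdiv Omega f' g' ->
  is_wdiv Omega (fun x => a *: f x + f' x) (fun x => a * g x + g' x).
Proof.
move=> [h1 h2 h3] [h4 h5 h6]; split; [exact: L2v_lin|exact: L2_lin|move=> phi hphi].
have h7 := cgrad_L2 hphi; have h8 := test_L2 hphi.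
by rewrite sip_linl // vip_linl // h3 // h6 //; ring.
Qed.

Lemma is_wgrad_aeq f f' g : is_wgrad Omega f g -> L2 Omega f' -> aeq Omega f f' -> is_wgrad Omega f' g.
Proof.
move=> [h1 h2 h3] h4 e; split=> // phi hphi; rewrite -h3 //; apply: sip_aeql => //.
- exact: cdiv_L2.
- exact: aeq_sym.
Qed.

Lemma is_wcurl_aeq f f' g : is_wcurl Omega f g -> L2v Omega f' -> aeq Omega f f' -> is_wcurl Omega f' g.
Proof.
move=> [h1 h2 h3] h4 e; split=> // phi hphi; rewrite -h3 //; apply: vip_aeql => //.
- exact: ccurl_L2.
- exact: aeq_sym.
Qed.

Lemma is_wdiv_aeq f f' g : is_wdiv Omega f g -> L2v Omega f' -> aeq Omega f f' -> is_wdiv Omega f' g.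
Proof.
move=> [h1 h2 h3] h4 e; split=> // phi hphi; rewrite -h3 //; apply: vip_aeql => //.
- exact: cgrad_L2.
- exact: aeq_sym.
Qed.

Lemma sum_ord3 (V : nmodType) (F : 'I_3 -> V) : \sum_i F i = F 0 + F 1 + F 2.
Proof.
rewrite !big_ord_recr big_ord0 /= add0r.
by congr (F _ + F _ + F _); apply: val_inj.
Qed.

(** A velocity has weak gradients of its components, whereas the scheme takes its divergence and its
    curl. This lemma and the next supply both. *)
Lemma H1v_wdiv v : H1v Omega v ->
  is_wdiv Omega v (fun x => \sum_i comp i (wgrad Omega (comp i v)) x).
Proof.
move=> hv; have hw i := wgradP (hv i).
have hL i : L2 Omega (comp i v) by have [] := hw i.
split=> //; first by apply: L2_sum => i; exact: wgrad_L2.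
move=> phi hphi; rewrite vipE //; last exact: cgrad_L2.
rewrite sip_suml; [|exact: test_L2|by move=> i; exact: wgrad_L2].
rewrite -sumrN; apply: eq_bigr => i _; rewrite comp_cgrad.
exact: is_wgrad_partial.
Qed.

Lemma H1v_wcurl v : H1v Omega v -> exists w, is_wcurl Omega v w.
Proof.
move=> hv; have hw i := wgradP (hv i).
have hL i : L2 Omega (comp i v) by have [] := hw i.
pose G i j : @sfield R := comp j (wgrad Omega (comp i v)).
have hG i j : L2 Omega (G i j) by exact: wgrad_L2.
pose w : @vfield R := fun x => \row_i (G (i + 2) (i + 1) x - G (i + 1) (i + 2) x).
have wE i : comp i w = fun x => G (i + 2) (i + 1) x - G (i + 1) (i + 2) x.
  by apply/funext => x; rewrite /comp mxE.
exists w; split=> //; first by move=> i; rewrite wE; exact: L2B.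
move=> phi hphi; rewrite !vipE //; [|by move=> i; rewrite wE; exact: L2B|exact: vtest_L2|exact: ccurl_L2].
have e1 i : sip Omega (comp i v) (comp i (ccurl phi)) =
    sip Omega (G i (i + 2)) (comp (i + 1) phi) - sip Omega (G i (i + 1)) (comp (i + 2) phi).
  rewrite comp_ccurl (sipC Om) (_ : (fun x => _) = fun x =>
    -1 * partial (i + 2) (comp (i + 1) phi) x + partial (i + 1) (comp (i + 2) phi) x); last first.
    by apply/funext => x; rewrite mulN1r addrC.
  rewrite sip_linl //; [|exact: partial_L2|exact: partial_L2].
  by rewrite !(sipC Om (partial _ _)) !(is_wgrad_partial _ (hw i)) // mulN1r opprK.
have e2 i : sip Omega (comp i w) (comp i phi) =
    sip Omega (G (i + 2) (i + 1)) (comp i phi) - sip Omega (G (i + 1) (i + 2)) (comp i phi).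
  rewrite wE (_ : (fun x => _) = fun x => -1 * G (i + 1) (i + 2) x + G (i + 2) (i + 1) x); last first.
    by apply/funext => x; rewrite mulN1r addrC.
  by rewrite sip_linl // ?mulN1r 1?addrC //; exact: test_L2.
(* With the indices reduced mod 3, both sums consist of the same six pairings of a gradient entry
   with a component of phi. *)
rewrite !sum_ord3 !e1 !e2.
have -> : (0 + 1 : 'I_3) = 1 by apply: val_inj.
have -> : (0 + 2 : 'I_3) = 2 by apply: val_inj.
have -> : (1 + 1 : 'I_3) = 2 by apply: val_inj.
have -> : (1 + 2 : 'I_3) = 0 by apply: val_inj.
have -> : (2 + 1 : 'I_3) = 0 by apply: val_inj.
have -> : (2 + 2 : 'I_3) = 1 by apply: val_inj.
ring.
Qed.

End WeakOperators.

Section TripleProduct.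
Context {R : realType}.
Local Notation pt := 'rV[R]_3.
Implicit Types (a b u v : pt).

Lemma dot_cross u a b : dot (cross u a) b = dot a (cross b u).
Proof.
rewrite /dot !sum_ord3 !mxE.
have -> : 0 + 1 = 1 :> 'I_3 by apply/val_inj.
have -> : 0 + 2 = 2 :> 'I_3 by apply/val_inj.
have -> : 1 + 1 = 2 :> 'I_3 by apply/val_inj.
have -> : 1 + 2 = 0 :> 'I_3 by apply/val_inj.
have -> : 2 + 1 = 0 :> 'I_3 by apply/val_inj.
have -> : 2 + 2 = 1 :> 'I_3 by apply/val_inj.
by ring.
Qed.

Lemma crossvv u : cross u u = 0.
Proof. by apply/rowP => i; rewrite !mxE mulrC subrr. Qed.

Lemma crossC u v : cross u v = -1 *: cross v u.
Proof. by apply/rowP => i; rewrite !mxE; ring. Qed.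

Lemma dot_crossl u a : dot (cross u a) u = 0.
Proof. by rewrite dot_cross crossvv /dot big1 // => i _; rewrite mxE mulr0. Qed.

Lemma vip_fdot (Omega : set pt) (u v u' v' : @vfield R) : fdot u v = fdot u' v' -> vip Omega u v = vip Omega u' v'.
Proof. by rewrite /vip => ->. Qed.

End TripleProduct.

(* Unification must not unfold these into integrals and choice operators. *)
Local Opaque wgrad wcurl wdiv vip sip L2 aeq.

(** * Linearity of the Sobolev spaces and of the weak operators *)

Section Spaces.
Context {R : realType}.
Local Notation pt := 'rV[R]_3.
Local Notation comp := Defs.comp.
Variable Om : bounded_open R.
Local Notation Omega := (bo_set Om).
Local Notation pt3 := (measurableTypeR R * measurableTypeR R * measurableTypeR R)%type.
Local Notation mu := (@mu3 R).
Let oO : open Omega. Proof. exact: bo_open. Qed.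
Let bO : bounded_set Omega. Proof. exact: bo_bounded. Qed.

Lemma H1_L2 f : H1 Omega f -> L2 Omega f. Proof. by move=> [g []]. Qed.
Lemma H1v_L2 v : H1v Omega v -> L2v Omega v. Proof. by move=> h i; exact: H1_L2. Qed.

Lemma H1_lin a f g : H1 Omega f -> H1 Omega g -> H1 Omega (fun x => a * f x + g x).
Proof. by move=> [f' hf] [g' hg]; eexists; exact: is_wgrad_lin hf hg. Qed.

Lemma wgrad_lin a f g : H1 Omega f -> H1 Omega g ->
  aeq Omega (wgrad Omega (fun x => a * f x + g x)) (fun x => a *: wgrad Omega f x + wgrad Omega g x).
Proof.
move=> hf hg; apply: wgrad_uniq (wgradP (H1_lin a hf hg)) _.
by apply: is_wgrad_lin; exact: wgradP.
Qed.

Lemma wcurl_lin a u v : (exists w, is_wcurl Omega u w) -> (exists w, is_wcurl Omega v w) ->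
  aeq Omega (wcurl Omega (fun x => a *: u x + v x)) (fun x => a *: wcurl Omega u x + wcurl Omega v x).
Proof.
move=> /wcurlP hu /wcurlP hv; have h := is_wcurl_lin a hu hv.
by apply: (wcurl_uniq _ h); apply: wcurlP; eexists; exact: h.
Qed.

Lemma wdiv_lin a u v : (exists w, is_wdiv Omega u w) -> (exists w, is_wdiv Omega v w) ->
  aeq Omega (wdiv Omega (fun x => a *: u x + v x)) (fun x => a * wdiv Omega u x + wdiv Omega v x).
Proof.
move=> /wdivP hu /wdivP hv; have h := is_wdiv_lin a hu hv.
by apply: (wdiv_uniq _ h); apply: wdivP; eexists; exact: h.
Qed.

(** Parallelogram identity for a f and g, without the nonnegative square of g - a f. *)
Lemma sip_lin_le a (f g : @sfield R) : L2 Omega f -> L2 Omega g ->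
  sip Omega (fun x => a * f x + g x) (fun x => a * f x + g x)
  <= 2 * a ^+ 2 * sip Omega f f + 2 * sip Omega g g.
Proof.
move=> hf hg.
have h1 := L2_lin a hf hg; have h2 := L2_lin (- a) hf hg.
have := sip_ge0 Om (fun x => - a * f x + g x).
rewrite !sip_linl // !sip_linr // (sipC Om g f).
move: (sip _ f f) (sip _ f g) (sip _ g g) => A B C; lra.
Qed.

Lemma vip_lin_le a (f g : @vfield R) : L2v Omega f -> L2v Omega g ->
  vip Omega (fun x => a *: f x + g x) (fun x => a *: f x + g x)
  <= 2 * a ^+ 2 * vip Omega f f + 2 * vip Omega g g.
Proof.
move=> hf hg.
have h1 := L2v_lin a hf hg; have h2 := L2v_lin (- a) hf hg.
have := vip_ge0 Om (fun x => - a *: f x + g x).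
rewrite !vip_linl // !vip_linr // (vipC Om g f).
move: (vip _ f f) (vip _ f g) (vip _ g g) => A B C; lra.
Qed.

Lemma H1_test phi : test_function Omega phi -> H1 Omega phi.
Proof. by move=> h; exists (cgrad phi); exact: test_wgrad. Qed.

Definition h1sqr (f : @sfield R) :=
  sip Omega f f + vip Omega (wgrad Omega f) (wgrad Omega f).

Lemma h1sqr_ge0 f : 0 <= h1sqr f.
Proof. by rewrite addr_ge0 ?sip_ge0 ?vip_ge0. Qed.

Lemma h1sqr_lin_le a f g : H1 Omega f -> H1 Omega g ->
  h1sqr (fun x => a * f x + g x) <= 2 * a ^+ 2 * h1sqr f + 2 * h1sqr g.
Proof.
move=> hf hg; rewrite /h1sqr.
have h1 := sip_lin_le a (H1_L2 hf) (H1_L2 hg).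
have hwf := wgrad_L2 Om f; have hwg := wgrad_L2 Om g.
have h2 := vip_lin_le a hwf hwg.
have hL := L2v_lin a hwf hwg.
have hW := wgrad_L2 Om (fun x => a * f x + g x).
have e := wgrad_lin a hf hg.
move: (wgrad Omega (fun x => a * f x + g x)) hW e => W hW e.
rewrite (vip_aeql hW hL hW e) (vip_aeqr hW hL hL e).
rewrite !mulrDr addrACA; exact: lerD h1 h2.
Qed.

Lemma H01_lin a f g : H01 Omega f -> H01 Omega g -> H01 Omega (fun x => a * f x + g x).
Proof.
move=> [hf af] [hg ag]; split; first exact: H1_lin.
(* Approximating f and g within dl leaves a squared error below 2 a^2 dl^2 + 2 dl^2, which is at
   most 4 (1 + |a|)^2 dl^2 = e^2. *)
move=> e e0; pose dl := e / (2 * (1 + `|a|)).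
have a1 : 0 < 1 + `|a| by rewrite ltr_wpDr.
have d0 : 0 < dl by rewrite divr_gt0 // mulr_gt0.
have [phi tphi nphi] := af _ d0; have [psi tpsi npsi] := ag _ d0.
exists (fun x => a * phi x + psi x); first exact: test_function_lin.
have sub u v : H1 Omega u -> H1 Omega v -> H1 Omega (fun x => u x - v x).
  move=> hu hv; have := H1_lin (-1) hv hu; congr H1.
  by apply/funext => x; rewrite mulN1r addrC.
pose F x := f x - phi x; pose G x := g x - psi x.
have hF : H1 Omega F by apply: sub => //; exact: H1_test.
have hG : H1 Omega G by apply: sub => //; exact: H1_test.
have -> : (fun x => a * f x + g x - (a * phi x + psi x)) = fun x => a * F x + G x.
  by apply/funext => x; rewrite /F /G; ring.
have Nlt u : h1norm Omega u < dl -> h1sqr u < dl ^+ 2.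
  by rewrite /h1norm -/(h1sqr u) => h; rewrite -(sqr_sqrtr (h1sqr_ge0 u)) ltrXn2r // ?nnegrE ?sqrtr_ge0 // ltW.
have NF : h1sqr F < dl ^+ 2 by exact: Nlt nphi.
have NG : h1sqr G < dl ^+ 2 by exact: Nlt npsi.
have hwF := wgrad_L2 Om F; have hwG := wgrad_L2 Om G.
have NFG : h1sqr (fun x => a * F x + G x) <= 2 * a ^+ 2 * h1sqr F + 2 * h1sqr G.
  exact: h1sqr_lin_le.
rewrite /h1norm -/(h1sqr _) -(ltr_pXn2r (n := 2)) ?nnegrE ?sqrtr_ge0 ?(ltW e0) // sqr_sqrtr ?h1sqr_ge0 //.
have ea : e = dl * (2 * (1 + `|a|)) by rewrite /dl divfK // gt_eqF // mulr_gt0.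
apply: (@lt_le_trans _ _ (2 * a ^+ 2 * dl ^+ 2 + 2 * dl ^+ 2)); last first.
  rewrite ea -[a ^+ 2]real_normK ?num_real //; have := normr_ge0 a.
  move: (`|a|) => b b0; rewrite -subr_ge0.
  rewrite (_ : _ - _ = dl ^+ 2 * (2 * b ^+ 2 + 8 * b + 2)); last by ring.
  by rewrite mulr_ge0 ?sqr_ge0 // addr_ge0 // addr_ge0 // mulr_ge0 // sqr_ge0.
apply: le_lt_trans NFG _; apply: ler_ltD; last by rewrite ltr_pM2l.
by apply: ler_wpM2l (ltW NF); apply: mulr_ge0; [exact: ler0n|exact: sqr_ge0].
Qed.

Lemma C0bar_lin a f g : C0bar Omega f -> C0bar Omega g -> C0bar Omega (fun x => a * f x + g x).
Proof.
move=> [f' cf ef] [g' cg eg]; exists (fun x => a * f' x + g' x).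
  move=> x; apply: cvgD; last exact: cg.
  by apply: cvgMr; exact: cf.
by move: ef eg; rewrite !aeqE; apply: filterS2 => p h1 h2 Dp; rewrite h1 // h2.
Qed.

Lemma wcurl_dom_L2 v : (exists w, is_wcurl Omega v w) -> L2v Omega v. Proof. by move=> [w []]. Qed.
Lemma wdiv_dom_L2 v : (exists w, is_wdiv Omega v w) -> L2v Omega v. Proof. by move=> [w []]. Qed.

Lemma H0curl_lin a u v : H0curl Omega u -> H0curl Omega v -> H0curl Omega (fun x => a *: u x + v x).
Proof.
move=> [du tu] [dv tv]; split.
  by have [[w hw] [w' hw']] := (du, dv); eexists; exact: is_wcurl_lin hw hw'.
move=> w hw; have hwL := H1v_L2 hw.
have [hu hv] := (wcurl_dom_L2 du, wcurl_dom_L2 dv).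
rewrite (vip_aeql (wcurl_L2 Om _) (L2v_lin a (wcurl_L2 Om u) (wcurl_L2 Om v)) hwL (wcurl_lin a du dv)).
have e1 := subr0_eq (tu w hw); have e2 := subr0_eq (tv w hw); have cw := wcurl_L2 Om w.
rewrite (vip_linl a (wcurl_L2 Om u) (wcurl_L2 Om v) hwL) (vip_linl a hu hv cw).
by rewrite e1 e2 subrr.
Qed.

Lemma H0div_lin a u v : H0div Omega u -> H0div Omega v -> H0div Omega (fun x => a *: u x + v x).
Proof.
move=> [du tu] [dv tv]; split.
  by have [[w hw] [w' hw']] := (du, dv); eexists; exact: is_wdiv_lin hw hw'.
move=> q hq; have hqL := H1_L2 hq.
have [hu hv] := (wdiv_dom_L2 du, wdiv_dom_L2 dv).
rewrite (sip_aeql (wdiv_L2 Om _) (L2_lin a (wdiv_L2 Om u) (wdiv_L2 Om v)) hqL (wdiv_lin a du dv)).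
have gq := wgrad_L2 Om q.
have /eqP := tu q hq; rewrite addr_eq0 => /eqP e1.
have /eqP := tv q hq; rewrite addr_eq0 => /eqP e2.
rewrite (vip_linl a hu hv gq) (sip_linl a (wdiv_L2 Om u) (wdiv_L2 Om v) hqL).
by rewrite e1 e2 mulrN -opprD addNr.
Qed.

End Spaces.

(** * Finite element spaces *)

Section Annihilator.
Variables (R : realType) (n : nat) (S : 'rV[R]_n -> Prop).
Hypotheses (S0 : S 0) (S_lin : forall a u v, S u -> S v -> S (a *: u + v)).

(** S is a subspace known only through a predicate. A matrix of maximal rank with rows in S spans
    it, since adjoining one more row from S cannot raise the rank. The columns of its cokernel
    annihilate S, hence l, which puts l in the row space. *)
Lemma double_annihilator (l : 'rV[R]_n) :
  (forall x : 'rV[R]_n, (forall d, S d -> d *m x^T = 0) -> l *m x^T = 0) -> S l.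
Proof.
move=> hl.
pose Q r := `[< exists m (A : 'M[R]_(m, n)), (forall i, S (row i A)) /\ \rank A = r >].
have Q0 : exists r, Q r.
  by exists 0%N; apply/asboolP; exists 0%N, 0; split; [case|exact: mxrank0].
have Qn r : Q r -> (r <= n)%N by move=> /asboolP[m [A [_ <-]]]; exact: rank_leq_col.
case: (ex_maxnP Q0 Qn) => r /asboolP[m [A [SA rA]]] rmax.
have Sspan d : (d <= A)%MS -> S d.
  move=> /submxP[x ->]; rewrite mulmx_sum_row.
  by elim/big_rec : _ => // i y _ Sy; exact: S_lin.
have span d : S d -> (d <= A)%MS.
  move=> Sd.
  have rk : (\rank (col_mx A d) <= r)%N.
    apply: rmax; apply/asboolP; exists (m + 1)%N, (col_mx A d); split=> // i.
    case: (split_ordP i) => j ->; first by rewrite rowKu.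
    by rewrite rowKd ord1 row_id.
  have sAB : (A <= col_mx A d)%MS by rewrite -addsmxE addsmxSl.
  have := mxrank_leqif_sup sAB; rewrite rA => -[h1 h2].
  have e : (r == \rank (col_mx A d)) by rewrite eqn_leq h1 rk.
  rewrite e in h2; apply: submx_trans (_ : (col_mx A d <= A)%MS); last by rewrite -h2.
  by rewrite -addsmxE addsmxSr.
apply: Sspan; rewrite submxE; apply/eqP/matrixP => i j; rewrite ord1 [RHS]mxE.
have := hl (col j (cokermx A))^T.
rewrite trmxK => h; have : l *m col j (cokermx A) = 0.
  apply: h => d /span; rewrite submxE => /eqP h.
  by rewrite colE mulmxA h mul0mx.
by rewrite colE mulmxA -colE => /matrixP /(_ 0 0); rewrite !mxE.
Qed.
End Annihilator.

Section FiniteElementSpaces.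
Context {R : realType}.
Local Notation pt := 'rV[R]_3.
Local Notation comp := Defs.comp.
Variable Om : bounded_open R.
Local Notation Omega := (bo_set Om).
Local Notation pt3 := (measurableTypeR R * measurableTypeR R * measurableTypeR R)%type.
Local Notation mu := (@mu3 R).

Lemma conforming_lin (V : lmodType R) (P : nat -> set (pt -> V)) (X : set (pt -> V)) Th l Xh :
  @conforming_space R V P X Th l Xh -> linear_space X -> linear_space Xh.
Proof.
move=> [r [Q [hQ ->]]] [X0 Xl]; split.
  split=> // K KTh; have [[Q0 _] _ _] := hQ K KTh.
  by exists (fun=> 0); rewrite ?aeqE //; apply: nearW.
move=> a f g [Xf hf] [Xg hg]; split; first exact: Xl.
move=> K KTh; have [[_ Ql] _ _] := hQ K KTh.
have [p Qp ep] := hf K KTh; have [q Qq eq] := hg K KTh.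
exists (fun x => a *: p x + q x); first exact: Ql.
by move: ep eq; rewrite !aeqE; apply: filterS2 => x h1 h2 Dx; rewrite h1 // h2.
Qed.

Lemma Pol_bounded r (p : @sfield R) (B : R) : Pol r p ->
  exists C, forall x : pt, (forall i, `|x 0 i| <= B) -> `|p x| <= C.
Proof.
move=> [c hc].
exists (\sum_(i < r.+1) \sum_(j < r.+1) \sum_(k < r.+1 | (i + j + k <= r)%N)
   `|c i j k| * B ^+ i * B ^+ j * B ^+ k).
move=> x hx; rewrite hc.
rewrite (le_trans (ler_norm_sum _ _ _)) // ler_sum // => i _.
rewrite (le_trans (ler_norm_sum _ _ _)) // ler_sum // => j _.
rewrite (le_trans (ler_norm_sum _ _ _)) // ler_sum // => k _.
have B0 : 0 <= B by exact: le_trans (hx 0).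
have h m s : `|x 0 s| ^+ m <= B ^+ m by rewrite lerXn2r // nnegrE.
by rewrite !normrM !normrX !ler_pM // ?mulr_ge0 ?exprn_ge0.
Qed.

Lemma thull_bounded (K : @tetra R) : exists B, forall x, thull K x -> forall i, `|x 0 i| <= B.
Proof.
exists (\sum_i \sum_j `|K j i|) => x [lam [l0 _ l1 ->]] i.
rewrite (bigD1 i) //= ler_wpDr ?sumr_ge0 // => [j _|]; first by rewrite sumr_ge0.
rewrite mxE (le_trans (ler_norm_sum _ _ _)) // ler_sum // => j _.
rewrite normrM ler_piMl // ger0_norm // -l1 (bigD1 j) //= lerDl.
by rewrite sumr_ge0.
Qed.

Definition pwpol (Th : seq (@tetra R)) (r : nat) (v : @vfield R) :=
  forall i K, K \in Th -> exists2 p, Pol r p & aeq (thull K) (comp i v) p.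

(** A polynomial is bounded on each tetrahedron, and finitely many tetrahedra cover Omega. *)
Lemma pwpol_bounded Th r v : triangulation Omega Th -> L2v Omega v -> pwpol Th r v -> Bv Om v.
Proof.
move=> [_ hcov _] hL hv i; split; first exact: hL.
have H (s : seq tetra) : (forall K, K \in s -> K \in Th) -> exists C : R,
    {ae mu, forall p : pt3, forall K, K \in s -> thull K (vec3 p) -> `|comp i v (vec3 p)| <= C}.
  elim: s => [_|K s ih hs]; first by exists 0; apply: nearW.
  have [|C hC] := ih; first by move=> L Ls; apply: hs; rewrite inE Ls orbT.
  have [p Pp ep] := hv i K (hs K (mem_head _ _)).
  have [B hB] := thull_bounded K; have [C' hC'] := Pol_bounded B Pp.
  exists (Num.max C C'); move: ep; rewrite aeqE => ep.
  apply: filterS2 hC ep => x h1 h2 L; rewrite inE => /predU1P[->|Ls] hx.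
    by rewrite h2 // le_max (hC' _ (hB _ hx)) orbT.
  by rewrite le_max (h1 L).
have [//|C hC] := H Th; exists C; apply: filterS hC => p h Op.
have : closure Omega (vec3 p) by exact: subset_closure.
by rewrite -hcov => -[K /= KTh hK]; exact: h hK.
Qed.

Lemma conforming_pwpol X Th l (Xh : set (@vfield R)) :
  @conforming_space R 'rV[R]_3 Polv X Th l Xh -> exists r, forall v, Xh v -> pwpol Th r v.
Proof.
move=> [r [Q [hQ ->]]]; exists r => v [_ hv] i K KTh.
have [p Qp ep] := hv K KTh; have [_ _ hP] := hQ K KTh.
exists (comp i p); first exact: hP.
by move: ep; rewrite !aeqE; apply: filterS => x h Dx; rewrite /comp h.
Qed.

Lemma vec_space_pwpol X Th l (Sh : set (@sfield R)) :
  @conforming_space R R^o Pol X Th l Sh -> exists r, forall v, vec_space Sh v -> pwpol Th r v.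
Proof.
move=> [r [Q [hQ ->]]]; exists r => v hv i K KTh.
have [_ /(_ K KTh)[p Qp ep]] := hv i; have [_ _ hP] := hQ K KTh.
by exists p => //; exact: hP.
Qed.

Definition lc n (c : 'rV[R]_n) (e : 'I_n -> @vfield R) : @vfield R :=
  fun x => \sum_i c 0 i *: e i x.

(** Finite dimension modulo null sets comes from counting coefficients: M is the number of triples
    of a component, an element and a multi-exponent, so M + 1 coefficient rows are dependent.
    Counting also the exponents of total degree above r only enlarges M. *)
Lemma pwpol_dependent Th r : triangulation Omega Th -> exists M, forall e : 'I_M.+1 -> @vfield R,
  (forall i, pwpol Th r (e i)) -> exists2 c : 'rV[R]_M.+1, c != 0 & aeq Omega (lc c e) (fun=> 0).
Proof.
move=> [_ hcov _].
pose J := ('I_3 * 'I_(size Th) * ('I_r.+1 * 'I_r.+1 * 'I_r.+1))%type.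
exists #|{: J}| => e he.
have coef (i : 'I_#|{: J}|.+1) : exists a : J -> R, forall s (k : 'I_(size Th)),
    aeq (thull (tnth (in_tuple Th) k)) (comp s (e i))
      (fun x => \sum_(m < r.+1) \sum_(n < r.+1) \sum_(q < r.+1 | (m + n + q <= r)%N)
                a (s, k, (m, n, q)) * x 0 0 ^+ m * x 0 1 ^+ n * x 0 2 ^+ q).
  have h (sk : 'I_3 * 'I_(size Th)) : exists c : nat -> nat -> nat -> R,
     aeq (thull (tnth (in_tuple Th) sk.2)) (comp sk.1 (e i))
      (fun x => \sum_(m < r.+1) \sum_(n < r.+1) \sum_(q < r.+1 | (m + n + q <= r)%N)
                c m n q * x 0 0 ^+ m * x 0 1 ^+ n * x 0 2 ^+ q).
    have [|p [c hc] hp] := he i sk.1 (tnth (in_tuple Th) sk.2); first exact: mem_tnth.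
    by exists c; rewrite (_ : (fun x => _) = p) //; apply/funext => x; rewrite hc.
  have [c hc] := choice h.
  exists (fun j : J => c j.1 j.2.1.1 j.2.1.2 j.2.2) => s k.
  exact: (hc (s, k)).
have [a ha] := choice coef.
pose A : 'M[R]_(#|{: J}|.+1, #|{: J}|) := \matrix_(i, j) a i (enum_val j).
have : (0 < \rank (kermx A))%N.
  by rewrite mxrank_ker subn_gt0 ltnS rank_leq_col.
rewrite lt0n mxrank_eq0 => /rowV0Pn[c /sub_kermxP cA c0].
exists c => //.
have hcA j : \sum_i c 0 i * a i j = 0.
  have /matrixP /(_ 0 (enum_rank j)) := cA; rewrite mxE [RHS]mxE => h.
  by rewrite -[RHS]h; apply: eq_bigr => i _; rewrite mxE enum_rankK.
apply/aeq_vP => s.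
have : {ae mu, forall p : pt3, forall k : 'I_(size Th), thull (tnth (in_tuple Th) k) (vec3 p) ->
    comp s (lc c e) (vec3 p) = 0}.
  have hk (k : 'I_(size Th)) : {ae mu, forall p : pt3, thull (tnth (in_tuple Th) k) (vec3 p) ->
      comp s (lc c e) (vec3 p) = 0}.
    have hi : {ae mu, forall p : pt3, forall i, thull (tnth (in_tuple Th) k) (vec3 p) ->
       comp s (e i) (vec3 p) = \sum_(m < r.+1) \sum_(n < r.+1) \sum_(q < r.+1 | (m + n + q <= r)%N)
                a i (s, k, (m, n, q)) * vec3 p 0 0 ^+ m * vec3 p 0 1 ^+ n * vec3 p 0 2 ^+ q}.
      by apply: filter_forall => i; have := ha i s k; rewrite aeqE.
    apply: filterS hi => p h hK.
    rewrite /comp /lc summxE.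
    under eq_bigr => i _ do rewrite mxE -/(comp s (e i) (vec3 p)) (h i hK).
    move: (vec3 p) => x.
    under eq_bigr => i _ do rewrite mulr_sumr.
    rewrite exchange_big big1 //= => m _.
    under eq_bigr => i _ do rewrite mulr_sumr.
    rewrite exchange_big big1 //= => n _.
    under eq_bigr => i _ do rewrite mulr_sumr.
    rewrite exchange_big big1 //= => q _.
    under eq_bigr => i _ do rewrite !mulrA.
    by rewrite -!mulr_suml hcA !mul0r.
  by apply: filter_forall => k; exact: hk.
rewrite aeqE; apply: filterS => p h Op.
have : closure Omega (vec3 p) by exact: subset_closure.
rewrite -hcov => -[K /= KTh hK].
have [k ek] : exists k : 'I_(size Th), K = tnth (in_tuple Th) k.
  by have /tnthP[k ->] : K \in in_tuple Th by []; exists k.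
transitivity (0 : R); last by rewrite /comp mxE.
by apply: (h k); rewrite -ek; exact: hK.
Qed.

Lemma lcS n (c : 'rV[R]_n.+1) e : lc c e = fun x =>
  c 0 ord0 *: e ord0 x + lc (\row_i c 0 (lift ord0 i)) (fun i => e (lift ord0 i)) x.
Proof.
apply/funext => x; rewrite /lc big_ord_recl; congr (_ + _).
by apply: eq_bigr => i _; rewrite mxE.
Qed.

Lemma lc0 (c : 'rV[R]_0) e : lc c e = fun=> 0.
Proof. by apply/funext => x; rewrite /lc big_ord0. Qed.

Lemma lc_closed (X : set (@vfield R)) n (c : 'rV[R]_n) e : @linear_space R 'rV[R]_3 X ->
  (forall i, X (e i)) -> X (lc c e).
Proof.
move=> [X0 Xl]; elim: n c e => [|n ih] c e he; first by rewrite lc0.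
by rewrite lcS; apply: Xl => //; apply: ih => i; exact: he.
Qed.

Definition lin_on (X : set (@vfield R)) (L : @vfield R -> R) :=
  forall a u v, X u -> X v -> L (fun x => a *: u x + v x) = a * L u + L v.

Lemma lin_on0 X L : @linear_space R 'rV[R]_3 X -> lin_on X L -> L (fun=> 0) = 0.
Proof.
move=> [X0 _] Ll; have := Ll 1 _ _ X0 X0.
rewrite (_ : (fun x => 1 *: (0 : pt) + 0) = fun=> 0); last by apply/funext => x; rewrite scaler0 addr0.
by rewrite mul1r => /eqP; rewrite -subr_eq subrr eq_sym => /eqP.
Qed.

Lemma lin_lc X L n (c : 'rV[R]_n) e : @linear_space R 'rV[R]_3 X -> lin_on X L ->
  (forall i, X (e i)) -> L (lc c e) = \sum_i c 0 i * L (e i).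
Proof.
move=> Xl Ll; elim: n c e => [|n ih] c e he; first by rewrite lc0 big_ord0 (lin_on0 Xl).
rewrite lcS Ll // ?big_ord_recl; last by apply: lc_closed.
by rewrite ih //; congr (_ + _); apply: eq_bigr => i _; rewrite mxE.
Qed.

Lemma linear_L2v : @linear_space R 'rV[R]_3 (L2v Omega).
Proof. by split; [exact: L2v0|move=> a f g; exact: L2v_lin]. Qed.

Lemma vip_lcl n (c : 'rV[R]_n) e v : (forall i, L2v Omega (e i)) -> L2v Omega v ->
  vip Omega (lc c e) v = \sum_i c 0 i * vip Omega (e i) v.
Proof.
move=> he hv; apply: (lin_lc c linear_L2v (L := fun u => vip Omega u v)) => //.
by move=> a f g hf hg; exact: vip_linl.
Qed.

(** Only a bound on the length of independent families is available, not a spanning family to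
    orthogonalize. A longest orthonormal system is taken instead; a field not almost everywhere
    equal to its projection would allow one more vector. *)
Lemma orthonormal_basis Th r (X : set (@vfield R)) : triangulation Omega Th ->
  @linear_space R 'rV[R]_3 X -> (forall v, X v -> L2v Omega v) -> (forall v, X v -> pwpol Th r v) ->
  exists n (e : 'I_n -> @vfield R), [/\ forall i, X (e i),
    forall i j, vip Omega (e i) (e j) = (i == j)%:R &
    forall v, X v -> aeq Omega v (lc (\row_i vip Omega v (e i)) e)].
Proof.
move=> hTh Xl XL2 Xpw.
pose P n := `[< exists e : 'I_n -> @vfield R, (forall i, X (e i)) /\
    forall i j, vip Omega (e i) (e j) = (i == j)%:R >].
have [M hM] := pwpol_dependent r hTh.
(* A system longer than M would contain M + 1 dependent fields; pairing the relation with each of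
   them annihilates its coefficients. *)
have PM : forall n, P n -> (n <= M)%N.
  move=> n /asboolP[e [Xe oe]]; rewrite leqNgt; apply/negP => Mn.
  have [|c c0 hc] := hM (fun i => e (widen_ord Mn i)); first by move=> i; exact: Xpw.
  case/eqP: c0; apply/rowP => j; rewrite mxE.
  have eL i : L2v Omega (e (widen_ord Mn i)) by exact: XL2.
  have := vip_lcl c eL (eL j).
  rewrite (vip_aeql _ (@L2v0 _ Om) _ hc) //; last by apply: lc_closed => //; exact: linear_L2v.
  rewrite (vipC Om) (_ : vip _ _ _ = 0); last first.
    by apply: (lin_on0 linear_L2v (L := fun u => vip Omega (e (widen_ord Mn j)) u)) => a f g hf hg; exact: vip_linr.
  rewrite (bigD1 j) //= big1 => [|i ij].
    by rewrite oe eqxx mulr1 addr0 => <-.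
  by rewrite oe (_ : (_ == _) = false) ?mulr0 //; apply: contraNF ij => /eqP /(congr1 val) /= h; apply/eqP/val_inj.
have P0 : exists n, P n.
  by exists 0%N; apply/asboolP; exists (fun=> fun=> 0); split => -[].
case: (ex_maxnP P0 PM) => n /asboolP[e [Xe oe]] nmax.
exists n, e; split=> // v Xv.
have eL i : L2v Omega (e i) by exact: XL2.
pose u := lc (\row_i vip Omega v (e i)) e.
have Xu : X u by exact: lc_closed.
pose w : @vfield R := fun x => -1 *: u x + v x.
have Xw : X w by case: Xl => _; apply.
have [uL vL wL] : [/\ L2v Omega u, L2v Omega v & L2v Omega w] by split; exact: XL2.
have we i : vip Omega w (e i) = 0.
  rewrite (vip_linl _ uL vL (eL i)) (vip_lcl _ eL (eL i)) (bigD1 i) //= big1 => [|j ji].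
    by rewrite mxE oe eqxx mulr1 addr0 mulN1r addNr.
  by rewrite oe (negbTE ji) mulr0.
have [w0|w0] := eqVneq (vip Omega w w) 0.
  move: (vip_eq0 wL w0); rewrite !aeqE; apply: filterS => p h Op.
  by apply/eqP; rewrite -subr_eq0 -(h Op) /w scaleN1r addrC.
have w_gt0 : 0 < vip Omega w w by rewrite lt_def w0 vip_ge0.
pose s := (Num.sqrt (vip Omega w w))^-1.
(* The trailing 0 gives w' the shape a f + g of the closure and linearity lemmas. *)
pose w' : @vfield R := fun x => s *: w x + 0.
have zL := @L2v0 _ Om.
have w'E g : L2v Omega g -> vip Omega w' g = s * vip Omega w g.
  move=> hg; rewrite (vip_linl s wL zL hg).
  rewrite (lin_on0 linear_L2v (L := fun u => vip Omega u g)) ?addr0 // => a f f' hf hf'.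
  exact: vip_linl.
have Xw' : X w' by case: Xl => X0; apply.
have w'L := XL2 _ Xw'.
have : (n.+1 <= n)%N; last by rewrite ltnn.
apply: nmax; apply/asboolP.
exists (fun i : 'I_n.+1 => if unlift ord0 i is Some j then e j else w'); split.
  by move=> i; case: unliftP => // j _; exact: Xe.
move=> i j; case: unliftP => [i' ->|->]; case: unliftP => [j' ->|->].
- by rewrite oe (inj_eq lift_inj).
- by rewrite (vipC Om) w'E // we mulr0 eq_sym (negbTE (neq_lift _ _)).
- by rewrite w'E // we mulr0 (negbTE (neq_lift _ _)).
- rewrite w'E // (vipC Om) w'E // eqxx mulrA -expr2 /s exprVn sqr_sqrtr ?ltW //.
  by rewrite mulVf.
Qed.

End FiniteElementSpaces.

(** * Linear functionals modulo null sets: representers and multipliers *)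

Section Functionals.
Context {R : realType}.
Local Notation comp := Defs.comp.
Variable Om : bounded_open R.
Local Notation Omega := (bo_set Om).
Implicit Types (X Y : set (@vfield R)) (L : @vfield R -> R).

(* L is linear on X and factors through almost everywhere equality. *)
Definition ae_linear X L := lin_on X L /\ forall u, X u -> aeq Omega u (fun=> 0) -> L u = 0.

Definition domcurl : set (@vfield R) := [set v | exists w, is_wcurl Omega v w].
Definition domdiv : set (@vfield R) := [set v | exists w, is_wdiv Omega v w].

Lemma ae_linear_sub X Y L : ae_linear Y L -> X `<=` Y -> ae_linear X L.
Proof.
move=> [Ll L0] XY; split; first by move=> a u v hu hv; apply: Ll; exact: XY.
by move=> u hu; apply: L0; exact: XY.
Qed.

Lemma ae_linear_comb X a L L' : ae_linear X L -> ae_linear X L' -> ae_linear X (fun v => a * L v + L' v).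
Proof.
move=> [Ll L0] [Ll' L0']; split.
  by move=> b u v hu hv; rewrite Ll // Ll' //; ring.
by move=> u hu u0; rewrite L0 // L0' // mulr0 addr0.
Qed.

Lemma ae_linear0 X : ae_linear X (fun=> 0).
Proof. by split => // a u v _ _; rewrite mulr0 addr0. Qed.

Lemma ae_linearZ X a L : ae_linear X L -> ae_linear X (fun v => a * L v).
Proof.
move=> h; have := ae_linear_comb a h (ae_linear0 X).
by rewrite (_ : (fun v => a * L v + 0) = fun v => a * L v) //; apply/funext => v; rewrite addr0.
Qed.

Lemma ae_linearD X L L' : ae_linear X L -> ae_linear X L' -> ae_linear X (fun v => L v + L' v).
Proof.
move=> h h'; have := ae_linear_comb 1 h h'.
by rewrite (_ : (fun v => 1 * L v + L' v) = fun v => L v + L' v) //; apply/funext => v; rewrite mul1r.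
Qed.

Lemma ae_linearB X L L' : ae_linear X L -> ae_linear X L' -> ae_linear X (fun v => L v - L' v).
Proof.
move=> h h'; have := ae_linear_comb (-1) h' h.
rewrite (_ : (fun v => -1 * L' v + L v) = fun v => L v - L' v) //.
by apply/funext => v; rewrite mulN1r addrC.
Qed.

Lemma ae_linear_congr X L u v : @linear_space R 'rV[R]_3 X -> ae_linear X L -> X u -> X v -> aeq Omega u v -> L u = L v.
Proof.
move=> [X0 Xl] [Ll L0] Xu Xv uv.
have Xd : X (fun x => -1 *: v x + u x) by exact: Xl.
have : L (fun x => -1 *: v x + u x) = 0.
  apply: L0 => //; move: uv; rewrite !aeqE; apply: filterS => p h Op.
  by rewrite h // scaleN1r addNr.
by rewrite Ll // mulN1r addrC => /eqP; rewrite subr_eq0 => /eqP.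
Qed.

Lemma vip_null u v : L2v Omega u -> L2v Omega v -> aeq Omega u (fun=> 0) -> vip Omega u v = 0.
Proof.
move=> hu hv h; rewrite (vip_aeql hu (@L2v0 _ Om) hv h).
apply: (lin_on0 (@linear_L2v _ Om) (L := fun w => vip Omega w v)) => a f g hf hg.
exact: vip_linl.
Qed.

Lemma ae_linear_vipl v : L2v Omega v -> ae_linear (L2v Omega) (fun u => vip Omega u v).
Proof.
move=> hv; split; first by move=> a f g hf hg; exact: vip_linl.
by move=> u hu; exact: vip_null.
Qed.

Lemma ae_linear_vipr v : L2v Omega v -> ae_linear (L2v Omega) (fun u => vip Omega v u).
Proof.
by move=> hv; have := ae_linear_vipl hv; congr ae_linear; apply/funext => u; exact: vipC.
Qed.

Lemma is_wgrad0 : is_wgrad Omega (fun=> 0) (fun=> 0).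
Proof.
split; [exact: L2_0|exact: L2v0|move=> phi hphi].
by rewrite sip0l vip_null ?oppr0 //; [exact: L2v0|exact: vtest_L2|exact: aeq_refl].
Qed.

Lemma is_wcurl0 : is_wcurl Omega (fun=> 0) (fun=> 0).
Proof.
split; [exact: L2v0|exact: L2v0|move=> phi hphi].
by rewrite !vip_null //; [exact: L2v0|exact: vtest_L2|exact: aeq_refl|exact: L2v0|exact: ccurl_L2|exact: aeq_refl].
Qed.

Lemma is_wdiv0 : is_wdiv Omega (fun=> 0) (fun=> 0).
Proof.
split; [exact: L2v0|exact: L2_0|move=> phi hphi].
by rewrite sip0l oppr0 vip_null //; [exact: L2v0|exact: cgrad_L2|exact: aeq_refl].
Qed.

(** The curls of u, v and of their combination are chosen independently, so additivity holds only
    almost everywhere; uniqueness of the weak curl and the invariance of L under null sets repair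
    this. *)
Lemma ae_linear_wcurl L : ae_linear (L2v Omega) L -> ae_linear domcurl (fun u => L (wcurl Omega u)).
Proof.
move=> Lg; split.
  move=> a u v hu hv; have [Ll _] := Lg.
  have h1 := L2v_lin a (wcurl_L2 Om u) (wcurl_L2 Om v).
  rewrite (ae_linear_congr (@linear_L2v _ Om) Lg (wcurl_L2 Om _) h1 (wcurl_lin a hu hv)).
  by apply: Ll; exact: wcurl_L2.
move=> u hu u0; have [_ L0] := Lg; apply: L0; first exact: wcurl_L2.
apply: wcurl_uniq (wcurlP hu) _; apply: is_wcurl_aeq is_wcurl0 (wcurl_dom_L2 hu) _.
exact: aeq_sym.
Qed.

Lemma wdiv_null u : domdiv u -> aeq Omega u (fun=> 0) -> aeq Omega (wdiv Omega u) (fun=> 0).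
Proof.
move=> hu u0.
apply: wdiv_uniq (wdivP hu) _; apply: is_wdiv_aeq is_wdiv0 (wdiv_dom_L2 hu) _.
exact: aeq_sym.
Qed.

Lemma wgrad_null f : H1 Omega f -> aeq Omega f (fun=> 0) -> aeq Omega (wgrad Omega f) (fun=> 0).
Proof.
move=> hf f0.
apply: wgrad_uniq (wgradP hf) _; apply: is_wgrad_aeq is_wgrad0 (H1_L2 hf) _.
exact: aeq_sym.
Qed.

Lemma sip_null f g : L2 Omega f -> L2 Omega g -> aeq Omega g (fun=> 0) -> sip Omega f g = 0.
Proof.
by move=> hf hg h; rewrite (sipC Om) (sip_aeql hg (L2_0 Om) hf h) sip0l.
Qed.

Lemma ae_linear_wdiv f : L2 Omega f -> ae_linear domdiv (fun u => sip Omega f (wdiv Omega u)).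
Proof.
move=> hf; split; last first.
  by move=> u hu u0; apply: sip_null => //; [exact: wdiv_L2|exact: wdiv_null].
move=> a u v hu hv; have h1 := L2_lin a (wdiv_L2 Om u) (wdiv_L2 Om v).
rewrite (sipC Om) (sip_aeql (wdiv_L2 Om _) h1 hf (wdiv_lin a hu hv)).
by rewrite (sip_linl a (wdiv_L2 Om u) (wdiv_L2 Om v) hf) !(sipC Om f).
Qed.

Lemma ae_linear_wdivl f : L2 Omega f -> ae_linear domdiv (fun u => sip Omega (wdiv Omega u) f).
Proof. by move=> hf; have := ae_linear_wdiv hf; congr ae_linear; apply/funext => u; exact: sipC. Qed.

Lemma ae_linear_gradip u : ae_linear (H1v Omega) (fun v => gradip Omega u v).
Proof.
split; last first.
  move=> v hv v0; rewrite /gradip big1 // => i _; rewrite (vipC Om).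
  apply: vip_null; [exact: wgrad_L2|exact: wgrad_L2|apply: wgrad_null => //].
  have /(aeq_vP Om) /(_ i) := v0.
  by rewrite (_ : comp i (fun=> 0) = fun=> 0) //; apply/funext => x; rewrite /comp mxE.
move=> a v w hv hw; rewrite /gradip mulr_sumr -big_split /=; apply: eq_bigr => i _.
rewrite comp_lin.
have h1 := L2v_lin a (wgrad_L2 Om (comp i v)) (wgrad_L2 Om (comp i w)).
have h2 := wgrad_L2 Om (fun x => a * comp i v x + comp i w x).
rewrite (vip_aeqr h2 h1 (wgrad_L2 Om (comp i u)) (wgrad_lin a (hv i) (hw i))).
exact: (vip_linr a (wgrad_L2 Om (comp i v)) (wgrad_L2 Om (comp i w)) (wgrad_L2 Om (comp i u))).
Qed.

Lemma gradipC u v : gradip Omega u v = gradip Omega v u.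
Proof. by rewrite /gradip; apply: eq_bigr => i _; exact: vipC. Qed.

Lemma gradip_ge0 u : 0 <= gradip Omega u u.
Proof. by apply: sumr_ge0 => i _; exact: vip_ge0. Qed.

Lemma ae_linear_gradipl u : ae_linear (H1v Omega) (fun v => gradip Omega v u).
Proof.
have -> : (fun v => gradip Omega v u) = (fun v => gradip Omega u v).
  by apply/funext => v; exact: gradipC.
exact: ae_linear_gradip.
Qed.

Lemma ae_linear_dotl v d : L2v Omega v -> L2 Omega d -> ae_linear (Bv Om) (fun u => sip Omega (fdot u v) d).
Proof.
move=> hv hd; split; last first.
  move=> u hu u0; rewrite (sipC Om); apply: sip_null => //; first exact: fdot_L2.
  move: u0; rewrite !aeqE; apply: filterS => p h Op.
  by rewrite /fdot /dot big1 // => i _; rewrite h // mxE mul0r.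
move=> a u w hu hw.
rewrite -(sip_linl a (fdot_L2 hu hv) (fdot_L2 hw hv) hd); congr sip.
apply/funext => x; rewrite /fdot /dot mulr_sumr -big_split /=; apply: eq_bigr => i _.
by rewrite !mxE; ring.
Qed.

Lemma ae_linear_dotr u d : Bv Om u -> L2 Omega d -> ae_linear (L2v Omega) (fun v => sip Omega (fdot u v) d).
Proof.
move=> hu hd; split; last first.
  move=> v hv v0; rewrite (sipC Om); apply: sip_null => //; first exact: fdot_L2.
  move: v0; rewrite !aeqE; apply: filterS => p h Op.
  by rewrite /fdot /dot big1 // => i _; rewrite h // mxE mulr0.
move=> a v w hv hw.
rewrite -(sip_linl a (fdot_L2 hu hv) (fdot_L2 hu hw) hd); congr sip.
apply/funext => x; rewrite /fdot /dot mulr_sumr -big_split /=; apply: eq_bigr => i _.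
by rewrite !mxE; ring.
Qed.

Lemma ae_linear_crossl L w : ae_linear (L2v Omega) L -> L2v Omega w -> ae_linear (Bv Om) (fun u => L (fcross u w)).
Proof.
move=> [Ll L0] hw; split; last first.
  move=> u hu u0; apply: L0; first exact: fcross_L2.
  move: u0; rewrite !aeqE; apply: filterS => p h Op.
  by apply/rowP => i; rewrite /fcross h // !mxE !mul0r subrr.
move=> a u v hu hv.
rewrite -Ll; [|exact: fcross_L2|exact: fcross_L2]; congr L.
by apply/funext => x; apply/rowP => i; rewrite !mxE; ring.
Qed.

Lemma ae_linear_crossr L u : ae_linear (L2v Omega) L -> Bv Om u -> ae_linear (L2v Omega) (fun w => L (fcross u w)).
Proof.
move=> [Ll L0] hu; split; last first.
  move=> w hw w0; apply: L0; first exact: fcross_L2.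
  move: w0; rewrite !aeqE; apply: filterS => p h Op.
  by apply/rowP => i; rewrite /fcross h // !mxE !mulr0 subrr.
move=> a v w hv hw.
rewrite -Ll; [|exact: fcross_L2|exact: fcross_L2]; congr L.
by apply/funext => x; apply/rowP => i; rewrite !mxE; ring.
Qed.

Lemma riesz X L n (e : 'I_n -> @vfield R) : @linear_space R 'rV[R]_3 X -> ae_linear X L ->
  (forall i, X (e i)) -> (forall v, X v -> aeq Omega v (lc (\row_i vip Omega v (e i)) e)) ->
  forall v, X v -> L v = \sum_i vip Omega v (e i) * L (e i).
Proof.
move=> Xl Lg Xe he v Xv.
rewrite (ae_linear_congr Xl Lg Xv (lc_closed _ Xl Xe) (he v Xv)).
have [Ll _] := Lg; rewrite (lin_lc _ Xl Ll Xe).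
by apply: eq_bigr => i _; rewrite mxE.
Qed.

Lemma riesz_representer X L n (e : 'I_n -> @vfield R) : @linear_space R 'rV[R]_3 X -> ae_linear X L ->
  X `<=` L2v Omega ->
  (forall i, X (e i)) -> (forall v, X v -> aeq Omega v (lc (\row_i vip Omega v (e i)) e)) ->
  forall v, X v -> vip Omega (lc (\row_i L (e i)) e) v = L v.
Proof.
move=> Xl Lg XL2 Xe he v Xv; rewrite (riesz Xl Lg Xe he Xv).
rewrite (vip_lcl _ (fun i => XL2 _ (Xe i)) (XL2 _ Xv)).
by apply: eq_bigr => i _; rewrite mxE mulrC (vipC Om).
Qed.

(** In coordinates on X, the constraints v -> (q, div v) form a subspace S of row vectors. L
    annihilates their common kernel, so its own row vector lies in S by double annihilation, and the
    corresponding q is the multiplier. *)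
Lemma lagrange_multiplier X (Q : set (@sfield R)) L n (e : 'I_n -> @vfield R) :
  @linear_space R 'rV[R]_3 X -> X `<=` domdiv ->
  (forall i, X (e i)) -> (forall v, X v -> aeq Omega v (lc (\row_i vip Omega v (e i)) e)) ->
  @linear_space R R^o Q -> Q `<=` L2 Omega -> ae_linear X L ->
  (forall v, X v -> (forall q, Q q -> sip Omega q (wdiv Omega v) = 0) -> L v = 0) ->
  exists2 p, Q p & forall v, X v -> L v = sip Omega p (wdiv Omega v).
Proof.
move=> Xl Xdiv Xe he [Q0 Ql] QL2 Lg hL.
pose S (d : 'rV[R]_n) := exists2 q, Q q & d = \row_j sip Omega q (wdiv Omega (e j)).
have wL j := wdiv_L2 Om (e j).
have gdiv q : Q q -> ae_linear X (fun v => sip Omega q (wdiv Omega v)).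
  by move=> Qq; exact: ae_linear_sub (ae_linear_wdiv (QL2 _ Qq)) Xdiv.
have [||| q Qq hq] := @double_annihilator R n S _ _ (\row_j L (e j)).
- exists (fun=> 0) => //; apply/rowP => j; rewrite !mxE sip0l //.
- move=> a _ _ [q Qq ->] [q' Qq' ->]; exists (fun x => a *: q x + q' x); first exact: Ql.
  by apply/rowP => j; rewrite !mxE (sip_linl a (QL2 _ Qq) (QL2 _ Qq') (wL j)).
- move=> x hx; apply/rowP => k; rewrite ord1 !mxE.
  have e1 := lin_lc x Xl (proj1 Lg) Xe.
  have : L (lc x e) = 0.
    apply: hL; first exact: lc_closed.
    move=> q Qq; rewrite (lin_lc x Xl (proj1 (gdiv q Qq)) Xe).
    have /(_ (ex_intro2 _ _ q Qq erefl)) /matrixP /(_ 0 0) := hx (\row_j sip Omega q (wdiv Omega (e j))).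
    rewrite mxE [RHS]mxE => h; rewrite -[RHS]h; apply: eq_bigr => j _.
    by rewrite !mxE mulrC.
  rewrite e1 => h; rewrite -[RHS]h; apply: eq_bigr => j _.
  by rewrite !mxE mulrC.
exists q => // v Xv.
rewrite (riesz Xl Lg Xe he Xv) (riesz Xl (gdiv q Qq) Xe he Xv); apply: eq_bigr => j _.
by have /rowP /(_ j) := hq; rewrite !mxE => ->.
Qed.

(** * Fields depending polynomially on coordinates *)

Section PolynomialFamilies.
Variable N : nat.

(* Families of fields sum_j p_j(y) v_j with p_j polynomial and v_j in X. *)
Inductive pvec X : ('rV[R]_N -> @vfield R) -> Prop :=
| pvec_cst v : X v -> pvec X (fun=> v)
| pvec_lin p g g' : polyfun p -> pvec X g -> pvec X g' ->
    pvec X (fun y x => p y *: g y x + g' y x).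

Lemma pvec_in X g : @linear_space R 'rV[R]_3 X -> pvec X g -> forall y, X (g y).
Proof. by move=> [X0 Xl]; elim=> [v Xv//|p {}g g' _ _ ih _ ih' y]; exact: Xl. Qed.

(** L may itself depend on y. This allows a multilinear form with all its arguments depending on y
    to be treated one argument at a time. *)
Lemma polyfun_pvec X (L : @vfield R -> 'rV[R]_N -> R) g : @linear_space R 'rV[R]_3 X ->
  pvec X g -> (forall v, X v -> polyfun (L v)) -> (forall y, ae_linear X (fun v => L v y)) ->
  polyfun (fun y => L (g y) y).
Proof.
move=> Xl hg hL Lg; elim: hg => [v /hL//|p {}g g' hp hg ih hg' ih'].
rewrite (_ : (fun y => _) = fun y => p y * L (g y) y + L (g' y) y).
  by apply: OddSystem.polyfunD => //; exact: OddSystem.polyfunM.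
apply/funext => y; have [Ll _] := Lg y.
by apply: Ll; [exact: (pvec_in Xl hg)|exact: (pvec_in Xl hg')].
Qed.

Lemma polyfun_cstM a (p : 'rV[R]_N -> R) : polyfun p -> polyfun (fun y => a * p y).
Proof. by move=> h; apply: OddSystem.polyfunM => //; exact: OddSystem.polyfun_cst. Qed.

Lemma polyfun_sub (p q : 'rV[R]_N -> R) : polyfun p -> polyfun q -> polyfun (fun y => p y - q y).
Proof.
move=> hp hq; rewrite (_ : (fun y => _) = fun y => p y + -1 * q y).
  by apply: OddSystem.polyfunD => //; exact: polyfun_cstM.
by apply/funext => y; rewrite mulN1r.
Qed.

Lemma pvec_lc X n (c : 'rV[R]_N -> 'rV[R]_n) e : @linear_space R 'rV[R]_3 X ->
  (forall i, X (e i)) -> (forall i, polyfun (fun y => c y 0 i)) -> pvec X (fun y => lc (c y) e).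
Proof.
move=> Xl; elim: n c e => [|n ih] c e Xe hc.
  rewrite (_ : (fun y => _) = fun=> fun=> 0); first by apply: pvec_cst; case: Xl.
  by apply/funext => y; rewrite lc0.
rewrite (_ : (fun y => _) = fun y x => c y 0 ord0 *: e ord0 x +
    lc (\row_i c y 0 (lift ord0 i)) (fun i => e (lift ord0 i)) x); last first.
  by apply/funext => y; rewrite lcS.
apply: pvec_lin => //; first exact: pvec_cst.
apply: ih => // i; rewrite (_ : (fun y => _) = fun y => c y 0 (lift ord0 i)) //.
by apply/funext => y; rewrite mxE.
Qed.

End PolynomialFamilies.

End Functionals.

Section PolynomialForms.
Context {R : realType}.
Variables (Om : bounded_open R) (N : nat).
Implicit Types X Y Z : set (@vfield R).

Lemma polyfun1 X L (g : 'rV[R]_N -> @vfield R) : @linear_space R 'rV[R]_3 X ->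
  pvec X g -> ae_linear Om X L -> polyfun (fun y => L (g y)).
Proof.
move=> Xl hg Lg; apply: (polyfun_pvec (Om := Om) Xl hg (L := fun v _ => L v)) => // v _.
exact: OddSystem.polyfun_cst.
Qed.

Lemma polyfun2 X Y (L : @vfield R -> @vfield R -> R) g h :
  @linear_space R 'rV[R]_3 X -> @linear_space R 'rV[R]_3 Y -> pvec X g -> pvec Y h ->
  (forall v, Y v -> ae_linear Om X (fun u => L u v)) -> (forall u, X u -> ae_linear Om Y (L u)) ->
  polyfun (fun y : 'rV[R]_N => L (g y) (h y)).
Proof.
move=> Xl Yl hg hh L1 L2; apply: (polyfun_pvec (Om := Om) Xl hg (L := fun v y => L v (h y))).
  by move=> v Xv; apply: (polyfun1 Yl hh); exact: L2.
by move=> y; apply: L1; exact: (pvec_in Yl hh).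
Qed.

Lemma polyfun3 X Y Z (L : @vfield R -> @vfield R -> @vfield R -> R) g h k :
  @linear_space R 'rV[R]_3 X -> @linear_space R 'rV[R]_3 Y -> @linear_space R 'rV[R]_3 Z ->
  pvec X g -> pvec Y h -> pvec Z k ->
  (forall v w, Y v -> Z w -> ae_linear Om X (fun u => L u v w)) ->
  (forall u w, X u -> Z w -> ae_linear Om Y (fun v => L u v w)) ->
  (forall u v, X u -> Y v -> ae_linear Om Z (L u v)) ->
  polyfun (fun y : 'rV[R]_N => L (g y) (h y) (k y)).
Proof.
move=> Xl Yl Zl hg hh hk L1 L2 L3.
apply: (polyfun_pvec (Om := Om) Xl hg (L := fun v y => L v (h y) (k y))).
  by move=> u Xu; apply: (polyfun2 Yl Zl hh hk) => [w Zw|v Yv]; [exact: L2|exact: L3].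
by move=> y; apply: L1; [exact: (pvec_in Yl hh)|exact: (pvec_in Zl hk)].
Qed.

Lemma pvecZ X c (g : 'rV[R]_N -> @vfield R) : @linear_space R 'rV[R]_3 X -> pvec X g ->
  pvec X (fun y x => c *: g y x).
Proof.
move=> [X0 _] hg.
rewrite (_ : (fun y => _) = fun y x => (fun=> c) y *: g y x + (fun y x => 0) y x).
  by apply: pvec_lin => //; [exact: OddSystem.polyfun_cst|exact: pvec_cst].
by apply/funext => y; apply/funext => x; rewrite addr0.
Qed.

Lemma pvecD X (g g' : 'rV[R]_N -> @vfield R) : pvec X g -> pvec X g' ->
  pvec X (fun y x => g y x + g' y x).
Proof.
move=> hg hg'.
rewrite (_ : (fun y => _) = fun y x => (fun=> 1) y *: g y x + g' y x).
  by apply: pvec_lin => //; exact: OddSystem.polyfun_cst.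
by apply/funext => y; apply/funext => x; rewrite scale1r.
Qed.

Lemma pvecB X (g g' : 'rV[R]_N -> @vfield R) : @linear_space R 'rV[R]_3 X -> pvec X g -> pvec X g' ->
  pvec X (fun y x => g y x - g' y x).
Proof.
move=> Xl hg hg'.
rewrite (_ : (fun y => _) = fun y x => g y x + (fun y x => -1 *: g' y x) y x).
  by apply: pvecD => //; exact: pvecZ.
by apply/funext => y; apply/funext => x; rewrite scaleN1r.
Qed.

End PolynomialForms.

(** * The discrete problem *)

Section DiscreteProblem.
Context {R : realType}.
Variable Om : bounded_open R.
Local Notation Omega := (bo_set Om).
Local Notation linear X := (@linear_space R 'rV[R]_3 X).
Variables (eta mu0 sigma tau chi0 beta dt : R).
Variables (S U V : set (@vfield R)).
Hypotheses (Sl : linear S) (Ul : linear U) (Vl : linear V).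
Hypotheses (SB : S `<=` Bv Om) (SH1 : S `<=` H1v Omega).
Hypotheses (UB : U `<=` Bv Om) (Ucurl : U `<=` domcurl Om) (VB : V `<=` Bv Om) (Vdiv : V `<=` domdiv Om).
Variables (u0 m0 : @vfield R).
Hypotheses (Su0 : S u0) (Vm0 : V m0).

(* Residuals of the momentum equation, without pressure, and of the
   magnetization equation. *)
Definition momentum (u m k H v : @vfield R) :=
  vip Omega (ddt dt u u0) v - vip Omega (fcross u (wcurl Omega u)) v + eta * gradip Omega u v
  - mu0 * bform Omega v H m - mu0 / 2 * vip Omega (fcross v k) H.

Definition magnetization (u m z k H F : @vfield R) :=
  vip Omega (ddt dt m m0) F + bform Omega u m F + 2^-1 * vip Omega (fcross u F) k
  + tau^-1 * vip Omega m F - 2^-1 * vip Omega (wcurl Omega z) F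
  + sigma * vip Omega (wcurl Omega k) F
  + sigma * sip Omega (wdiv Omega m) (wdiv Omega F)
  - chi0 / tau * vip Omega H F + beta * vip Omega (fcross m (fcross m H)) F.

Let SL2 : S `<=` L2v Omega. Proof. by move=> v /SB; exact: Bv_L2. Qed.
Let UL2 : U `<=` L2v Omega. Proof. by move=> v /UB; exact: Bv_L2. Qed.
Let VL2 : V `<=` L2v Omega. Proof. by move=> v /VB; exact: Bv_L2. Qed.
Let Scurl : S `<=` domcurl Om. Proof. by move=> v /SH1; exact: H1v_wcurl. Qed.

Lemma ddt_L2 v v0 : L2v Omega v -> L2v Omega v0 -> L2v Omega (ddt dt v v0).
Proof.
move=> hv hv0; have h := L2v_lin (-1) hv0 hv.
have := L2v_lin dt^-1 h (@L2v0 _ Om).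
rewrite (_ : (fun x => _) = ddt dt v v0) //.
by apply/funext => x; rewrite /ddt scaleN1r addr0 [in RHS]addrC.
Qed.

Lemma vip_ddt v v0 w : L2v Omega v -> L2v Omega v0 -> L2v Omega w ->
  vip Omega (ddt dt v v0) w = dt^-1 * (vip Omega v w - vip Omega v0 w).
Proof.
move=> hv hv0 hw; have h := L2v_lin (-1) hv0 hv.
have [g _] := ae_linear_vipl hw.
have e := g dt^-1 _ _ h (@L2v0 _ Om).
rewrite (lin_on0 (@linear_L2v _ Om) g) addr0 (vip_linl (-1) hv0 hv hw) mulN1r in e.
rewrite [in RHS]addrC -e; congr vip.
by apply/funext => x; rewrite /ddt scaleN1r addr0 addrC.
Qed.

Lemma ae_linear_momentum u m k H : S u -> V m -> U k -> V H -> ae_linear Om S (momentum u m k H).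
Proof.
move=> Su Vm Uk VH; rewrite /momentum.
have hH := wdiv_L2 Om H; have hm := wdiv_L2 Om m.
apply: ae_linearB; [apply: ae_linearB; [apply: ae_linearD; [apply: ae_linearB|]|]|].
- by apply: (ae_linear_sub _ SL2); apply: ae_linear_vipr; apply: ddt_L2; exact: SL2.
- apply: (ae_linear_sub _ SL2); apply: ae_linear_vipr; apply: fcross_L2; [exact: SB|exact: wcurl_L2].
- by apply: ae_linearZ; apply: (ae_linear_sub _ SH1); exact: ae_linear_gradip.
- apply: ae_linearZ; rewrite /bform; apply: ae_linearB; apply: ae_linearZ.
    by apply: (ae_linear_sub _ SB); apply: ae_linear_dotl => //; exact: VL2.
  by apply: (ae_linear_sub _ SB); apply: ae_linear_dotl => //; exact: VL2.
- apply: ae_linearZ; apply: (ae_linear_sub _ SB); apply: (ae_linear_crossl (L := fun f => vip Omega f H)); last exact: UL2.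
  by apply: ae_linear_vipl; exact: VL2.
Qed.

Lemma ae_linear_magnetization u m z k H : S u -> V m -> U k -> V H -> ae_linear Om V (magnetization u m z k H).
Proof.
move=> Su Vm Uk VH; rewrite /magnetization.
have hH := wdiv_L2 Om H; have hm := wdiv_L2 Om m.
have g w : L2v Omega w -> ae_linear Om V (fun F => vip Omega w F).
  by move=> hw; apply: (ae_linear_sub _ VL2); exact: ae_linear_vipr.
apply: ae_linearD; [apply: ae_linearB; [apply: ae_linearD; [apply: ae_linearD; [apply: ae_linearB;
  [apply: ae_linearD; [apply: ae_linearD; [apply: ae_linearD|]|]|]|]|]|]|].
- by apply: g; apply: ddt_L2; exact: VL2.
- rewrite /bform; apply: ae_linearB; apply: ae_linearZ.
    by apply: (ae_linear_sub _ VL2); apply: ae_linear_dotr => //; exact: SB.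
  by apply: (ae_linear_sub _ Vdiv); apply: ae_linear_wdiv; apply: fdot_L2; [exact: SB|exact: VL2].
- apply: ae_linearZ; apply: (ae_linear_sub _ VL2); apply: (ae_linear_crossr (L := fun f => vip Omega f k)); last exact: SB.
  by apply: ae_linear_vipl; exact: UL2.
- by apply: ae_linearZ; apply: g; exact: VL2.
- by apply: ae_linearZ; apply: g; exact: wcurl_L2.
- by apply: ae_linearZ; apply: g; exact: wcurl_L2.
- by apply: ae_linearZ; apply: (ae_linear_sub _ Vdiv); exact: ae_linear_wdiv.
- by apply: ae_linearZ; apply: g; exact: VL2.
- apply: ae_linearZ; apply: g; apply: fcross_L2; first exact: VB.
  by apply: fcross_L2; [exact: VB|exact: VL2].
Qed.

Section Polynomial.
Variable N : nat.
Variables (u m z k H : 'rV[R]_N -> @vfield R).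
Hypotheses (pu : pvec S u) (pm : pvec V m) (pz : pvec U z) (pk : pvec U k) (pH : pvec V H).

Let Su y : S (u y). Proof. exact: (pvec_in Sl pu). Qed.
Let Vm y : V (m y). Proof. exact: (pvec_in Vl pm). Qed.

Lemma polyfun_momentum v : S v -> polyfun (fun y => momentum (u y) (m y) (k y) (H y) v).
Proof.
move=> Sv; rewrite /momentum.
have vL := SL2 Sv; have vB := SB Sv.
apply: polyfun_sub; [apply: polyfun_sub; [apply: OddSystem.polyfunD; [apply: polyfun_sub|]|]|].
- rewrite (_ : (fun y => _) = fun y => dt^-1 * (vip Omega (u y) v - (fun=> vip Omega u0 v) y)).
    apply: polyfun_cstM; apply: polyfun_sub; last exact: OddSystem.polyfun_cst.
    by apply: (polyfun1 (Om := Om) Sl pu (L := fun a => vip Omega a v)); apply: (ae_linear_sub _ SL2); exact: ae_linear_vipl.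
  by apply/funext => y; apply: vip_ddt => //; exact: SL2.
- apply: (polyfun2 (Om := Om) Sl Sl pu pu (L := fun u w => vip Omega (fcross u (wcurl Omega w)) v)) => w Sw.
    apply: (ae_linear_sub _ SB); apply: (ae_linear_crossl (L := fun f => vip Omega f v)); last exact: wcurl_L2.
    exact: ae_linear_vipl.
  apply: (ae_linear_sub _ Scurl); apply: (ae_linear_wcurl (L := fun f => vip Omega (fcross w f) v)).
  apply: (ae_linear_crossr (L := fun f => vip Omega f v)); last exact: SB.
  exact: ae_linear_vipl.
- apply: polyfun_cstM; apply: (polyfun1 (Om := Om) Sl pu (L := fun a => gradip Omega a v));
  apply: (ae_linear_sub _ SH1); exact: ae_linear_gradipl.
- apply: polyfun_cstM; rewrite /bform; apply: polyfun_sub; apply: polyfun_cstM.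
    apply: (polyfun2 (Om := Om) Vl Vl pm pH (L := fun a b => sip Omega (fdot v a) (wdiv Omega b))) => w Vw.
      by apply: (ae_linear_sub _ VL2); apply: ae_linear_dotr => //; exact: wdiv_L2.
    by apply: (ae_linear_sub _ Vdiv); apply: ae_linear_wdiv; apply: fdot_L2 => //; exact: VL2.
  apply: (polyfun2 (Om := Om) Vl Vl pH pm (L := fun a b => sip Omega (fdot v a) (wdiv Omega b))) => w Vw.
    by apply: (ae_linear_sub _ VL2); apply: ae_linear_dotr => //; exact: wdiv_L2.
  by apply: (ae_linear_sub _ Vdiv); apply: ae_linear_wdiv; apply: fdot_L2 => //; exact: VL2.
- apply: polyfun_cstM.
  apply: (polyfun2 (Om := Om) Ul Vl pk pH (L := fun a b => vip Omega (fcross v a) b)) => w Uw.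
    apply: (ae_linear_sub _ UL2); apply: (ae_linear_crossr (L := fun f => vip Omega f w)) => //.
    by apply: ae_linear_vipl; exact: VL2.
  by apply: (ae_linear_sub _ VL2); apply: ae_linear_vipr; apply: fcross_L2 => //; exact: UL2.
Qed.

Lemma polyfun_magnetization F : V F ->
  polyfun (fun y => magnetization (u y) (m y) (z y) (k y) (H y) F).
Proof.
move=> VF; rewrite /magnetization.
have FL := VL2 VF; have FB := VB VF.
have g : ae_linear Om (L2v Omega) (fun w => vip Omega w F) by exact: ae_linear_vipl.
have gV : ae_linear Om V (fun w => vip Omega w F) by exact: (ae_linear_sub _ VL2).
have gc : ae_linear Om U (fun w => vip Omega (wcurl Omega w) F).
  by apply: (ae_linear_sub _ Ucurl); exact: (ae_linear_wcurl g).
apply: OddSystem.polyfunD; [apply: polyfun_sub; [apply: OddSystem.polyfunD;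
  [apply: OddSystem.polyfunD; [apply: polyfun_sub; [apply: OddSystem.polyfunD;
  [apply: OddSystem.polyfunD; [apply: OddSystem.polyfunD|]|]|]|]|]|]|].
- rewrite (_ : (fun y => _) = fun y => dt^-1 * (vip Omega (m y) F - (fun=> vip Omega m0 F) y)).
    apply: polyfun_cstM; apply: polyfun_sub; last exact: OddSystem.polyfun_cst.
    exact: (polyfun1 (Om := Om) Vl pm gV).
  by apply/funext => y; apply: vip_ddt => //; exact: VL2.
- rewrite /bform; apply: polyfun_sub; apply: polyfun_cstM.
    apply: (polyfun2 (Om := Om) Sl Vl pu pm (L := fun a b => sip Omega (fdot a F) (wdiv Omega b))) => w hw.
      by apply: (ae_linear_sub _ SB); apply: ae_linear_dotl => //; exact: wdiv_L2.
    by apply: (ae_linear_sub _ Vdiv); apply: ae_linear_wdiv; apply: fdot_L2 => //; exact: SB.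
  apply: (polyfun2 (Om := Om) Sl Vl pu pm (L := fun a b => sip Omega (fdot a b) (wdiv Omega F))) => w hw.
    by apply: (ae_linear_sub _ SB); apply: ae_linear_dotl; [exact: VL2|exact: wdiv_L2].
  by apply: (ae_linear_sub _ VL2); apply: ae_linear_dotr; [exact: SB|exact: wdiv_L2].
- apply: polyfun_cstM.
  apply: (polyfun2 (Om := Om) Sl Ul pu pk (L := fun a b => vip Omega (fcross a F) b)) => w hw.
    apply: (ae_linear_sub _ SB); apply: (ae_linear_crossl (L := fun f => vip Omega f w)) => //.
    by apply: ae_linear_vipl; exact: UL2.
  by apply: (ae_linear_sub _ UL2); apply: ae_linear_vipr; apply: fcross_L2 => //; exact: SB.
- by apply: polyfun_cstM; exact: (polyfun1 (Om := Om) Vl pm gV).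
- by apply: polyfun_cstM; exact: (polyfun1 (Om := Om) Ul pz gc).
- by apply: polyfun_cstM; exact: (polyfun1 (Om := Om) Ul pk gc).
- by apply: polyfun_cstM; apply: (polyfun1 (Om := Om) Vl pm
    (L := fun a => sip Omega (wdiv Omega a) (wdiv Omega F))); apply: (ae_linear_sub _ Vdiv); apply: ae_linear_wdivl; exact: wdiv_L2.
- by apply: polyfun_cstM; exact: (polyfun1 (Om := Om) Vl pH gV).
- apply: polyfun_cstM.
  apply: (polyfun3 (Om := Om) Vl Vl Vl pm pm pH (L := fun a b c => vip Omega (fcross a (fcross b c)) F)) => a b Va Vb.
  + apply: (ae_linear_sub _ VB); apply: (ae_linear_crossl g); apply: fcross_L2; [exact: VB|exact: VL2].
  + apply: (ae_linear_sub _ VB); apply: (ae_linear_crossl (L := fun f => vip Omega (fcross a f) F)); last exact: VL2.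
    by apply: (ae_linear_crossr g); exact: VB.
  + apply: (ae_linear_sub _ VL2); apply: (ae_linear_crossr (L := fun f => vip Omega (fcross a f) F)); last exact: VB.
    by apply: (ae_linear_crossr g); exact: VB.
Qed.

End Polynomial.
End DiscreteProblem.

(** * Cancellations and the energy estimate *)

Section TripleProductIntegrals.
Context {R : realType}.
Local Notation pt := 'rV[R]_3.
Variable Om : bounded_open R.
Local Notation Omega := (bo_set Om).

Lemma fcross_swap (u v : @vfield R) : fcross u v = fun x => -1 *: fcross v u x + (0 : pt).
Proof. by apply/funext => x; rewrite addr0; exact: crossC. Qed.

Lemma vip_crossA (u a b : @vfield R) : Bv Om u -> L2v Omega a -> L2v Omega b ->
  vip Omega (fcross u a) b = - vip Omega (fcross u b) a.
Proof.
move=> hu ha hb; rewrite (vip_fdot Omega (_ : _ = fdot a (fcross b u))); last first.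
  by apply/funext => x; exact: dot_cross.
have [g _] := ae_linear_vipr ha.
rewrite (fcross_swap b u) g ?(lin_on0 (@linear_L2v _ Om) g) ?addr0 ?mulN1r ?(vipC Om a) //.
- exact: fcross_L2.
- exact: L2v0.
Qed.

Lemma vip_zero : vip Omega (fun=> 0) (fun=> 0) = 0.
Proof. by apply: vip_null; [exact: L2v0|exact: L2v0|exact: aeq_refl]. Qed.

Lemma fdot_zero : fdot (fun=> 0) (fun=> 0 : pt) = (fun=> 0).
Proof. by apply/funext => x; rewrite /fdot /dot big1 // => i _; rewrite mxE mul0r. Qed.

Lemma vip_crossl (u a : @vfield R) : vip Omega (fcross u a) u = 0.
Proof.
rewrite -vip_zero; apply: vip_fdot; rewrite fdot_zero.
by apply/funext => x; exact: dot_crossl.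
Qed.

(** From the squares of b + a/2 and b - a/2. With weight 1/4 two such products, as occur for H, are
    absorbed by the square of a with half of it to spare. *)
Lemma vip_young (a b : @vfield R) : L2v Omega a -> L2v Omega b ->
  - (4^-1 * vip Omega a a + vip Omega b b) <= vip Omega b a /\
  vip Omega b a <= 4^-1 * vip Omega a a + vip Omega b b.
Proof.
move=> ha hb.
have h c : 0 <= 4^-1 * c ^+ 2 * vip Omega a a + c * vip Omega b a + vip Omega b b.
  have hab := L2v_lin (2^-1 * c) ha hb.
  have := vip_ge0 Om (fun x => (2^-1 * c) *: a x + b x).
  rewrite (vip_linl (2^-1 * c) ha hb hab) (vip_linr (2^-1 * c) ha hb ha) (vip_linr (2^-1 * c) ha hb hb).
  rewrite (vipC Om a b); move: (vip Omega a a) (vip Omega b a) (vip Omega b b) => x y z.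
  by congr (_ <= _); field.
have := h 1; have := h (-1).
move: (vip Omega a a) (vip Omega b a) (vip Omega b b) => x y z; rewrite sqrrN !expr1n mulr1.
by move=> *; split; lra.
Qed.

Lemma sip_young (a b : @sfield R) : L2 Omega a -> L2 Omega b ->
  0 <= sip Omega a a + sip Omega b a + sip Omega b b.
Proof.
move=> ha hb; have hab := L2_lin 2^-1 ha hb.
have := sip_ge0 Om (fun x => 2^-1 * a x + b x).
rewrite (sip_linl 2^-1 ha hb hab) (sip_linr 2^-1 ha hb ha) (sip_linr 2^-1 ha hb hb).
have := sip_ge0 Om a; rewrite (sipC Om a b).
move: (sip Omega a a) (sip Omega b a) (sip Omega b b) => x y z; lra.
Qed.

End TripleProductIntegrals.

Section Energy.
Context {R : realType}.
Variable Om : bounded_open R.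
Local Notation Omega := (bo_set Om).
Local Notation linear X := (@linear_space R 'rV[R]_3 X).
Variables (eta mu0 sigma tau chi0 beta dt : R).
Hypotheses (eta0 : 0 < eta) (mu00 : 0 < mu0) (sigma0 : 0 < sigma) (tau0 : 0 < tau)
  (chi00 : 0 < chi0) (beta0 : 0 < beta) (dt0 : 0 < dt).
Variables (S U V : set (@vfield R)).
Hypotheses (Vl : linear V).
Hypotheses (SB : S `<=` Bv Om).
Hypotheses (UB : U `<=` Bv Om) (VB : V `<=` Bv Om) (Vdiv : V `<=` domdiv Om).
Hypotheses (curlUV : forall v, U v -> V (wcurl Omega v))
  (div_curl : forall v, U v -> aeq Omega (wdiv Omega (wcurl Omega v)) (fun=> 0)).
Variables (u0 m0 Heh : @vfield R).
Hypotheses (Su0 : S u0) (Vm0 : V m0) (VHeh : V Heh).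
Let SL2 : S `<=` L2v Omega. Proof. by move=> v /SB; exact: Bv_L2. Qed.
Let UL2 : U `<=` L2v Omega. Proof. by move=> v /UB; exact: Bv_L2. Qed.
Let VL2 : V `<=` L2v Omega. Proof. by move=> v /VB; exact: Bv_L2. Qed.

Variables (u m z k H : @vfield R).
Hypotheses (Su : S u) (Vm : V m) (Uz : U z) (Uk : U k) (VH : V H).
Hypothesis hz : forall zeta, U zeta -> vip Omega z zeta = vip Omega (fcross u m) zeta.
Hypothesis hk : forall kappa, U kappa -> vip Omega k kappa = vip Omega m (wcurl Omega kappa).
Hypothesis hH : forall G, V G -> aeq Omega (wdiv Omega G) (fun=> 0) -> vip Omega H G = 0.
Hypothesis hP : aeq Omega (wdiv Omega (fun x => m x + H x + Heh x)) (fun=> 0).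

Let P : @vfield R := fun x => 1 *: (1 *: m x + H x) + Heh x.
Let PE : (fun x => m x + H x + Heh x) = P.
Proof. by apply/funext => x; rewrite /P !scale1r. Qed.
Let VmH : V (fun x => 1 *: m x + H x). Proof. by case: Vl => _; exact. Qed.
Let VP : V P. Proof. by case: Vl => _; exact. Qed.

(** H is orthogonal to the divergence-free field m + H + Heh of V. *)
Lemma vip_mH : vip Omega m H = - vip Omega H H - vip Omega Heh H.
Proof.
have := hH VP; rewrite -PE => /(_ hP); rewrite PE (vipC Om).
rewrite (vip_linl 1 (VL2 VmH) (VL2 VHeh) (VL2 VH)) (vip_linl 1 (VL2 Vm) (VL2 VH) (VL2 VH)).
move: (vip Omega m H) (vip Omega H H) (vip Omega Heh H) => x y w; lra.
Qed.

Lemma sip_div_mHHe f : L2 Omega f ->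
  sip Omega (wdiv Omega m) f + sip Omega (wdiv Omega H) f + sip Omega (wdiv Omega Heh) f = 0.
Proof.
move=> hf; have dL := wdiv_L2 Om.
have [g _] := ae_linear_wdivl hf.
have := g 1 _ _ (Vdiv VmH) (Vdiv VHeh); rewrite (g 1 _ _ (Vdiv Vm) (Vdiv VH)) -/P -PE.
rewrite (sipC Om (wdiv Omega (fun x => m x + H x + Heh x))) (sip_null hf (dL _) hP).
by rewrite !mul1r.
Qed.

Lemma energy_momentum : momentum Om eta mu0 dt u0 u m k H u =
  dt^-1 * (vip Omega u u - vip Omega u0 u) + eta * gradip Omega u u
  - mu0 * bform Omega u H m - mu0 / 2 * vip Omega (fcross u k) H.
Proof.
rewrite /momentum (vip_ddt dt (SL2 Su) (SL2 Su0) (SL2 Su)) (vip_crossl Om u (wcurl Omega u)).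
by rewrite subr0.
Qed.

(** Testing the equation of k with z, and that of z with k, gives (curl z, m) = (k, z) = (u x m, k),
    so the two terms with factor 1/2 cancel. Likewise (curl k, m) is the square of k, b(u; m, m) =
    0, the double cross product is orthogonal to m, and (H, m) is rewritten by [vip_mH]. *)
Lemma energy_magnetization_m : magnetization Om sigma tau chi0 beta dt m0 u m z k H m =
  dt^-1 * (vip Omega m m - vip Omega m0 m) + tau^-1 * vip Omega m m
  + sigma * vip Omega k k + sigma * sip Omega (wdiv Omega m) (wdiv Omega m)
  + chi0 / tau * (vip Omega H H + vip Omega Heh H).
Proof.
rewrite /magnetization (vip_ddt dt (VL2 Vm) (VL2 Vm0) (VL2 Vm)).
rewrite (vip_crossl Om m (fcross m H)) (vipC Om H m) vip_mH.
rewrite (vipC Om (wcurl Omega z) m) -(hk Uz) (vipC Om k z) (hz Uk).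
rewrite (vipC Om (wcurl Omega k) m) -(hk Uk) /bform subrr mulr0.
move: (dt^-1 * _) (vip Omega (fcross u m) k) (chi0 / tau) (vip Omega H H) (vip Omega Heh H) => a b c d e.
move: (tau^-1 * _) (sigma * vip Omega k k) (sigma * _) => *; ring.
Qed.

(** The curls of z and k are divergence-free fields of V, hence orthogonal to H. The products of m
    with H and of div m with div H are expressed through H and Heh; b is skew in its last two
    arguments; and moving m across the triple product turns the quartic term into minus the square
    of m x H. *)
Lemma energy_magnetization_H : magnetization Om sigma tau chi0 beta dt m0 u m z k H H =
  - dt^-1 * (vip Omega H H + vip Omega Heh H + vip Omega m0 H)
  - bform Omega u H m - 2^-1 * vip Omega (fcross u k) H
  - tau^-1 * (vip Omega H H + vip Omega Heh H)
  - sigma * (sip Omega (wdiv Omega H) (wdiv Omega H) + sip Omega (wdiv Omega Heh) (wdiv Omega H))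
  - chi0 / tau * vip Omega H H - beta * vip Omega (fcross m H) (fcross m H).
Proof.
rewrite /magnetization (vip_ddt dt (VL2 Vm) (VL2 Vm0) (VL2 VH)).
have hc w : U w -> vip Omega (wcurl Omega w) H = 0.
  by move=> Uw; rewrite (vipC Om); apply: hH; [exact: curlUV|exact: div_curl].
rewrite (hc _ Uz) (hc _ Uk) vip_mH.
have := sip_div_mHHe (wdiv_L2 Om H).
rewrite (vip_crossA (SB Su) (VL2 VH) (UL2 Uk)).
have mH := fcross_L2 (VB Vm) (VL2 VH).
rewrite (vip_crossA (VB Vm) mH (VL2 VH)) /bform.
move: (vip Omega (fcross u k) H) (vip Omega (fcross m H) (fcross m H)) (vip Omega H H)
  (vip Omega Heh H) (vip Omega m0 H) => a b c d e.
move: (sip Omega (wdiv Omega H) (wdiv Omega H)) (sip Omega (wdiv Omega Heh) (wdiv Omega H)) => f g.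
move: (sip Omega (wdiv Omega m) (wdiv Omega H)) => q; rewrite -addrA => /eqP; rewrite addr_eq0 => /eqP ->.
move: (sip Omega (fdot u m) (wdiv Omega H)) (sip Omega (fdot u H) (wdiv Omega m)) => i j.
move: (dt^-1) (tau^-1) => *; ring.
Qed.

(** With weight mu0 the b-term and the cross term of the H-test cancel those of the momentum
    equation. What is left are nonnegative squares and products with the data u0, m0 and Heh, which
    Young's inequality absorbs. *)
Lemma energy_ge :
  2^-1 * dt^-1 * (vip Omega u u + vip Omega m m + mu0 * vip Omega H H)
  - (dt^-1 * (vip Omega u0 u0 + vip Omega m0 m0 + mu0 * (vip Omega Heh Heh + vip Omega m0 m0))
     + (chi0 / tau + mu0 / tau) * vip Omega Heh Heh
     + mu0 * sigma * sip Omega (wdiv Omega Heh) (wdiv Omega Heh))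
  <= momentum Om eta mu0 dt u0 u m k H u + magnetization Om sigma tau chi0 beta dt m0 u m z k H m
     - mu0 * magnetization Om sigma tau chi0 beta dt m0 u m z k H H.
Proof.
rewrite energy_momentum energy_magnetization_m energy_magnetization_H.
have [_] := vip_young (SL2 Su) (SL2 Su0).
have [_] := vip_young (VL2 Vm) (VL2 Vm0).
have [+ _] := vip_young (VL2 VH) (VL2 VHeh).
have [+ _] := vip_young (VL2 VH) (VL2 Vm0).
have := sip_young (wdiv_L2 Om H) (wdiv_L2 Om Heh).
have := gradip_ge0 Om u.
have := vip_ge0 Om u; have := vip_ge0 Om m; have := vip_ge0 Om H; have := vip_ge0 Om k.
have := vip_ge0 Om u0; have := vip_ge0 Om m0; have := vip_ge0 Om Heh.
have := vip_ge0 Om (fcross m H); have := sip_ge0 Om (wdiv Omega m).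
move: (bform Omega u H m) (vip Omega (fcross u k) H) => bf cr.
move: (sip Omega (wdiv Omega m) (wdiv Omega m)) (vip Omega (fcross m H) (fcross m H)) => D X.
move: (vip Omega Heh Heh) (vip Omega m0 m0) (vip Omega u0 u0) (vip Omega k k) => h B0 A0 K.
move: (vip Omega H H) (vip Omega m m) (vip Omega u u) (gradip Omega u u) => C B A G.
move: (sip Omega (wdiv Omega H) (wdiv Omega H)) (sip Omega (wdiv Omega Heh) (wdiv Omega H))
  (sip Omega (wdiv Omega Heh) (wdiv Omega Heh)) => DH hDH dh.
move: (vip Omega m0 H) (vip Omega Heh H) (vip Omega m0 m) (vip Omega u0 u) => mH hH' mm uu.
move=> D0 X0 h0 B00 A00 K0 C0 B0' A0' G0 y1 y2 y3 y4 y5.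
have : 0 < dt^-1 by rewrite invr_gt0.
have : 0 < tau^-1 by rewrite invr_gt0.
move: (dt^-1) (tau^-1) => d t t0 d0.
have p a b : 0 <= a -> 0 <= b -> 0 <= a * b := @mulr_ge0 R a b.
(* The difference of the two sides is the sum of e1 to e12 plus a quarter of e13 + e14. *)
have e1 : 0 <= eta * G by apply: (p) => //; exact: ltW.
have e2 : 0 <= sigma * K by apply: (p) => //; exact: ltW.
have e3 : 0 <= sigma * D by apply: (p) => //; exact: ltW.
have e4 : 0 <= t * B by apply: (p) => //; exact: ltW.
have e5 : 0 <= d * (4^-1 * A + A0 - uu) by apply: (p); [exact: ltW|lra].
have e6 : 0 <= d * (4^-1 * B + B0 - mm) by apply: (p); [exact: ltW|lra].
have e7 : 0 <= chi0 * t * (C + hH' + h) by apply: (p); [apply: (p); exact: ltW|lra].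
have e8 : 0 <= mu0 * d * (2^-1 * C + h + B0 + hH' + mH) by apply: (p); [apply: (p); exact: ltW|lra].
have e9 : 0 <= mu0 * t * (C + hH' + h) by apply: (p); [apply: (p); exact: ltW|lra].
have e10 : 0 <= mu0 * sigma * (DH + hDH + dh) by apply: (p); [apply: (p); exact: ltW|lra].
have e11 : 0 <= mu0 * (chi0 * t) * C by apply: (p) => //; apply: (p); [|apply: (p)]; exact: ltW.
have e12 : 0 <= mu0 * beta * X by apply: (p) => //; apply: (p); exact: ltW.
have e13 : 0 <= d * A by apply: (p) => //; exact: ltW.
have e14 : 0 <= d * B by apply: (p) => //; exact: ltW.
lra.
Qed.

End Energy.

(** * Existence for the abstract discrete problem *)

Section Subspaces.
Context {R : realType}.
Variable Om : bounded_open R.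
Local Notation Omega := (bo_set Om).

(** Two kinds of constraint: for face element fields the divergence itself vanishes, whereas for
    velocities it is only orthogonal to the pressure space. *)
Definition divfree (V : set (@vfield R)) : set (@vfield R) :=
  [set v | V v /\ aeq Omega (wdiv Omega v) (fun=> 0)].
Definition div_orthogonal (S : set (@vfield R)) (Q : set (@sfield R)) : set (@vfield R) :=
  [set v | S v /\ forall q, Q q -> sip Omega q (wdiv Omega v) = 0].

Lemma linear_divfree V : @linear_space R 'rV[R]_3 V -> V `<=` domdiv Om -> @linear_space R 'rV[R]_3 (divfree V).
Proof.
move=> [V0 Vl] Vdiv; split.
  by split=> //; apply: wdiv_null; [exact: Vdiv|exact: aeq_refl].
move=> a u v [Vu hu] [Vv hv]; split; first exact: Vl.
have := wdiv_lin a (Vdiv _ Vu) (Vdiv _ Vv); move: hu hv; rewrite !aeqE => h1 h2 h3.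
by apply: filterS3 h1 h2 h3 => p e1 e2 e3 Op; rewrite e3 // e1 // e2 // mulr0 addr0.
Qed.

Lemma linear_div_orthogonal S Q : @linear_space R 'rV[R]_3 S -> S `<=` domdiv Om -> Q `<=` L2 Omega ->
  @linear_space R 'rV[R]_3 (div_orthogonal S Q).
Proof.
move=> Sl Sdiv QL2; have [S0 Sl'] := Sl.
have gq q : Q q -> lin_on S (fun v => sip Omega q (wdiv Omega v)).
  by move=> /QL2 hq; have [] := ae_linear_sub (ae_linear_wdiv hq) Sdiv.
split; first by split=> // q /gq; exact: (lin_on0 Sl).
move=> a u v [Su hu] [Sv hv]; split; first exact: Sl'.
by move=> q Qq; rewrite (gq q Qq a u v Su Sv) hu // hv // mulr0 addr0.
Qed.

End Subspaces.

Section Existence.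
Context {R : realType}.
Variable Om : bounded_open R.
Local Notation Omega := (bo_set Om).
Local Notation linear X := (@linear_space R 'rV[R]_3 X).
Variables (eta mu0 sigma tau chi0 beta dt : R).
Hypotheses (eta0 : 0 < eta) (mu00 : 0 < mu0) (sigma0 : 0 < sigma) (tau0 : 0 < tau)
  (chi00 : 0 < chi0) (beta0 : 0 < beta) (dt0 : 0 < dt).
Variables (S U V : set (@vfield R)) (Q W : set (@sfield R)).
Hypotheses (Sl : linear S) (Ul : linear U) (Vl : linear V).
Hypotheses (Ql : @linear_space R R^o Q) (Wl : @linear_space R R^o W).
Hypotheses (QL2 : Q `<=` L2 Omega) (WL2 : W `<=` L2 Omega).
Hypotheses (SB : S `<=` Bv Om) (SH1 : S `<=` H1v Omega).
Hypotheses (UB : U `<=` Bv Om) (Ucurl : U `<=` domcurl Om) (VB : V `<=` Bv Om) (Vdiv : V `<=` domdiv Om).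
Hypotheses (curlUV : forall v, U v -> V (wcurl Omega v))
  (div_curl : forall v, U v -> aeq Omega (wdiv Omega (wcurl Omega v)) (fun=> 0))
  (divVW : forall v, V v -> W (wdiv Omega v)).
Variables (u0 m0 Heh : @vfield R).
Hypotheses (Su0 : S u0) (Vm0 : V m0) (VHeh : V Heh).
Let SL2 : S `<=` L2v Omega. Proof. by move=> v /SB; exact: Bv_L2. Qed.
Let UL2 : U `<=` L2v Omega. Proof. by move=> v /UB; exact: Bv_L2. Qed.
Let VL2 : V `<=` L2v Omega. Proof. by move=> v /VB; exact: Bv_L2. Qed.
Let Sdiv : S `<=` domdiv Om. Proof. by move=> v /SH1 h; eexists; exact: H1v_wdiv. Qed.

Local Notation Z := (div_orthogonal Om S Q).
Local Notation V0 := (divfree Om V).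
Let Zl : linear Z. Proof. exact: linear_div_orthogonal. Qed.
Let V0l : linear V0. Proof. exact: linear_divfree. Qed.

Definition onb (X : set (@vfield R)) n (e : 'I_n -> @vfield R) := [/\ forall i, X (e i),
  forall i j, vip Omega (e i) (e j) = (i == j)%:R &
  forall v, X v -> aeq Omega v (lc (\row_i vip Omega v (e i)) e)].

Lemma vip_lc n (e : 'I_n -> @vfield R) X (d : 'rV[R]_n) : onb X e -> X `<=` L2v Omega ->
  vip Omega (lc d e) (lc d e) = \sum_i d 0 i ^+ 2.
Proof.
move=> [Xe oe _] XL2; have eL i := XL2 _ (Xe i).
have dL : L2v Omega (lc d e) by apply: lc_closed => //; exact: linear_L2v.
rewrite (vip_lcl d eL dL); apply: eq_bigr => i _.
rewrite (vipC Om) (vip_lcl d eL (eL i)) (bigD1 i) //= big1 => [|j ji].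
  by rewrite oe eqxx mulr1 addr0 expr2.
by rewrite oe (negbTE ji) mulr0.
Qed.

Variables (nz nv ng nu ns : nat) (a : 'I_nz -> @vfield R) (f : 'I_nv -> @vfield R)
  (g : 'I_ng -> @vfield R) (c : 'I_nu -> @vfield R) (s : 'I_ns -> @vfield R).
Hypotheses (oa : onb Z a) (of_ : onb V f) (og : onb V0 g) (oc : onb U c) (os : onb S s).

Let Sa i : S (a i). Proof. by have [h _ _] := oa; have [] := h i. Qed.
Let Vf i : V (f i). Proof. by have [h _ _] := of_. Qed.
Let V0g i : V0 (g i). Proof. by have [h _ _] := og. Qed.
Let Vg i : V (g i). Proof. by have [] := V0g i. Qed.
Let Uc i : U (c i). Proof. by have [h _ _] := oc. Qed.

(* H is the field orthogonal to V0 for which m := w + mu0 H satisfies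
   m + H + Heh in V0: this sum is w + Heh + (1 + mu0) H, so it has to be
   proj w + proj Heh, that is, (1 + mu0) H = (proj w - w) + E0. *)
Let proj (w : @vfield R) : @vfield R := lc (\row_i vip Omega w (g i)) g.
Let E0 : @vfield R := fun x => proj Heh x - Heh x.
Let Hf (w : @vfield R) : @vfield R := fun x => (1 + mu0)^-1 *: ((proj w x - w x) + E0 x).
Let mf (w : @vfield R) : @vfield R := fun x => (proj w x + E0 x) - Hf w x.
Let kf (m : @vfield R) : @vfield R := lc (\row_i vip Omega m (wcurl Omega (c i))) c.
Let zf (u m : @vfield R) : @vfield R := lc (\row_i vip Omega (fcross u m) (c i)) c.

Let linZ X b v : linear X -> X v -> X (fun x => b *: v x).
Proof.
move=> [X0 Xl] Xv; rewrite (_ : (fun x => _) = fun x => b *: v x + 0); first exact: Xl.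
by apply/funext => x; rewrite addr0.
Qed.

Let linD X u v : linear X -> X u -> X v -> X (fun x => u x + v x).
Proof.
move=> [X0 Xl] Xu Xv; rewrite (_ : (fun x => _) = fun x => 1 *: u x + v x); first exact: Xl.
by apply/funext => x; rewrite scale1r.
Qed.

Let linB X u v : linear X -> X u -> X v -> X (fun x => u x - v x).
Proof.
move=> Xl Xu Xv; rewrite (_ : (fun x => _) = fun x => u x + (fun x => -1 *: v x) x).
  by apply: linD => //; exact: linZ.
by apply/funext => x; rewrite scaleN1r.
Qed.

Let V0proj w : V0 (proj w). Proof. exact: lc_closed. Qed.
Let Vproj w : V (proj w). Proof. by have [] := V0proj w. Qed.
Let VE0 : V E0. Proof. exact: linB. Qed.
Let VHf w : V w -> V (Hf w).
Proof. by move=> Vw; apply: linZ => //; apply: linD => //; exact: linB. Qed.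
Let Vmf w : V w -> V (mf w).
Proof. by move=> Vw; apply: linB => //; [exact: linD|exact: VHf]. Qed.

Let mu1 : 1 + mu0 != 0. Proof. by rewrite gt_eqF // addr_gt0. Qed.

Let mfE w : w = fun x => - mu0 *: Hf w x + mf w x.
Proof.
apply/funext => x; apply/rowP => i; rewrite !mxE.
by move: (proj w x 0 i) (w x 0 i) (proj Heh x 0 i) (Heh x 0 i) => *; field.
Qed.

Let projP w G : V w -> V0 G -> vip Omega (proj w) G = vip Omega w G.
Proof.
move=> Vw V0G; have [_ _ h] := og.
apply: (riesz_representer (L := fun G => vip Omega w G) V0l _ _ V0g h V0G).
  by apply: ae_linear_sub (ae_linear_vipr (VL2 Vw)) _ => v [/VL2].
by move=> v [/VL2].
Qed.

Let HfP w G : V w -> V0 G -> vip Omega (Hf w) G = 0.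
Proof.
move=> Vw V0G; have [/VL2 GL _] := V0G; have [gl _] := ae_linear_vipl GL.
have hl b v v' : V v -> V v' -> vip Omega (fun x => b *: v x + v' x) G = b * vip Omega v G + vip Omega v' G.
  by move=> /VL2 h1 /VL2 h2; exact: gl.
have V00 : V (fun=> 0) by case: Vl.
have vip0 : vip Omega (fun=> 0) G = 0 by apply: (lin_on0 (@linear_L2v _ Om) gl).
have -> : Hf w = fun x => (1 + mu0)^-1 *: (fun x => 1 *: (-1 *: w x + proj w x) + (-1 *: Heh x + proj Heh x)) x + 0.
  by apply/funext => x; rewrite /Hf /E0 addr0 scale1r !scaleN1r ![- _ + _]addrC.
have V1 v v' b : V v -> V v' -> V (fun x => b *: v x + v' x) by case: Vl => _; exact.
rewrite hl //; last by apply: (V1); exact: V1.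
rewrite (hl 1 _ _ (V1 _ _ _ Vw (Vproj w)) (V1 _ _ _ VHeh (Vproj Heh))).
by rewrite (hl _ _ _ Vw (Vproj w)) (hl _ _ _ VHeh (Vproj Heh)) vip0 !projP //; ring.
Qed.

Let divP w : V w -> aeq Omega (wdiv Omega (fun x => mf w x + Hf w x + Heh x)) (fun=> 0).
Proof.
move=> Vw; have -> : (fun x => mf w x + Hf w x + Heh x) = fun x => proj w x + proj Heh x.
  by apply/funext => x; rewrite /mf /E0 subrK addrA subrK.
by have [] := linD V0l (V0proj w) (V0proj Heh).
Qed.

Let Uk m : U (kf m). Proof. exact: lc_closed. Qed.
Let Uz u m : U (zf u m). Proof. exact: lc_closed. Qed.

Let kfP m kappa : V m -> U kappa -> vip Omega (kf m) kappa = vip Omega m (wcurl Omega kappa).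
Proof.
move=> Vm Ukap; have [_ _ h] := oc.
apply: (riesz_representer (L := fun K => vip Omega m (wcurl Omega K)) Ul _ UL2 Uc h Ukap).
by apply: ae_linear_sub (ae_linear_wcurl (ae_linear_vipr (VL2 Vm))) Ucurl.
Qed.

Let zfP u m zeta : S u -> V m -> U zeta -> vip Omega (zf u m) zeta = vip Omega (fcross u m) zeta.
Proof.
move=> Su Vm Uzeta; have [_ _ h] := oc.
apply: (riesz_representer (L := fun K => vip Omega (fcross u m) K) Ul _ UL2 Uc h Uzeta).
apply: ae_linear_sub (ae_linear_vipr _) UL2; apply: fcross_L2; [exact: SB|exact: VL2].
Qed.

Let u_ (y : 'rV[R]_(nz + nv)) : @vfield R := lc (lsubmx y) a.
Let w_ (y : 'rV[R]_(nz + nv)) : @vfield R := lc (rsubmx y) f.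
Let mom y := momentum Om eta mu0 dt u0 (u_ y) (mf (w_ y)) (kf (mf (w_ y))) (Hf (w_ y)).
Let mag y := magnetization Om sigma tau chi0 beta dt m0 (u_ y) (mf (w_ y))
  (zf (u_ y) (mf (w_ y))) (kf (mf (w_ y))) (Hf (w_ y)).
(** Equations are paired with unknowns: momentum is tested with the basis that carries u,
    magnetization with the basis that carries w. This pairing turns the sum of F_i(y) y_i into an
    energy. *)
Let F (i : 'I_(nz + nv)) y := row_mx (\row_j mom y (a j)) (\row_j mag y (f j)) 0 i.

Let Zu y : Z (u_ y). Proof. by have [h _ _] := oa; exact: lc_closed. Qed.
Let Su y : S (u_ y). Proof. by have [] := Zu y. Qed.
Let Vw y : V (w_ y). Proof. exact: lc_closed. Qed.

Let good_mom y : ae_linear Om S (mom y).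
Proof. exact: (ae_linear_momentum eta mu0 dt SB SH1 UB VB Su0 (Su y) (Vmf (Vw y)) (Uk _) (VHf (Vw y))). Qed.

Let good_mag y : ae_linear Om V (mag y).
Proof.
exact: (ae_linear_magnetization sigma tau chi0 beta dt SB UB VB Vdiv Vm0 _ (Su y) (Vmf (Vw y)) (Uk _) (VHf (Vw y))).
Qed.

Let pw : pvec V w_.
Proof.
apply: pvec_lc => // i; rewrite (_ : (fun y => _) = fun y : 'rV[R]_(nz + nv) => y 0 (rshift nz i)).
  exact: OddSystem.polyfun_coord.
by apply/funext => y; rewrite mxE.
Qed.

Let pu : pvec S u_.
Proof.
apply: pvec_lc => // i; rewrite (_ : (fun y => _) = fun y : 'rV[R]_(nz + nv) => y 0 (lshift nv i)).
  exact: OddSystem.polyfun_coord.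
by apply/funext => y; rewrite mxE.
Qed.

Let polyfun_row n (L : 'I_n -> 'rV[R]_(nz + nv) -> R) i : polyfun (L i) ->
  polyfun (fun y => (\row_j L j y) 0 i).
Proof. by congr OddSystem.polyfun; apply/funext => y; rewrite mxE. Qed.

Let pproj : pvec V (fun y => proj (w_ y)).
Proof.
apply: pvec_lc => // i; apply: (polyfun_row (L := fun i y => vip Omega (w_ y) (g i))).
apply: (polyfun1 (Om := Om) Vl pw (L := fun w => vip Omega w (g i))).
by apply: ae_linear_sub (ae_linear_vipl _) VL2; exact: VL2.
Qed.

Let pH : pvec V (fun y => Hf (w_ y)).
Proof.
apply: pvecZ => //; apply: pvecD; first exact: pvecB.
exact: pvec_cst.
Qed.

Let pm : pvec V (fun y => mf (w_ y)).
Proof.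
apply: pvecB => //; apply: pvecD; first exact: pproj.
exact: pvec_cst.
Qed.

Let pk : pvec U (fun y => kf (mf (w_ y))).
Proof.
apply: pvec_lc => // i.
apply: (polyfun_row (L := fun i y => vip Omega (mf (w_ y)) (wcurl Omega (c i)))).
apply: (polyfun1 (Om := Om) Vl pm (L := fun m => vip Omega m (wcurl Omega (c i)))).
by apply: ae_linear_sub (ae_linear_vipl _) VL2; exact: wcurl_L2.
Qed.

Let pz : pvec U (fun y => zf (u_ y) (mf (w_ y))).
Proof.
apply: pvec_lc => // i.
apply: (polyfun_row (L := fun i y => vip Omega (fcross (u_ y) (mf (w_ y))) (c i))).
apply: (polyfun2 (Om := Om) Sl Vl pu pm (L := fun u m => vip Omega (fcross u m) (c i))) => v hv.
  apply: (ae_linear_sub _ SB); apply: (ae_linear_crossl (L := fun f => vip Omega f (c i))); last exact: VL2.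
  by apply: ae_linear_vipl; exact: UL2.
apply: (ae_linear_sub _ VL2); apply: (ae_linear_crossr (L := fun f => vip Omega f (c i))); last exact: SB.
by apply: ae_linear_vipl; exact: UL2.
Qed.

Let polyF i : polyfun (F i).
Proof.
rewrite /F; case: (split_ordP i) => j ->.
  rewrite (_ : (fun y => _) = fun y => mom y (a j)); last by apply/funext => y; rewrite row_mxEl mxE.
  exact: (polyfun_momentum eta mu0 dt Sl Ul Vl SB SH1 UB VB Vdiv Su0 pu pm pk pH (Sa j)).
rewrite (_ : (fun y => _) = fun y => mag y (f j)); last by apply/funext => y; rewrite row_mxEr mxE.
exact: (polyfun_magnetization sigma tau chi0 beta dt Sl Ul Vl SB UB Ucurl VB Vdiv Vm0 pu pm pz pk pH (Vf j)).
Qed.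

Let Cst := dt^-1 * (vip Omega u0 u0 + vip Omega m0 m0 + mu0 * (vip Omega Heh Heh + vip Omega m0 m0))
     + (chi0 / tau + mu0 / tau) * vip Omega Heh Heh
     + mu0 * sigma * sip Omega (wdiv Omega Heh) (wdiv Omega Heh).

Let energyF y : \sum_i F i y * y 0 i = mom y (u_ y) + mag y (mf (w_ y)) - mu0 * mag y (Hf (w_ y)).
Proof.
rewrite big_split_ord /=.
have -> : mom y (u_ y) = \sum_i F (lshift nv i) y * y 0 (lshift nv i).
  have [gl _] := good_mom y; rewrite /u_ (lin_lc _ Sl gl Sa).
  by apply: eq_bigr => i _; rewrite /F row_mxEl !mxE mulrC.
rewrite -addrA; congr (_ + _).
have [gl _] := good_mag y.
have := gl (- mu0) _ _ (VHf (Vw y)) (Vmf (Vw y)); rewrite -(mfE (w_ y)) => h.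
rewrite addrC -mulNr -h /w_ (lin_lc _ Vl gl Vf).
by apply: eq_bigr => i _; rewrite /F row_mxEr !mxE mulrC.
Qed.

Let normy (y : 'rV[R]_(nz + nv)) : \sum_i y 0 i ^+ 2 = vip Omega (u_ y) (u_ y) + vip Omega (w_ y) (w_ y).
Proof.
rewrite big_split_ord /= (vip_lc _ oa) => [|v [/SL2]//]; rewrite (vip_lc _ of_) => [|v /VL2//].
by congr (_ + _); apply: eq_bigr => i _; rewrite mxE.
Qed.

(** As w = m - mu0 H, its square is at most 2 |m|^2 + 2 mu0^2 |H|^2, so |u|^2 + |w|^2 is at most 2
    (1 + mu0) times |u|^2 + |m|^2 + mu0 |H|^2. The energy bound has 1/(2 dt) in front of the latter;
    the two factors combine into the radius. *)
Let coerciveF (y : 'rV[R]_(nz + nv)) : Cst * (4 * (1 + mu0) * dt) < \sum_i y 0 i ^+ 2 -> 0 < \sum_i F i y * y 0 i.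
Proof.
rewrite energyF normy.
have Vm := Vmf (Vw y); have VH := VHf (Vw y).
have := energy_ge eta0 mu00 sigma0 tau0 chi00 beta0 dt0 Vl SB UB VB Vdiv curlUV div_curl Su0 Vm0 VHeh
  (Su y) Vm (Uz _ _) (Uk _) VH (fun zeta => zfP (Su y) Vm) (fun kappa => kfP Vm)
  (fun G VG hG => HfP (Vw y) (conj VG hG)) (divP (Vw y)).
rewrite -/(mom y _) -/(mag y _) -/(mag y _) -/Cst.
have := vip_lin_le (- mu0) (VL2 VH) (VL2 Vm); rewrite -(mfE (w_ y)) sqrrN.
have := vip_ge0 Om (u_ y); have := vip_ge0 Om (mf (w_ y)); have := vip_ge0 Om (Hf (w_ y)).
move: (vip Omega (u_ y) (u_ y)) (vip Omega (mf (w_ y)) (mf (w_ y))) (vip Omega (Hf (w_ y)) (Hf (w_ y))).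
move: (vip Omega (w_ y) (w_ y)) (mom y _ + _ - _) Cst => Wy E Cs A B C C0 B0 A0 hW hE hr.
have h2 : A + Wy <= 2 * (1 + mu0) * (A + B + mu0 * C).
  have : 0 <= mu0 * A by rewrite mulr_ge0 // ltW.
  have : 0 <= mu0 * B by rewrite mulr_ge0 // ltW.
  have : 0 <= mu0 * C by rewrite mulr_ge0 // ltW.
  by rewrite expr2 in hW *; lra.
apply: lt_le_trans hE; rewrite subr_gt0.
have : Cs * (4 * (1 + mu0) * dt) < 2 * (1 + mu0) * (A + B + mu0 * C) by exact: lt_le_trans h2.
have p4 : 0 < 4 * (1 + mu0) * dt by rewrite !mulr_gt0 // addr_gt0.
rewrite -ltr_pdivlMr //; move/lt_le_trans; apply; rewrite le_eqVlt; apply/orP; left; apply/eqP.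
by field; rewrite mu1 gt_eqF.
Qed.

Lemma discrete_solution (He : @vfield R) :
  (forall r, W r -> sip Omega (wdiv Omega Heh) r = sip Omega (wdiv Omega He) r) ->
  exists (u : @vfield R) (p : @sfield R) (m z k H : @vfield R) (phi : @sfield R),
    [/\ S u, Q p & V m] /\ [/\ U z, U k, V H & W phi] /\
    FD_solution Omega eta mu0 sigma tau chi0 beta dt S Q U V W He u0 m0 u p m z k H phi.
Proof.
move=> hHe; have [y hy] := coercive_polynomial_zero polyF coerciveF.
have Vm := Vmf (Vw y); have VH := VHf (Vw y).
have mag0 G : V G -> mag y G = 0.
  move=> VG; have [_ _ h] := of_; rewrite (riesz Vl (good_mag y) Vf h VG) big1 // => i _.
  by have := hy (rshift nz i); rewrite /F row_mxEr mxE => ->; rewrite mulr0.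
have mom0 v : Z v -> mom y v = 0.
  move=> Zv; have [Za _ h] := oa.
  have gz : ae_linear Om Z (mom y) by apply: ae_linear_sub (good_mom y) _ => ? [].
  rewrite (riesz Zl gz Za h Zv) big1 // => i _.
  by have := hy (lshift nv i); rewrite /F row_mxEl mxE => ->; rewrite mulr0.
have [ss _ hs] := os.
have [p Qp hp] := lagrange_multiplier Sl Sdiv ss hs Ql QL2 (good_mom y) (fun v Sv h => mom0 v (conj Sv h)).
(* The minus sign matches (H, G) + (phi, div G) = 0: the multiplier of this functional is phi
   itself. *)
have gH : ae_linear Om V (fun G => - 1 * vip Omega (Hf (w_ y)) G).
  by apply: ae_linearZ; apply: ae_linear_sub (ae_linear_vipr _) VL2; exact: VL2.
have [_ _ hf] := of_.
have [|phi Wphi hphi] := lagrange_multiplier Vl Vdiv Vf hf Wl WL2 gH.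
  (* div G belongs to W, so being orthogonal to W it is orthogonal to itself and vanishes almost
     everywhere; G is then among the fields to which H is orthogonal. *)
  move=> G VG hG; rewrite HfP ?mulr0 //; split=> //.
  by apply: sip_eq0; [exact: wdiv_L2|apply: hG; exact: divVW].
exists (u_ y), p, (mf (w_ y)), (zf (u_ y) (mf (w_ y))), (kf (mf (w_ y))), (Hf (w_ y)), phi.
split; first by split.
split; first by split.
split.
- move=> v Sv; have := hp v Sv; rewrite /mom /momentum.
  move: (sip Omega p _) (_ * bform _ _ _ _) (mu0 / 2 * _) (eta * _) (vip _ (ddt _ _ _) _) (vip _ (fcross _ _) _) => *; lra.
- by move=> q Qq; have [_ h] := Zu y; rewrite (sipC Om) h.
- exact: mag0.
- by move=> zeta Uzeta; rewrite zfP ?subrr.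
- by move=> kappa Ukappa; rewrite kfP ?subrr.
- by move=> G VG; rewrite -hphi // mulN1r subrr.
(* [hHe] trades div He for div Heh against r, and the sum of the three divergences vanishes almost
   everywhere. *)
- move=> r Wr; rewrite (sipDl (wdiv_L2 Om _) (wdiv_L2 Om _) (WL2 Wr)) -hHe //.
  rewrite [X in X + _]addrC.
  exact: (sip_div_mHHe Vl Vdiv VHeh Vm VH (divP (Vw y)) (WL2 Wr)).
Qed.

End Existence.

(** * The finite element scheme as an instance of the discrete problem *)

Section ZeroField.
Context {R : realType}.
Local Notation pt := 'rV[R]_3.
Local Notation comp := Defs.comp.
Variable Om : bounded_open R.
Local Notation Omega := (bo_set Om).

Lemma linear_vec_space (Sh : set (@sfield R)) : @linear_space R R^o Sh -> @linear_space R 'rV[R]_3 (vec_space Sh).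
Proof.
move=> [S0 Sl]; split=> [i|a u v hu hv i]; last by rewrite comp_lin; exact: Sl.
by rewrite (_ : comp i _ = fun=> 0) //; apply/funext => x; rewrite /comp mxE.
Qed.

Lemma conforming_sub (V : lmodType R) (P : nat -> set (pt -> V)) (X : set (pt -> V)) Th l Xh :
  @conforming_space R V P X Th l Xh -> Xh `<=` X.
Proof. by move=> [r [Q [_ ->]]] v []. Qed.

Lemma linear_H0curl : @linear_space R 'rV[R]_3 (H0curl Omega).
Proof.
split=> [|a u v]; last exact: H0curl_lin.
have h0 : domcurl Om (fun=> 0) by exists (fun=> 0); exact: is_wcurl0.
split=> // w hw; rewrite (vip_null (@L2v0 _ Om) (wcurl_L2 Om w) (aeq_refl Om _)) subr0.
by have [_] := ae_linear_wcurl (ae_linear_vipl (H1v_L2 hw)); apply => //; exact: aeq_refl.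
Qed.

Lemma linear_H0div : @linear_space R 'rV[R]_3 (H0div Omega).
Proof.
split=> [|a u v]; last exact: H0div_lin.
have h0 : domdiv Om (fun=> 0) by exists (fun=> 0); exact: is_wdiv0.
split=> // q hq; rewrite (vip_null (@L2v0 _ Om) (wgrad_L2 Om q) (aeq_refl Om _)) add0r.
by have [_] := ae_linear_wdivl (H1_L2 hq); apply => //; exact: aeq_refl.
Qed.

Lemma linear_H01_C0bar : @linear_space R R^o (H01 Omega `&` C0bar Omega).
Proof.
split=> [|a f g [hf cf] [hg cg]]; last by split; [exact: H01_lin|exact: C0bar_lin].
have h0 : H1 Omega (fun=> 0) by exists (fun=> 0); exact: is_wgrad0.
split; last by exists (fun=> 0); [move=> x; exact: cst_continuous|exact: aeq_refl].
split=> // e e0; exists (fun=> 0); first exact: test_function0.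
rewrite /h1norm (_ : (fun x => 0 - 0) = fun=> 0); last by apply/funext => x; rewrite subrr.
rewrite sip0l (vip_null (wgrad_L2 Om _) (wgrad_L2 Om _) (wgrad_null h0 (aeq_refl Om _))).
by rewrite addr0 sqrtr0.
Qed.

End ZeroField.

Theorem theorem4p6 (R : realType)
  (Omega : set 'rV[R]_3)
  (hdom : domain Omega) (hbdd : bounded_set Omega)
  (hsc : simply_connected Omega) (hconv : convex_set Omega)
  (hlip : lipschitz_boundary Omega)
  (eta mu0 sigma tau chi0 beta : R)
  (heta : 0 < eta) (hmu0 : 0 < mu0) (hsigma : 0 < sigma) (htau : 0 < tau)
  (hchi0 : 0 < chi0) (hbeta : 0 < beta)
  (T : R) (hT : 0 < T) (N : nat) (hN : (0 < N)%N)
  (He : R -> @vfield R) (hHe : forall t, 0 <= t <= T -> H0div Omega (He t))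
  (l : nat) (gam theta c : R)
  (hgam : 0 < gam) (htheta : 0 < theta) (hc : 0 < c)
  (Th : seq (@tetra R)) (hTh : triangulation Omega Th)
  (hreg : shape_regular gam Th) (hqu : quasi_uniform theta Th)
  (Sh Sigmah Wh Lh : set (@sfield R)) (Uh Vh : set (@vfield R))
  (hSh : lagrange_space Omega Th l.+1 Sh)
  (hSigmah : lagrange_space Omega Th l Sigmah)
  (hUh : edge_space Omega Th l Uh)
  (hVh : face_space Omega Th l Vh)
  (hWh : pw_poly_space Omega Th l Wh)
  (hLh : pw_poly_space Omega Th l Lh)
  (hexact : exact_sequence Omega (H01 Omega) (H0curl Omega) (H0div Omega)
              (L20 Omega))
  (hexact_h : exact_sequence Omega Sigmah Uh Vh Wh)
  (piS : @sfield R -> @sfield R) (piU piV : @vfield R -> @vfield R)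
  (hpi : commuting_interpolations Omega Sigmah Uh Vh Wh piS piU piV)
  (hinfsup : inf_sup Omega c (vec_space Sh) Lh)
  (n : nat) (hn : (1 <= n <= N)%N)
  (u0 m0 : @vfield R) (hu0 : vec_space Sh u0) (hm0 : Vh m0) :
  let dt := T / N%:R in
  exists (u : @vfield R) (p : @sfield R) (m z k H : @vfield R)
         (phi : @sfield R),
    [/\ vec_space Sh u, Lh p & Vh m] /\ [/\ Uh z, Uh k, Vh H & Wh phi] /\
    FD_solution Omega eta mu0 sigma tau chi0 beta dt
      (vec_space Sh) Lh Uh Vh Wh (He (n%:R * dt)) u0 m0 u p m z k H phi.
Proof.
move=> dt.
have oOm : open Omega by case: hdom.
pose Om := BoundedOpen oOm hbdd.
have Sl : @linear_space R 'rV[R]_3 (vec_space Sh).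
  exact: linear_vec_space (conforming_lin hSh (linear_H01_C0bar Om)).
have Ul : @linear_space R 'rV[R]_3 Uh := conforming_lin hUh (linear_H0curl Om).
have Vl : @linear_space R 'rV[R]_3 Vh := conforming_lin hVh (linear_H0div Om).
have [Ql QL20 _ _ _] := hLh; have [Wl WL20 _ _ _] := hWh.
have [[_ UV VW] _ Vex _] := hexact_h.
have SH1 : vec_space Sh `<=` H1v Omega by move=> v hv i; have [[]] := conforming_sub hSh (hv i).
have SL2 : vec_space Sh `<=` L2v Omega by move=> v /SH1; exact: (H1v_L2 (Om := Om)).
have Uc : Uh `<=` domcurl Om by move=> v /(conforming_sub hUh) [].
have Vd : Vh `<=` domdiv Om by move=> v /(conforming_sub hVh) [].
have UL2 : Uh `<=` L2v Omega by move=> v /Uc; exact: (wcurl_dom_L2 (Om := Om)).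
have VL2 : Vh `<=` L2v Omega by move=> v /Vd; exact: (wdiv_dom_L2 (Om := Om)).
have [rs Spw] := vec_space_pwpol hSh.
have [ru Upw] := conforming_pwpol hUh.
have [rv Vpw] := conforming_pwpol hVh.
have bd X r : X `<=` L2v Omega -> (forall v, X v -> pwpol Th r v) -> X `<=` Bv Om.
  by move=> XL2 Xpw v Xv; exact: (pwpol_bounded (Om := Om) hTh (XL2 v Xv) (Xpw v Xv)).
have SB := bd _ _ SL2 Spw; have UB := bd _ _ UL2 Upw; have VB := bd _ _ VL2 Vpw.
have QL2 : Lh `<=` L2 Omega by move=> q /QL20 [].
have WL2 : Wh `<=` L2 Omega by move=> q /WL20 [].
(* Exactness at V_h, with v itself as the potential of its curl. *)
have div_curl v : Uh v -> aeq Omega (wdiv Omega (wcurl Omega v)) (fun=> 0).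
  by move=> Uv; apply/(Vex _ (UV v Uv)); exists v => //; exact: (aeq_refl Om).
have basis X r : @linear_space R 'rV[R]_3 X -> X `<=` L2v Omega -> (forall v, X v -> pwpol Th r v) ->
    exists n (e : 'I_n -> @vfield R), onb Om X e.
  by move=> Xl XL2 Xpw; exact: (orthonormal_basis (Om := Om) hTh Xl XL2 Xpw).
have Sd : vec_space Sh `<=` domdiv Om by move=> v /SH1 h; eexists; exact: (H1v_wdiv (Om := Om)).
have [nz [a oa]] : exists n (e : 'I_n -> @vfield R), onb Om (div_orthogonal Om (vec_space Sh) Lh) e.
  apply: (basis _ rs); first exact: linear_div_orthogonal.
    by move=> v [/SL2].
  by move=> v [/Spw].
have [ng [g og]] : exists n (e : 'I_n -> @vfield R), onb Om (divfree Om Vh) e.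
  apply: (basis _ rv); first exact: linear_divfree.
    by move=> v [/VL2].
  by move=> v [/Vpw].
have [nv [f ovf]] := basis _ _ Vl VL2 Vpw.
have [nu [k ok]] := basis _ _ Ul UL2 Upw.
have [ns [s os]] := basis _ _ Sl SL2 Spw.
(* The interpolant of the external field plays the part of Heh: it lies in V_h, and since
   interpolation commutes with the L^2 projection its divergence has the same products with W_h as
   that of the field. *)
have [[_ _ [piVh _ _]] _ _ piVdiv] := hpi.
have dt0 : 0 < dt by rewrite /dt divr_gt0 // ltr0n.
have He0 : H0div Omega (He (n%:R * dt)).
  apply: hHe; apply/andP; split; first by rewrite mulr_ge0 // ltW.
  rewrite /dt mulrCA ger_pMr // ler_pdivrMr ?ltr0n //.
  by rewrite mul1r ler_nat; case/andP: hn.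
exact: (discrete_solution (Om := Om) heta hmu0 hsigma htau hchi0 hbeta dt0 Sl Ul Vl Ql Wl QL2 WL2 SB SH1
  UB Uc VB Vd UV div_curl VW hu0 hm0 (piVh _ He0) oa ovf og ok os (proj2 (piVdiv _ He0))).
Qed.
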